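(* Fix $\rho\in(0,1)$ and $\kappa\in(0,1)$. Let $\boldsymbol\sigma\sim\mathbb P$, where $\mathbb P$ is the quadratic interaction model with coupling matrix $A_n$, field vector $c\in\mathbb R^n$ and base measures $\mu_1,\dots,\mu_n$, and suppose $\|A_n\|_4\le\rho$. Let $q\in\mathbb R^n$ with $\|q\|=1$, let $u$ be the Mean-Field optimizer and $T_n^*(\boldsymbol\sigma)=\sum_{i=1}^nq_i(\sigma_i-u_i)$. Let $\nu_i=\sum_{j=1}^nA_n(i,j)\psi_j'(c_j)$, assume that $$\upsilon_n:=\sum_{i=1}^nq_i^2\psi_i''(c_i)\ge\kappa,$$ and define $$R_{1n}=\sum_{i=1}^n\Big(\sum_{j=1}^nA_n(i,j)q_j(\psi_j''(c_j)-\upsilon_n)\Big)^2,\qquad R_{2n}=\sum_{i=1}^n\nu_i^2,\qquad R_{3n}=\sum_{i=1}^n\nu_i^4.$$ Fix $\lambda_n\in\mathbb R$ with $|\lambda_n|\le\rho$, set $\boldsymbol\epsilon=A_nq-\lambda_nq$, and let $W_n\sim N\big(0,\frac{\upsilon_n}{1-\lambda_n\upsilon_n}\big)$. Then $$d_{KS}\big(T_n^*(\boldsymbol\sigma),W_n\big)\lesssim\sqrt{R_{1n}}+\sqrt{\alpha_nR_{2n}}+\sqrt{R_{3n}}+\sqrt n\,\alpha_n+\|q\|_\infty+\|\boldsymbol\epsilon\|,$$ where the implicit constant depends only on $\rho$ and $\kappa$.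
   Context: Model: $\mu_1,\dots,\mu_n$ are non-degenerate probability measures supported on $[-1,1]$, with both $-1$ and $1$ in the support of each $\mu_i$; $A_n$ is a real symmetric $n\times n$ matrix with zero diagonal; $c\in\mathbb R^n$ is deterministic. The quadratic interaction model $\mathbb P$ is the probability measure on $[-1,1]^n$ with $$\frac{d\mathbb P}{d\prod_{i=1}^n\mu_i}(\boldsymbol\sigma)=\frac1{Z_n}\exp\Big(\tfrac12\boldsymbol\sigma^\top A_n\boldsymbol\sigma+c^\top\boldsymbol\sigma\Big).$$ Norms: $\|\cdot\|,\|\cdot\|_\infty$ are the $\ell_2$ and $\ell_\infty$ norms of vectors; $\|A_n\|_4$ is the $\ell_4\to\ell_4$ operator norm. Put $\alpha_n=\max_{1\le i\le n}\sum_{j=1}^nA_n(i,j)^2$. $d_{KS}(X,Y)=\sup_{t\in\mathbb R}|P(X\le t)-P(Y\le t)|$. Mean-Field optimizer: let $\psi_i(\theta)=\log\int e^{\theta z}\,d\mu_i(z)$, let $\phi_i:(-1,1)\to\mathbb R$ be the inverse of $\psi_i':\mathbb R\to(-1,1)$, and let $I_i(z)=z\phi_i(z)-\psi_i(\phi_i(z))$ (extended to $z=\pm1$ by its limits in $[0,\infty]$). Let $F(z)=\frac12z^\top A_nz+z^\top c-\sum_iI_i(z_i)$ on $[-1,1]^n$. When $\|A_n\|<1$ in $\ell_2$ operator norm (in particular when $\|A_n\|_4<1$), $F$ has a unique maximizer $u\in(-1,1)^n$, and it satisfies $u_i=\psi_i'(s_i+c_i)$ with $s_i=\sum_jA_n(i,j)u_j$.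 *)

(* Defs.v *)
From HB Require Import structures.
From mathcomp Require Import all_boot all_order all_algebra.
From mathcomp Require Import all_classical all_reals all_analysis.

Set Implicit Arguments.
Unset Strict Implicit.
Unset Printing Implicit Defensive.

Import Order.TTheory GRing.Theory Num.Theory.
Import numFieldNormedType.Exports.

Local Open Scope classical_set_scope.
Local Open Scope ring_scope.

Section norms.
Context {R : realType}.

Definition lpnorm (p : nat) (n : nat) (x : 'cV[R]_n) : R :=
  (\sum_i `|x i 0| ^+ p) `^ (p%:R^-1).

Definition opnorm (p : nat) (n : nat) (A : 'M[R]_n) : R :=
  sup [set lpnorm p (A *m x) | x in [set x | lpnorm p x <= 1]].

End norms.

(* Product of n probability measures on the line, built by iterating the
   binary product [\x] and transporting along (x, t) |-> x :: t. *)
Section product.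
Context {R : realType}.

Definition tuple_cons (n : nat) (x : R * n.-tuple R) : n.+1.-tuple R :=
  [the n.+1.-tuple R of x.1 :: x.2].

Lemma measurable_tuple_cons (n : nat) : measurable_fun setT (@tuple_cons n).
Proof. exact: measurable_cons. Qed.

HB.instance Definition _ (n : nat) :=
  isMeasurableFun.Build _ _ _ _ (@tuple_cons n) (@measurable_tuple_cons n).

Fixpoint prod_prob (n : nat) :
    ('I_n -> probability R R) -> probability (n.-tuple R) R :=
  match n return ('I_n -> probability R R) -> probability (n.-tuple R) R with
  | 0 => fun _ => dirac [tuple]
  | m.+1 => fun mu => distribution
      (mu ord0 \x prod_prob (fun i : 'I_m => mu (lift ord0 i)))%E
      (@tuple_cons m)
  end.

Lemma prod_prob_box (n : nat) (mu : 'I_n -> probability R R)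
    (B : 'I_n -> set R) : (forall i, measurable (B i)) ->
  (prod_prob mu [set t | forall i, B i (tnth t i)] = \prod_i mu i (B i))%E.
Proof.
elim: n mu B => [|n IH] mu B mB.
  rewrite big_ord0 /= diracE mem_set//; first by move=> [].
rewrite big_ord_recl -IH //=.
rewrite /distribution /pushforward /=.
rewrite -product_measure1E //.
  congr (_ _); apply/seteqP; split=> [[x t] /= H|[x t] /= [H0 H1] i].
    split; first by have := H ord0; rewrite /tuple_cons.
    by move=> i; have := H (lift ord0 i); rewrite /tuple_cons tnthS.
  by case: (unliftP ord0 i) => [j|] ->; rewrite /tuple_cons ?tnthS.
rewrite [X in measurable X](_ : _ =
   \bigcap_(i in [set: 'I_n]) ((@tnth n R)^~ i @^-1` (B (lift ord0 i)))).
  apply: fin_bigcap_measurable => // i _.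
  by rewrite -[X in measurable X]setTI; exact: measurable_tnth.
by apply/seteqP; split=> [t H i _|t H i]; exact: H.
Qed.

End product.

Section model.
Context {R : realType}.
Implicit Type m : probability R R.

Definition in_support m (x : R) : Prop :=
  forall U : set R, open U -> U x -> (0 < m U)%E.

Definition base_measure m : Prop :=
  [/\ m `[-1, 1]%classic = 1%E,
      forall x, m [set x] <> 1%E,
      in_support m (-1) & in_support m 1].

Variables (n : nat) (mu : 'I_n -> probability R R) (A : 'M[R]_n) (c : 'cV[R]_n).

Definition energy (x : 'cV[R]_n) : R :=
  2^-1 * (x^T *m A *m x) 0 0 + (c^T *m x) 0 0.

Definition gibbs_weight (s : n.-tuple R) : R := expR (energy (\col_i tnth s i)).

Definition partition_fun : R := \int[prod_prob mu]_s gibbs_weight s.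

(* A law on the whole space, carried by the cube since each mu i is carried by
   [-1, 1]. *)
Definition gibbs (B : set (n.-tuple R)) : \bar R :=
  (\int[prod_prob mu]_(s in B) (gibbs_weight s / partition_fun)%:E)%E.

Definition psi m (theta : R) : R := ln (\int[m]_z expR (theta * z)).

(* For a base measure, psi' is a bijection from the line onto ]-1, 1[; phi is
   its inverse there and is never evaluated elsewhere. *)
Definition phi m : R -> R := 'pinv_(fun=> 0) setT (psi m)^`()%classic.

(* The endpoint values are limits in \bar R, possibly +oo; values outside of
   [-1, 1] are junk and never used. *)
Definition rate m (z : R) : \bar R :=
  let I x := (x * phi m x - psi m (phi m x))%:E in
  if z == 1 then lim (I x @[x --> 1^'-])
  else if z == -1 then lim (I x @[x --> (-1)^'+])
  else I z.

Definition mf_functional (z : 'cV[R]_n) : \bar R :=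
  ((energy z)%:E - \sum_i rate (mu i) (z i 0%R))%E.

Definition cube : set 'cV[R]_n := [set z | forall i, -1 <= z i 0 <= 1].

Definition mf_optimizer (u : 'cV[R]_n) : Prop :=
  cube u /\ forall z, cube z -> (mf_functional z <= mf_functional u)%E.

Definition alpha : R := \big[Num.max/0]_i \sum_j A i j ^+ 2.

Definition nu (i : 'I_n) : R := \sum_j A i j * (psi (mu j))^`()%classic (c j 0).

Variable q : 'cV[R]_n.

Definition upsilon : R := \sum_i q i 0 ^+ 2 * (psi (mu i))^`(2)%classic (c i 0).

Definition R1 : R :=
  \sum_i (\sum_j A i j * q j 0 * ((psi (mu j))^`(2)%classic (c j 0) - upsilon)) ^+ 2.

Definition R2 : R := \sum_i nu i ^+ 2.

Definition R3 : R := \sum_i nu i ^+ 4.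

Definition Tstar (u : 'cV[R]_n) (s : n.-tuple R) : R :=
  \sum_i q i 0 * (tnth s i - u i 0).

End model.

Section laws.
Context {R : realType}.

Definition has_law d d' (T : measurableType d) (T' : measurableType d')
    (P : probability T R) (X : {RV P >-> T'}) (m : set T' -> \bar R) : Prop :=
  forall B, measurable B -> distribution P X B = m B.

Definition dKS d d' (T : measurableType d) (T' : measurableType d')
    (P : probability T R) (P' : probability T' R)
    (X : T -> R) (Y : T' -> R) : R :=
  sup [set `|fine (P [set w | X w <= t]) - fine (P' [set w | Y w <= t])|
      | t in [set: R]].

End laws.

(* Main.v *)
Require Import Defs.
From mathcomp Require Import all_boot all_order all_algebra.
From mathcomp Require Import all_classical all_reals all_analysis.
From mathcomp Require Import measurable_realfun lebesgue_integral_under ring lra.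

Set Implicit Arguments.
Unset Strict Implicit.
Unset Printing Implicit Defensive.

Import Order.TTheory GRing.Theory Num.Theory.
Import numFieldNormedType.Exports.

Local Open Scope classical_set_scope.
Local Open Scope ring_scope.

(* Stein's method. Replacing each coordinate of the spin vector by its
   conditional mean b_i = psi_i'(t_i + s_i + c_i), where t_i is the fluctuation
   of the i-th local field around its mean-field value s_i, turns the statistic
   into an approximate solution of the Stein equation of the limiting normal
   law: the residuals sigma_i - b_i are orthogonal to every function of the
   other coordinates. Since the coupling contracts l4, the fluctuations are
   controlled by linear statistics of the residuals, whose fourth moments are
   bounded through the same orthogonality, so that E sum_i t_i^4 is at most of
   order n alpha^2; the mean-field values satisfy sum_i s_i^4 <= C R3 for the same
   reason. Expanding b_i to second order and inverting the linear part (a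
   resolvent bounded by 1 / (1 - rho)) leaves the error terms of the statement.
   The jump of the Stein solution at the threshold is handled by a concentration
   inequality, obtained by testing the orthogonality relations on a clipped
   linear function. *)

(** * Finite sums and matrix norms *)

(** In the core argument an expectation enters only through positivity, linearity and two
    orthogonality relations, for the residuals and for their centred squares. Every moment bound
    thus reduces to how much a function moves when one coordinate is reset to 0. In these
    oscillations the first-order response keeps A inside a signed sum, because entrywise absolute
    values would lose the operator norm. Fourth powers are forced by the Taylor remainder: it is
    paired with weights known only in l2, so Cauchy-Schwarz asks for the sum of t_i^4, and n rows of
    squared norm at most alpha contribute n alpha^2. When sqrt(n) alpha exceeds 1 the bound is
    trivial. The limiting variance appears as follows. Let D be the diagonal matrix of the
    psi_i''(c_i). Then A D q is close to upsilon A q (error R1), hence to lambda upsilon q (error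
    epsilon). So (1 - lambda upsilon) T is close to the sum of the q_i (sigma_i - b_i), whose terms
    have squares adding up to nearly upsilon. Therefore (1 - lambda upsilon) E T f(T) is close to
    upsilon E f'(T), the Stein identity of variance upsilon / (1 - lambda upsilon). *)

Section finite_sums.
Context {R : realFieldType}.

Lemma sum_CauchySchwarz (I : finType) (a b : I -> R) :
  (\sum_i a i * b i) ^+ 2 <= (\sum_i a i ^+ 2) * (\sum_i b i ^+ 2).
Proof.
set X := \sum_i a i ^+ 2; set Y := \sum_i b i ^+ 2; set Z := \sum_i a i * b i.
have Y0 : 0 <= Y by apply: sumr_ge0 => i _; exact: sqr_ge0.
have H (s : R) : 0 <= X - 2 * s * Z + s ^+ 2 * Y.
  rewrite /X /Y /Z !mulr_sumr -sumrB -big_split/=; apply: sumr_ge0 => i _.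
  by rewrite (_ : _ + _ = (a i - s * b i) ^+ 2); [exact: sqr_ge0|ring].
have [Y_eq0|Y_neq0] := eqVneq Y 0.
  have [->|Z_neq0] := eqVneq Z 0; first by rewrite Y_eq0 expr0n mulr0.
  have := H ((X + 1) / (2 * Z)); rewrite Y_eq0 mulr0 addr0.
  rewrite (_ : X - _ = - 1) ?oppr_ge0 ?ler10//.
  by field.
have Y_gt0 : 0 < Y by rewrite lt_def Y_neq0.
have := H (Z / Y).
rewrite (_ : X - _ + _ = (X * Y - Z ^+ 2) / Y); last by field.
by rewrite pmulr_lge0 ?invr_gt0// subr_ge0.
Qed.

Lemma ler_sum_sqr_mul (I : finType) (a b : I -> R) :
  \sum_i a i * b i <= (\sum_i a i ^+ 2 + \sum_i b i ^+ 2) / 2.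
Proof.
rewrite -big_split/= mulr_suml; apply: ler_sum => i _.
have := sqr_ge0 (a i - b i); lra.
Qed.

End finite_sums.

Section convexity.
Context {R : realFieldType}.
Implicit Types r y z : R.

(** Convexity of the square applied to [(1 - r) * (y / (1 - r)) + r * (z / r)]. The weight [r] goes
    to the term that a contraction of ratio [r] will shrink, so that it can be absorbed
    afterwards. *)
Lemma sqrD_le_weighted r y z : 0 < r < 1 ->
  (y + z) ^+ 2 <= y ^+ 2 / (1 - r) + z ^+ 2 / r.
Proof.
move=> /andP[r0 r1].
have ? : r != 0 by rewrite gt_eqF.
have ? : 1 - r != 0 by rewrite subr_eq0 gt_eqF.
rewrite -subr_ge0 (_ : _ - _ = (r * y - (1 - r) * z) ^+ 2 / (r * (1 - r))).
  by rewrite divr_ge0 ?sqr_ge0// mulr_ge0 ?subr_ge0 ?ltW.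
by field; apply/andP; split.
Qed.

Lemma expr4D_le_weighted r y z : 0 < r < 1 ->
  (y + z) ^+ 4 <= y ^+ 4 / (1 - r) ^+ 3 + z ^+ 4 / r ^+ 3.
Proof.
move=> r01; have /andP[r0 r1] := r01.
have ? : r != 0 by rewrite gt_eqF.
have ? : 1 - r != 0 by rewrite subr_eq0 gt_eqF.
rewrite -[4%N]/(2 * 2)%N exprM.
apply: (@le_trans _ _ ((y ^+ 2 / (1 - r) + z ^+ 2 / r) ^+ 2)).
  rewrite ler_pXn2r ?nnegrE ?sqr_ge0// ?sqrD_le_weighted//.
  by rewrite addr_ge0// divr_ge0 ?sqr_ge0 ?subr_ge0// ltW.
apply: (le_trans (sqrD_le_weighted _ _ r01)).
rewrite le_eqVlt; apply/orP; left; apply/eqP; field; exact/andP.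
Qed.

(** [w] may depend nonlinearly on [t], so no matrix is inverted. The weighted split makes the
    contracted term at most [r] times the left-hand side; moving it across leaves a factor [1 - r],
    which joins the one produced by convexity. *)
Lemma l2_contraction {n} (M : 'I_n -> 'I_n -> R) (t y w : 'I_n -> R) r :
  0 < r < 1 ->
  (forall x : 'I_n -> R,
    \sum_i (\sum_j M i j * x j) ^+ 2 <= r ^+ 2 * \sum_i x i ^+ 2) ->
  (forall i, t i = y i + \sum_j M i j * w j) -> (forall i, `|w i| <= `|t i|) ->
  \sum_i t i ^+ 2 <= (\sum_i y i ^+ 2) / (1 - r) ^+ 2.
Proof.
move=> r01 M2 tE wt; have /andP[r0 r1] := r01.
have ? : r != 0 by rewrite gt_eqF.
have ? : 1 - r != 0 by rewrite subr_eq0 gt_eqF.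
have H1 : \sum_i t i ^+ 2 <=
    (\sum_i y i ^+ 2) / (1 - r) + (\sum_i (\sum_j M i j * w j) ^+ 2) / r.
  rewrite !mulr_suml -big_split/=; apply: ler_sum => i _; rewrite tE.
  exact: sqrD_le_weighted.
have H2 : \sum_i w i ^+ 2 <= \sum_i t i ^+ 2.
  apply: ler_sum => i _; rewrite -[w i ^+ 2]real_normK ?num_real//.
  by rewrite -[t i ^+ 2]real_normK ?num_real// ler_pXn2r// nnegrE.
have H3 : (\sum_i (\sum_j M i j * w j) ^+ 2) / r <= r * \sum_i t i ^+ 2.
  rewrite ler_pdivrMr// mulrAC -expr2; apply: (le_trans (M2 w)).
  by rewrite ler_pM2l ?exprn_gt0.
rewrite ler_pdivlMr ?exprn_gt0 ?subr_gt0//.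
have : (\sum_i t i ^+ 2) * (1 - r) <= (\sum_i y i ^+ 2) / (1 - r) by lra.
by rewrite ler_pdivlMr ?subr_gt0// -mulrA -expr2.
Qed.

Lemma l4_contraction {n} (M : 'I_n -> 'I_n -> R) (t y w : 'I_n -> R) r :
  0 < r < 1 ->
  (forall x : 'I_n -> R,
    \sum_i (\sum_j M i j * x j) ^+ 4 <= r ^+ 4 * \sum_i x i ^+ 4) ->
  (forall i, t i = y i + \sum_j M i j * w j) -> (forall i, `|w i| <= `|t i|) ->
  \sum_i t i ^+ 4 <= (\sum_i y i ^+ 4) / (1 - r) ^+ 4.
Proof.
move=> r01 M4 tE wt; have /andP[r0 r1] := r01.
have ? : r != 0 by rewrite gt_eqF.
have ? : 1 - r != 0 by rewrite subr_eq0 gt_eqF.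
have H1 : \sum_i t i ^+ 4 <= (\sum_i y i ^+ 4) / (1 - r) ^+ 3 +
    (\sum_i (\sum_j M i j * w j) ^+ 4) / r ^+ 3.
  rewrite !mulr_suml -big_split/=; apply: ler_sum => i _; rewrite tE.
  exact: expr4D_le_weighted.
have H2 : \sum_i w i ^+ 4 <= \sum_i t i ^+ 4.
  apply: ler_sum => i _; rewrite -[4%N]/(2 * 2)%N !exprM.
  rewrite -[w i ^+ 2]real_normK ?num_real// -[t i ^+ 2]real_normK ?num_real//.
  by rewrite -!exprM ler_pXn2r// nnegrE.
have H3 : (\sum_i (\sum_j M i j * w j) ^+ 4) / r ^+ 3 <= r * \sum_i t i ^+ 4.
  rewrite ler_pdivrMr ?exprn_gt0// mulrAC -exprS; apply: (le_trans (M4 w)).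
  by rewrite ler_pM2l ?exprn_gt0.
rewrite ler_pdivlMr ?exprn_gt0 ?subr_gt0//.
have : (\sum_i t i ^+ 4) * (1 - r) <= (\sum_i y i ^+ 4) / (1 - r) ^+ 3 by lra.
by rewrite ler_pdivlMr ?exprn_gt0 ?subr_gt0// -mulrA -exprS.
Qed.

End convexity.

Section operator_norms.
Context {R : realType}.

(* Log-convexity of m |-> |M^m x|: if |M x| > r |x| then |M^m x| grows at least
   like (|M x| / |x|)^m, against the l4 bound. *)
Lemma l2_le_l4 {n} (M : 'I_n -> 'I_n -> R) (r : R) : 0 < r ->
  (forall i j, M i j = M j i) ->
  (forall x : 'I_n -> R,
    \sum_i (\sum_j M i j * x j) ^+ 4 <= r ^+ 4 * \sum_i x i ^+ 4) ->
  forall x : 'I_n -> R,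
    \sum_i (\sum_j M i j * x j) ^+ 2 <= r ^+ 2 * \sum_i x i ^+ 2.
Proof.
move=> r0 Msym M4 x.
pose T (y : 'I_n -> R) i := \sum_j M i j * y j.
pose y m := \sum_i (iter m T x i) ^+ 2.
have y_ge0 m : 0 <= y m by apply: sumr_ge0 => i _; exact: sqr_ge0.
(* By symmetry, |M^(m+1) x|^2 is the inner product of M^m x and M^(m+2) x. *)
have logconv m : y m.+1 ^+ 2 <= y m * y m.+2.
  rewrite [leLHS](_ : _ = (\sum_i iter m T x i * iter m.+2 T x i) ^+ 2).
    exact: sum_CauchySchwarz.
  congr (_ ^+ 2); rewrite /y /= -/(T _).
  transitivity (\sum_i \sum_j iter m T x j * (M i j * iter m.+1 T x i)).
    apply: eq_bigr => i _; rewrite {1}expr2 {1}/T mulr_suml.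
    by apply: eq_bigr => j _; rewrite mulrAC mulrC /=; congr (_ * _); rewrite mulrC.
  rewrite exchange_big/=; apply: eq_bigr => i _; rewrite -mulr_sumr.
  by congr (_ * _); apply: eq_bigr => j _; rewrite Msym.
(* Cauchy-Schwarz against the constant 1: passing from l4 to l2 costs a factor [n], harmless because
   it does not grow with [m]. *)
have y4 m : y m ^+ 2 <= n%:R * (r ^+ 4) ^+ m * \sum_i x i ^+ 4.
  have -> : y m = \sum_i 1 * iter m T x i ^+ 2.
    by apply: eq_bigr => i _; rewrite mul1r.
  apply: (le_trans (sum_CauchySchwarz _ _)); rewrite -mulrA.
  rewrite sumr_const card_ord expr1n; apply: ler_wpM2l; first exact: ler0n.
  under eq_bigr do rewrite -exprM.
  elim: m => [|m IH]; first by rewrite expr0 mul1r.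
  apply: (le_trans (M4 (iter m T x))).
  by rewrite (exprS _ m) -mulrA ler_pM2l// exprn_gt0.
change (y 1%N <= r ^+ 2 * y 0%N); rewrite leNgt; apply/negP => ylt.
have y0_gt0 : 0 < y 0%N.
  rewrite lt_def y_ge0 andbT; apply/eqP => y00.
  have := logconv 0%N; rewrite y00 mul0r => /(conj (sqr_ge0 (y 1%N))) /andP.
  by rewrite -eq_le eq_sym sqrf_eq0 => /eqP y10; move: ylt; rewrite y00 y10 mulr0 ltxx.
set s := y 1%N / y 0%N.
have rs : r ^+ 2 < s by rewrite ltr_pdivlMr.
have s0 : 0 < s by apply: le_lt_trans rs; exact: sqr_ge0.
have grow m : 0 < y m /\ s * y m <= y m.+1.
  elim: m => [|m [ym IH]]; first by split=> //; rewrite divfK// gt_eqF.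
  have ym1 : 0 < y m.+1 by apply: lt_le_trans IH; rewrite mulr_gt0.
  split=> //; rewrite -(ler_pM2l ym); apply: le_trans (logconv m).
  by rewrite mulrA [y m * s]mulrC expr2 ler_pM2r.
have ygrow m : s ^+ m * y 0%N <= y m.
  elim: m => [|m IH]; first by rewrite mul1r.
  by apply: le_trans (grow m).2; rewrite exprS -mulrA ler_pM2l.
set t := s / r ^+ 2 - 1.
have t0 : 0 < t by rewrite subr_gt0 ltr_pdivlMr ?mul1r ?exprn_gt0.
(* Bernoulli's inequality: linear growth in [m] already contradicts the bound [K] below, which is
   independent of [m]. *)
have bern m : 1 + m%:R * t <= (s / r ^+ 2) ^+ m.
  have -> : s / r ^+ 2 = 1 + t by rewrite /t addrC subrK.
  elim: m => [|m IH]; first by rewrite mul0r addr0.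
  rewrite exprS; apply: (@le_trans _ _ ((1 + t) * (1 + m%:R * t))); last first.
    by rewrite ler_pM2l// addr_gt0.
  rewrite -natr1 -subr_ge0.
  rewrite (_ : _ - _ = m%:R * t ^+ 2); last by ring.
  by rewrite mulr_ge0// sqr_ge0.
set K := n%:R * (\sum_i x i ^+ 4) / y 0%N ^+ 2.
have bound m : 1 + m%:R * t <= K.
  apply: (@le_trans _ _ (((s / r ^+ 2) ^+ m) ^+ 2)).
    have H1 : 1 <= (s / r ^+ 2) ^+ m.
      apply: le_trans (bern m); rewrite lerDl mulr_ge0// ltW//.
    apply: (le_trans (bern m)); rewrite expr2 ler_peMl//.
    exact: le_trans H1.
  rewrite /K ler_pdivlMr ?exprn_gt0//.
  rewrite expr_div_n expr_div_n mulrAC ler_pdivrMr ?exprn_gt0//.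
  rewrite -exprMn; apply: (@le_trans _ _ (y m ^+ 2)).
    by rewrite ler_pXn2r ?nnegrE ?ygrow// mulr_ge0// exprn_ge0// ltW.
  apply: (le_trans (y4 m)); rewrite mulrAC le_eqVlt; apply/orP; left.
  by rewrite -!exprM mulnA mulnAC.
have [m mK] : exists m : nat, K < m%:R * t.
  exists (Num.Def.archi_bound (K / t)).
  rewrite -ltr_pdivrMr//; apply: archi_boundP.
  apply: divr_ge0 (ltW t0); apply: divr_ge0 (sqr_ge0 _).
  apply: mulr_ge0; rewrite ?ler0n//; apply: sumr_ge0 => i _.
  by rewrite -[4%N]/(2 * 2)%N exprM sqr_ge0.
by have := le_lt_trans (bound m) mK; rewrite gtrDr ltr10.
Qed.

(** A strict contraction has no nonzero fixed vector, so the identity minus [M] is injective, hence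
    invertible in finite dimension. *)
Lemma resolvent_exists {n} (M : 'I_n -> 'I_n -> R) (r : R) : 0 < r < 1 ->
  (forall x : 'I_n -> R,
    \sum_i (\sum_j M i j * x j) ^+ 2 <= r ^+ 2 * \sum_i x i ^+ 2) ->
  forall h : 'I_n -> R, exists h' : 'I_n -> R,
    forall i, h' i = h i + \sum_j M i j * h' j.
Proof.
move=> /andP[r0 r1] M2 h.
(* [M] is transposed because [W] acts on row vectors from the right. *)
pose W : 'M[R]_n := 1%:M - \matrix_(i, j) M j i.
have WE (v : 'rV[R]_n) i : (v *m W) 0 i = v 0 i - \sum_j M i j * v 0 j.
  rewrite mulmxBr mulmx1 !mxE; congr (_ - _).
  by apply: eq_bigr => j _; rewrite mxE mulrC.
have Wunit : W \in unitmx.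
  rewrite -row_free_unit; apply: inj_row_free => v vW0.
  have vE i : v 0 i = \sum_j M i j * v 0 j.
    by apply/eqP; rewrite -subr_eq0 -WE vW0 mxE.
  have := M2 (v 0); under eq_bigr do rewrite -vE.
  set N := \sum_i _ => N_le.
  have N0 : 0 <= N by apply: sumr_ge0 => i _; exact: sqr_ge0.
  have N_eq0 : N = 0.
    have r2 : r ^+ 2 < 1 by rewrite expr_lt1// ltW.
    by apply/eqP; rewrite eq_le N0 andbT; nra.
  apply/rowP => i; rewrite mxE; apply/eqP; rewrite -sqrf_eq0.
  have /eqfunP/(_ i) : [forall i, v 0 i ^+ 2 == 0].
    apply/forallP => j; move/eqP: N_eq0; rewrite psumr_eq0; last first.
      by move=> k _; exact: sqr_ge0.
    by move=> /allP/(_ j); rewrite mem_index_enum => /(_ isT).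
  by move=> ->.
exists ((\row_i h i *m invmx W) 0) => i.
have : (\row_i h i *m invmx W *m W) 0 i = h i by rewrite mulmxKV// mxE.
by rewrite WE => /eqP; rewrite subr_eq => /eqP.
Qed.

End operator_norms.

(** * Expectations on the cube *)

Section expectation.
Context {R : realType}.

Definition upd {n} (x : 'I_n -> R) (i : 'I_n) (z : R) : 'I_n -> R :=
  fun j => if j == i then z else x j.

Definition in_cube {n} (x : 'I_n -> R) : Prop := forall i, `|x i| <= 1.

(** The outer functions that preserve bounded measurability on the cube. Continuity would be too
    much to ask: half-line indicators and the jumping derivative of the Stein solution must
    qualify. *)
Definition locally_bounded_measurable (g : R -> R) : Prop :=
  measurable_fun setT g /\
  forall M, exists K, forall y, `|y| <= M -> `|g y| <= K.

Lemma continuous_lbm (g : R -> R) : continuous g -> locally_bounded_measurable g.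
Proof.
move=> cg; split; first exact: continuous_measurable_fun.
move=> M.
have cgM : compact (g @` `[- M, M]).
  apply: continuous_compact; last exact: segment_compact.
  exact: continuous_subspaceT.
have [K [_ HK]] := compact_bounded cgM.
exists (K + 1) => y; rewrite ler_norml => yM.
by apply: (HK (K + 1)); [rewrite ltrDl|exists y => //=; rewrite in_itv/=].
Qed.

(* Positive normalised linear functionals on an algebra [adm] of functions on
   R^n, monotone for the order on the cube [-1, 1]^n. *)
Record cube_expectation (n : nat) := CubeExpectation {
  adm : (('I_n -> R) -> R) -> Prop ;
  Ex : (('I_n -> R) -> R) -> R ;
  adm_cst : forall a, adm (fun=> a) ;
  adm_coord : forall i, adm (fun x => x i) ;
  admD : forall f g, adm f -> adm g -> adm (fun x => f x + g x) ;
  admM : forall f g, adm f -> adm g -> adm (fun x => f x * g x) ;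
  adm_comp : forall g f, locally_bounded_measurable g -> adm f ->
    adm (fun x => g (f x)) ;
  adm_upd : forall i f, adm f -> adm (fun x => f (upd x i 0)) ;
  ExD : forall f g, adm f -> adm g -> Ex (fun x => f x + g x) = Ex f + Ex g ;
  ExZ : forall a f, adm f -> Ex (fun x => a * f x) = a * Ex f ;
  Ex_le : forall f g, adm f -> adm g -> (forall x, in_cube x -> f x <= g x) ->
    Ex f <= Ex g ;
  Ex_cst1 : Ex (fun=> 1) = 1
}.

End expectation.

Section expectation_theory.
Context {R : realType} {n : nat} (E : cube_expectation (R := R) n).
Implicit Types f g h : ('I_n -> R) -> R.


Lemma admN f : adm E f -> adm E (fun x => - f x).
Proof.
move=> af; rewrite (_ : (fun x => _) = (fun x => -1 * f x)).
  by apply: admM => //; exact: adm_cst.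
by apply: funext => x; rewrite mulN1r.
Qed.

Lemma admB f g : adm E f -> adm E g -> adm E (fun x => f x - g x).
Proof. by move=> af ag; apply: admD => //; exact: admN. Qed.

Lemma admX f k : adm E f -> adm E (fun x => f x ^+ k).
Proof.
move=> af; elim: k => [|k IH].
  by under eq_fun do rewrite expr0; exact: adm_cst.
by under eq_fun do rewrite exprS; exact: admM.
Qed.

Lemma adm_norm f : adm E f -> adm E (fun x => `|f x|).
Proof. by apply: (@adm_comp _ _ E Num.norm); apply: continuous_lbm; exact: norm_continuous. Qed.

Lemma adm_bigsum (I : Type) (r : seq I) (F : I -> ('I_n -> R) -> R) :
  (forall i, adm E (F i)) -> adm E (fun x => \sum_(i <- r) F i x).
Proof.
move=> aF; elim: r => [|i r IH].
  by under eq_fun do rewrite big_nil; exact: adm_cst.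
by under eq_fun do rewrite big_cons; exact: admD.
Qed.

Lemma ExB f g : adm E f -> adm E g -> Ex E (fun x => f x - g x) = Ex E f - Ex E g.
Proof.
move=> af ag; rewrite (_ : (fun x => _) = (fun x => f x + -1 * g x)).
  rewrite ExD ?ExZ ?mulN1r//; by apply: admM => //; exact: adm_cst.
by apply: funext => x; rewrite mulN1r.
Qed.

Lemma Ex_cst a : Ex E (fun=> a) = a.
Proof.
rewrite (_ : (fun=> a) = (fun=> a * 1)); last by apply: funext => x; rewrite mulr1.
by rewrite ExZ ?Ex_cst1 ?mulr1//; exact: adm_cst.
Qed.

Lemma Ex_affine k l f : adm E f -> Ex E (fun x => k * f x + l) = k * Ex E f + l.
Proof.
move=> af; have akf : adm E (fun x => k * f x) by apply: admM => //; exact: adm_cst.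
by rewrite (ExD akf (adm_cst E l)) ExZ// Ex_cst.
Qed.

Lemma Ex_sum (I : Type) (r : seq I) (F : I -> ('I_n -> R) -> R) :
  (forall i, adm E (F i)) ->
  Ex E (fun x => \sum_(i <- r) F i x) = \sum_(i <- r) Ex E (F i).
Proof.
move=> aF; elim: r => [|i r IH].
  by under eq_fun do rewrite big_nil; rewrite big_nil Ex_cst.
under eq_fun do rewrite big_cons; rewrite ExD ?big_cons ?IH//.
exact: adm_bigsum.
Qed.

Lemma Ex_ge0 f : adm E f -> (forall x, in_cube x -> 0 <= f x) -> 0 <= Ex E f.
Proof.
by move=> af f0; rewrite -[0](Ex_cst 0); apply: Ex_le => //; exact: adm_cst.
Qed.

Lemma Ex_le_cst f a : adm E f -> (forall x, in_cube x -> f x <= a) -> Ex E f <= a.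
Proof.
by move=> af fa; rewrite -[a]Ex_cst; apply: Ex_le => //; exact: adm_cst.
Qed.

Lemma norm_Ex_le f g : adm E f -> adm E g ->
  (forall x, in_cube x -> `|f x| <= g x) -> `|Ex E f| <= Ex E g.
Proof.
move=> af ag fg; rewrite ler_norml -[- Ex E g]mulN1r -ExZ//; apply/andP; split.
- apply: Ex_le => //; first by apply: admM => //; exact: adm_cst.
  by move=> x /fg; rewrite ler_norml mulN1r => /andP[].
- by apply: Ex_le => // x /fg; rewrite ler_norml => /andP[].
Qed.

(** Jensen's inequality through the pointwise bound |f| <= (f^2 / r + r) / 2, which uses only
    positivity and linearity. *)
Lemma Ex_norm_le f (M : R) : adm E f -> 0 <= M ->
  Ex E (fun x => f x ^+ 2) <= M ^+ 2 -> Ex E (fun x => `|f x|) <= M.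
Proof.
move=> af M0 fM.
have key (r : R) : 0 < r -> Ex E (fun x => `|f x|) <= (M ^+ 2 / r + r) / 2.
  move=> r0; apply: (@le_trans _ _ (Ex E (fun x => (2 * r)^-1 * f x ^+ 2 + r / 2))).
    apply: Ex_le; first exact: adm_norm.
      by apply: admD; [apply: admM; [exact: adm_cst|exact: admX]|exact: adm_cst].
    move=> x _; rewrite -subr_ge0 -[f x ^+ 2]real_normK ?num_real//.
    rewrite (_ : _ - _ = (2 * r)^-1 * (`|f x| - r) ^+ 2).
      by rewrite mulr_ge0 ?sqr_ge0// invr_ge0 mulr_ge0// ltW.
    by field; rewrite gt_eqF.
  have am : adm E (fun x => (2 * r)^-1 * f x ^+ 2).
    by apply: admM; [exact: adm_cst|exact: admX].
  rewrite ExD ?[X in _ + X]Ex_cst ?ExZ//; [|exact: admX|exact: adm_cst].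
  rewrite [leRHS]mulrDl lerD2r (_ : M ^+ 2 / r / 2 = (2 * r)^-1 * M ^+ 2).
    by apply: ler_wpM2l => //; rewrite invr_ge0 mulr_ge0// ltW.
  by field; rewrite gt_eqF.
(* The choice [r = M] is optimal for positive [M]; when [M = 0], [r] is an arbitrary positive
   number. *)
move: M0; rewrite le_eqVlt => /orP[/eqP M0|M0].
  rewrite -M0; apply/ler_addgt0Pr => e e0.
  by have := key _ e0; rewrite -M0 expr0n/= mul0r add0r; lra.
have := key _ M0; rewrite expr2 mulfK ?gt_eqF//; lra.
Qed.

(* [y] integrates to zero against functions that do not depend on the i-th
   coordinate, so only the oscillation of [F] in that coordinate matters. *)
Lemma Ex_centered (i : 'I_n) y F e (K : R) : 0 <= K ->
  adm E y -> adm E F -> adm E e ->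
  (forall h, adm E h -> (forall x z, h (upd x i z) = h x) ->
    Ex E (fun x => y x * h x) = 0) ->
  (forall x, in_cube x -> `|y x| <= K) ->
  (forall x, in_cube x -> `|F x - F (upd x i 0)| <= e x) ->
  `|Ex E (fun x => y x * F x)| <= K * Ex E e.
Proof.
move=> K0 ay aF ae y0 yK Fe.
have aF' : adm E (fun x => F (upd x i 0)) by exact: adm_upd.
have -> : Ex E (fun x => y x * F x) = Ex E (fun x => y x * (F x - F (upd x i 0))).
  under [in RHS]eq_fun do rewrite mulrBr.
  rewrite ExB ?[X in _ - X](y0 (fun x => F (upd x i 0))) ?subr0//; last 2 first.
  - exact: admM.
  - exact: admM.
  move=> x z; congr F; apply: funext => j; rewrite /upd.
  by case: eqP.
rewrite -ExZ//; apply: norm_Ex_le.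
- by apply: admM => //; exact: admB.
- by apply: admM => //; exact: adm_cst.
- by move=> x cx; rewrite normrM ler_pM// ?yK ?Fe.
Qed.

End expectation_theory.

Section test_functions.
Context {R : realType}.

Lemma lbm_bool (b : R -> bool) : measurable_fun setT b ->
  locally_bounded_measurable (fun y => (b y)%:R : R).
Proof.
move=> mb; split.
  rewrite (_ : (fun y => _) = (fun y => if b y then 1 else 0 : R)).
    exact: measurable_fun_ifT.
  by apply: funext => y; case: (b y).
by move=> M; exists 1 => y _; case: (b y); rewrite ?normr1 ?normr0.
Qed.

Lemma lbm_le (t : R) : locally_bounded_measurable (fun y : R => (y <= t)%R%:R : R).
Proof. by apply: lbm_bool; exact: measurable_fun_ler. Qed.

Lemma lbm_ball (t d : R) :
  locally_bounded_measurable (fun y : R => (`|y - t| <= d)%R%:R : R).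
Proof.
apply: lbm_bool; apply: measurable_fun_ler => //.
by apply: measurableT_comp => //; exact: measurable_funB.
Qed.

Definition clip (d w : R) : R := Num.max (- d) (Num.min d w).

Lemma clip_le (d w : R) : 0 <= d -> `|clip d w| <= d.
Proof.
move=> d0; rewrite ler_norml /clip le_max lexx /= ge_max ge_min lexx /= andbT.
by rewrite (le_trans _ d0)// oppr_le0.
Qed.

Lemma lbm_clip (t d : R) : 0 <= d ->
  locally_bounded_measurable (fun y => clip d (y - t)).
Proof.
move=> d0; split; last by move=> M; exists d => y _; exact: clip_le.
apply: measurable_maxr => //; apply: measurable_minr => //.
exact: measurable_funB.
Qed.

Lemma clip_mono (d v w : R) : v <= w -> clip d v <= clip d w.
Proof.
move=> vw; rewrite /clip; apply: le_max2 => //; exact: le_min2.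
Qed.

Lemma clip_id (d w : R) : `|w| <= d -> clip d w = w.
Proof. by rewrite ler_norml => /andP[dw wd]; rewrite /clip min_r// max_r. Qed.

(** If [w] is within [d] of 0, both [w] and [w - y] lie where the clipping at [2 * d] is the
    identity, and the product is exactly [y ^+ 2]. Elsewhere it is nonnegative by monotonicity. *)
Lemma clip_step (d w y : R) : `|y| <= d ->
  y ^+ 2 * (`|w| <= d)%R%:R <= y * (clip (2 * d) w - clip (2 * d) (w - y)).
Proof.
move=> yd; have d0 : 0 <= d by exact: le_trans (normr_ge0 _) yd.
case: (boolP (`|w| <= d)) => [wd|_].
  rewrite mulr1 !clip_id ?(le_trans (ler_normB _ _))//; last 2 first.
  - by rewrite mulr_natl mulr2n lerD.
  - by rewrite (le_trans wd)// mulr_natl mulr2n lerDl.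
  by rewrite opprB addrC subrK.
rewrite mulr0; have [y0|y0] := leP 0 y.
  by rewrite mulr_ge0// subr_ge0 clip_mono// gerBl.
by rewrite mulr_le0 ?(ltW y0)// subr_le0 clip_mono// lerBrDr gerDl ltW.
Qed.

End test_functions.

(** * Moments of the local fields *)

Section local_fields.
Context {R : realType} {n : nat}.
Variables (A : 'I_n -> 'I_n -> R) (c : 'I_n -> R) (B V : 'I_n -> R -> R).

Definition lfield i (x : 'I_n -> R) := \sum_j A i j * x j + c i.
Definition resid i (x : 'I_n -> R) := x i - B i (lfield i x).
Definition cvar i (x : 'I_n -> R) := V i (lfield i x).

(* [B i] and [V i] are the conditional mean and variance of the i-th coordinate
   given the others, as functions of the local field. *)
Record high_temperature (E : cube_expectation n) (rho al : R) : Prop := {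
  ht_rho : 0 < rho < 1 ;
  ht_sym : forall i j, A i j = A j i ;
  ht_diag : forall i, A i i = 0 ;
  ht_l4 : forall x : 'I_n -> R,
    \sum_i (\sum_j A i j * x j) ^+ 4 <= rho ^+ 4 * \sum_i x i ^+ 4 ;
  ht_row : forall i, \sum_j A i j ^+ 2 <= al ;
  ht_al : 0 <= al <= 1 ;
  ht_B_le1 : forall i t, `|B i t| <= 1 ;
  ht_V01 : forall i t, 0 <= V i t <= 1 ;
  ht_B_lbm : forall i, locally_bounded_measurable (B i) ;
  ht_V_lbm : forall i, locally_bounded_measurable (V i) ;
  ht_B_lip : forall i s t, `|B i s - B i t| <= `|s - t| ;
  ht_V_lip : forall i s t, `|V i s - V i t| <= 6 * `|s - t| ;
  ht_taylor : forall i s t, `|B i (s + t) - B i s - V i s * t| <= 6 * t ^+ 2 ;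
  ht_resid : forall i h, adm E h -> (forall x z, h (upd x i z) = h x) ->
    Ex E (fun x => resid i x * h x) = 0 ;
  ht_cvar : forall i h, adm E h -> (forall x z, h (upd x i z) = h x) ->
    Ex E (fun x => (resid i x ^+ 2 - cvar i x) * h x) = 0
}.

End local_fields.

Section moments.
Context {R : realType} {n : nat} (E : cube_expectation (R := R) n).
Variables (A : 'I_n -> 'I_n -> R) (c : 'I_n -> R) (B V : 'I_n -> R -> R).
Variables (rho al : R).
Hypothesis HT : high_temperature A c B V E rho al.

Let rho01 := ht_rho HT.
Let Asym := ht_sym HT.
Let A0 := ht_diag HT.
Let A4 := ht_l4 HT.
Let alA := ht_row HT.
Let al01 := ht_al HT.
Let B1 := ht_B_le1 HT.
Let V01 := ht_V01 HT.
Let lbmB := ht_B_lbm HT.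
Let lbmV := ht_V_lbm HT.
Let Btaylor := ht_taylor HT.

Local Notation lfield := (lfield A c).
Local Notation resid := (resid A c B).
Local Notation cvar := (cvar A c V).

Implicit Types x : 'I_n -> R.

Lemma A2 x : \sum_i (\sum_j A i j * x j) ^+ 2 <= rho ^+ 2 * \sum_i x i ^+ 2.
Proof. by apply: l2_le_l4 => //; case/andP: rho01. Qed.

Lemma field_upd i j x z : lfield i (upd x j z) = lfield i x + A i j * (z - x j).
Proof.
rewrite /lfield addrAC; congr (_ + _).
rewrite (bigD1 j)//= [in RHS](bigD1 j)//= {1}/upd eqxx.
under eq_bigr => k kj do rewrite /upd (negPf kj).
by ring.
Qed.

Lemma adm_field i : adm E (lfield i).
Proof.
apply: admD; last exact: adm_cst.
by apply: adm_bigsum => j; apply: admM; [exact: adm_cst|exact: adm_coord].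
Qed.

Lemma adm_resid i : adm E (resid i).
Proof.
by apply: admB; [exact: adm_coord|apply: adm_comp => //; exact: adm_field].
Qed.

Lemma adm_cvar i : adm E (cvar i).
Proof. by apply: adm_comp => //; exact: adm_field. Qed.

Lemma resid_le2 i x : in_cube x -> `|resid i x| <= 2.
Proof.
move=> cx; apply: (le_trans (ler_normB _ _)).
by have := cx i; have := B1 i (lfield i x); lra.
Qed.

Definition lin (a : 'I_n -> R) x := \sum_j a j * resid j x.

(** Three effects of resetting coordinate [j]: its own residual, the first-order response of the
    other conditional means, and their Taylor remainders. The middle sum is signed so that the l2
    norm of [A] applies to it. *)
Definition osc (a : 'I_n -> R) j x :=
  `|a j| + `|\sum_k A j k * (cvar k x * a k)| + 6 * \sum_k `|a k| * A j k ^+ 2.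

Lemma adm_lin a : adm E (lin a).
Proof.
by apply: adm_bigsum => j; apply: admM; [exact: adm_cst|exact: adm_resid].
Qed.

Lemma adm_osc a j : adm E (osc a j).
Proof.
apply: admD; last exact: adm_cst.
apply: admD; first exact: adm_cst.
apply: adm_norm; apply: adm_bigsum => k; apply: admM; first exact: adm_cst.
by apply: admM; [exact: adm_cvar|exact: adm_cst].
Qed.

Lemma osc_ge0 a j x : 0 <= osc a j x.
Proof.
rewrite !addr_ge0// mulr_ge0// sumr_ge0// => k _.
by rewrite mulr_ge0// sqr_ge0.
Qed.

Lemma lin_upd_le a j x : in_cube x -> `|lin a x - lin a (upd x j 0)| <= osc a j x.
Proof.
move=> cx.
pose rem k := B k (lfield k x + A k j * (0 - x j)) - B k (lfield k x)
              - V k (lfield k x) * (A k j * (0 - x j)).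
have remE k : `|rem k| <= 6 * A j k ^+ 2.
  apply: (le_trans (Btaylor _ _ _)); rewrite ler_pM2l// sub0r exprMn sqrrN Asym.
  rewrite ler_piMr ?sqr_ge0// -[leLHS]real_normK ?num_real//.
  by rewrite expr_le1// cx.
(* Since [A j j = 0], the local field at [j] does not change and the [j]-th residual moves by
   exactly [x j]; the other residuals move only through their conditional means. *)
have -> : lin a x - lin a (upd x j 0) =
    a j * x j - x j * (\sum_k A j k * (cvar k x * a k)) + \sum_k a k * rem k.
  rewrite /lin -sumrB mulr_sumr -sumrN.
  rewrite (bigD1 j)//= [X in _ = _ + X + _](bigD1 j)//= [X in _ = _ + X](bigD1 j)//=.
  rewrite /rem /resid !field_upd {1}/upd eqxx A0 /=.
  rewrite [X in _ + X = _](_ : _ = \sum_(i < n | i != j)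
     (- (x j * (A j i * (cvar i x * a i)))) + \sum_(i < n | i != j) a i * rem i).
    by ring.
  rewrite -big_split/=; apply: eq_bigr => i ij.
  rewrite !field_upd /rem /upd (negPf ij) [A j i]Asym /cvar; ring.
have nxj : `|x j| <= 1 by exact: cx.
apply: (le_trans (ler_normD _ _)); apply: lerD.
  apply: (le_trans (ler_normB _ _)); rewrite !normrM.
  by apply: lerD; [rewrite ler_piMr|rewrite ler_piMl].
apply: (le_trans (ler_norm_sum _ _ _)); rewrite mulr_sumr; apply: ler_sum => k _.
by rewrite normrM mulrCA ler_wpM2l.
Qed.

Lemma sum_osc_sqr a x : \sum_j osc a j x ^+ 2 <= 114 * \sum_j a j ^+ 2.
Proof.
have /andP[al0 al1] := al01; have /andP[rho0 rho1] := rho01.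
set N := \sum_j a j ^+ 2.
have N0 : 0 <= N by apply: sumr_ge0 => j _; exact: sqr_ge0.
have H2 : \sum_j (\sum_k A j k * (cvar k x * a k)) ^+ 2 <= N.
  apply: (le_trans (A2 _)).
  apply: (@le_trans _ _ (1 * N)); last by rewrite mul1r.
  apply: ler_pM; rewrite ?sqr_ge0//.
  - by apply: sumr_ge0 => j _; exact: sqr_ge0.
  - by rewrite expr_le1// ltW.
  - apply: ler_sum => k _; rewrite exprMn ler_piMl ?sqr_ge0//.
    have /andP[V0 V1] := V01 k (lfield k x).
    by rewrite expr_le1.
(* Rows of squared entries sum to at most 1, and by symmetry so do columns: Cauchy-Schwarz uses the
   rows, the exchange of sums the columns. The sign of [a k] is carried along to split the summand
   into two factors without absolute values. *)
have H3 : \sum_j (\sum_k `|a k| * A j k ^+ 2) ^+ 2 <= N.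
  apply: (@le_trans _ _ (\sum_j (\sum_k a k ^+ 2 * A j k ^+ 2))).
    apply: ler_sum => j _.
    have -> : \sum_k `|a k| * A j k ^+ 2 = \sum_k (a k * A j k * Num.sg (a k)) * A j k.
      by apply: eq_bigr => k _; rewrite normrEsg; ring.
    apply: (le_trans (sum_CauchySchwarz _ _)).
    apply: (@le_trans _ _ ((\sum_k a k ^+ 2 * A j k ^+ 2) * 1)); last by rewrite mulr1.
    apply: ler_pM.
    - by apply: sumr_ge0 => k _; exact: sqr_ge0.
    - by apply: sumr_ge0 => k _; exact: sqr_ge0.
    - apply: ler_sum => k _; rewrite !exprMn; apply: ler_piMr.
        by rewrite mulr_ge0 ?sqr_ge0.
      by rewrite sqr_sg; case: (_ != _).
    - exact: le_trans al1.
  rewrite exchange_big/=; apply: ler_sum => k _; rewrite -mulr_sumr.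
  rewrite ler_piMr ?sqr_ge0//; under eq_bigr do rewrite Asym.
  exact: le_trans al1.
(* The constant is 114 = 3 + 3 + 108, from (p + q + 6 r)^2 <= 3 p^2 + 3 q^2 + 108 r^2. *)
apply: (@le_trans _ _ (\sum_j (3 * a j ^+ 2 +
    (3 * (\sum_k A j k * (cvar k x * a k)) ^+ 2 +
     108 * (\sum_k `|a k| * A j k ^+ 2) ^+ 2)))).
  apply: ler_sum => j _; rewrite /osc.
  rewrite -[a j ^+ 2]real_normK ?num_real//.
  rewrite -[(\sum_k A j k * (cvar k x * a k)) ^+ 2]real_normK ?num_real//.
  suff sq3 (p q r : R) : (p + q + 6 * r) ^+ 2 <=
      3 * p ^+ 2 + (3 * q ^+ 2 + 108 * r ^+ 2) by exact: sq3.
  have := sqr_ge0 (p - q); have := sqr_ge0 (p - 6 * r); have := sqr_ge0 (q - 6 * r).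
  lra.
rewrite !big_split/= -!mulr_sumr -/N; lra.
Qed.

Lemma sum_norm_osc a x :
  \sum_j `|a j| * osc a j x <= 58 * \sum_j a j ^+ 2.
Proof.
have N0 : 0 <= \sum_j a j ^+ 2 by apply: sumr_ge0 => j _; exact: sqr_ge0.
apply: (le_trans (ler_sum_sqr_mul _ _)).
under eq_bigr do rewrite real_normK ?num_real//.
by have := sum_osc_sqr a x; lra.
Qed.

(** Only one factor of the square is expanded. Each residual, bounded by 2, then sees just the
    oscillation of the other factor, giving 116 = 2 * 58. *)
Lemma Ex_lin_sqr a : Ex E (fun x => lin a x ^+ 2) <= 116 * \sum_j a j ^+ 2.
Proof.
have aL := adm_lin a.
have -> : Ex E (fun x => lin a x ^+ 2) =
    \sum_j a j * Ex E (fun x => resid j x * lin a x).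
  transitivity (Ex E (fun x => \sum_j (a j * (resid j x * lin a x)))).
    congr (Ex E _); apply: funext => x; rewrite expr2 {1}/lin mulr_suml.
    by apply: eq_bigr => j _; rewrite mulrA.
  rewrite Ex_sum; last first.
    by move=> j; apply: admM; [exact: adm_cst|apply: admM => //; exact: adm_resid].
  by apply: eq_bigr => j _; rewrite ExZ//; apply: admM => //; exact: adm_resid.
apply: (@le_trans _ _ (\sum_j `|a j| * (2 * Ex E (osc a j)))).
  apply: ler_sum => j _; apply: (le_trans (ler_norm _)); rewrite normrM.
  apply: ler_wpM2l => //; apply: Ex_centered => //.
  - exact: adm_resid.
  - exact: adm_osc.
  - by move=> h; exact: (ht_resid HT).
  - by move=> x; exact: resid_le2.
  - by move=> x; exact: lin_upd_le.
have -> : \sum_j `|a j| * (2 * Ex E (osc a j)) =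
    2 * Ex E (fun x => \sum_j `|a j| * osc a j x).
  rewrite Ex_sum; last by move=> j; apply: admM; [exact: adm_cst|exact: adm_osc].
  rewrite mulr_sumr; apply: eq_bigr => j _; rewrite ExZ; [ring|exact: adm_osc].
suff : Ex E (fun x => \sum_j `|a j| * osc a j x) <= 58 * \sum_j a j ^+ 2.
  by move: (Ex E _) (\sum_j _) => u v; lra.
apply: Ex_le_cst => [|x _]; last exact: sum_norm_osc.
by apply: adm_bigsum => j; apply: admM; [exact: adm_cst|exact: adm_osc].
Qed.

Let bound_aux (u M P : R) : 0 <= M -> P <= 58 * M ->
  (10 * u ^+ 2 + 1140 * M) * P <= 580 * M * u ^+ 2 + 580 * 114 * M ^+ 2.
Proof.
move=> M0 PM; have u0 := sqr_ge0 u.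
have l0 : 0 <= 10 * u ^+ 2 + 1140 * M by lra.
by apply: (le_trans (ler_wpM2l l0 PM)); lra.
Qed.

Let bound_aux2 (G M : R) : 0 <= M -> G <= 116 * M ->
  580 * M * G + 580 * 114 * M ^+ 2 <= 366 ^+ 2 * M ^+ 2.
Proof.
move=> M0 GM; have M580 : 0 <= 580 * M by lra.
by have := ler_wpM2l M580 GM; have := sqr_ge0 M; lra.
Qed.

(** The same device with one factor of the fourth power expanded; the second moment closes the
    estimate. The constant works because 580 * 116 + 580 * 114 = 133400 is below 366^2 = 133956. *)
Lemma Ex_lin_expr4 a :
  Ex E (fun x => lin a x ^+ 4) <= 366 ^+ 2 * (\sum_j a j ^+ 2) ^+ 2.
Proof.
set N := \sum_j a j ^+ 2.
have N0 : 0 <= N by apply: sumr_ge0 => j _; exact: sqr_ge0.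
have aL := adm_lin a.
have -> : Ex E (fun x => lin a x ^+ 4) =
    \sum_j a j * Ex E (fun x => resid j x * lin a x ^+ 3).
  transitivity (Ex E (fun x => \sum_j (a j * (resid j x * lin a x ^+ 3)))).
    congr (Ex E _); apply: funext => x; rewrite exprS {1}/lin mulr_suml.
    by apply: eq_bigr => j _; rewrite mulrA.
  rewrite Ex_sum; last first.
    move=> j; apply: admM; first exact: adm_cst.
    by apply: admM; [exact: adm_resid|exact: admX].
  apply: eq_bigr => j _; rewrite ExZ//.
  by apply: admM; [exact: adm_resid|exact: admX].
(* Bounds the oscillation of the cube: the difference is at most 3 u^2 d + 3 |u| d^2 + d^3, and the
   mixed term is absorbed by d (|u| - d)^2 >= 0. *)
pose e j x := 5 * (lin a x ^+ 2 * osc a j x + osc a j x ^+ 3).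
have ae j : adm E (e j).
  apply: admM; first exact: adm_cst.
  apply: admD; last by apply: admX; exact: adm_osc.
  by apply: admM; [exact: admX|exact: adm_osc].
apply: (@le_trans _ _ (\sum_j `|a j| * (2 * Ex E (e j)))).
  apply: ler_sum => j _; apply: (le_trans (ler_norm _)); rewrite normrM.
  apply: ler_wpM2l => //; apply: (@Ex_centered _ _ E j (resid j)) => //.
  - exact: adm_resid.
  - exact: admX.
  - by move=> h; exact: (ht_resid HT).
  - by move=> x; exact: resid_le2.
  - move=> x /(lin_upd_le a j); rewrite /e; have := osc_ge0 a j x.
    move: (lin a x) (lin a (upd x j 0)) (osc a j x) => u w d d0 uwd.
    have -> : u ^+ 3 - w ^+ 3 =
      3 * u ^+ 2 * (u - w) - 3 * u * (u - w) ^+ 2 + (u - w) ^+ 3 by ring.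
    apply: (@le_trans _ _ (3 * `|u| ^+ 2 * d + 3 * `|u| * d ^+ 2 + d ^+ 3)).
      apply: (le_trans (ler_normD _ _)); apply: lerD.
        apply: (le_trans (ler_normB _ _)).
        apply: lerD.
          by rewrite normrM [`|3 * _|]normrM normrX normr_nat; apply: ler_wpM2l => //.
        rewrite normrM [`|3 * _|]normrM normrX normr_nat; apply: ler_wpM2l => //.
        by rewrite ler_pXn2r// nnegrE.
      by rewrite normrX ler_pXn2r// nnegrE.
    rewrite -[in leRHS](@real_normK _ u) ?num_real//.
    move: (normr_ge0 u); move: `|u| => v v0.
    have : 0 <= d * (v - d) ^+ 2 by rewrite mulr_ge0// sqr_ge0.
    have : 0 <= d * v ^+ 2 by rewrite mulr_ge0// sqr_ge0.
    have : 0 <= d ^+ 3 by rewrite exprn_ge0.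
    lra.
have -> : \sum_j `|a j| * (2 * Ex E (e j)) =
    Ex E (fun x => \sum_j (2 * `|a j|) * e j x).
  rewrite Ex_sum; last by move=> j; apply: admM => //; exact: adm_cst.
  by apply: eq_bigr => j _; rewrite (ExZ _ (ae j)); ring.
apply: (@le_trans _ _ (Ex E (fun x => 580 * N * lin a x ^+ 2 + (580 * 114) * N ^+ 2))).
  apply: Ex_le.
  - by apply: adm_bigsum => j; apply: admM => //; exact: adm_cst.
  - apply: admD; last exact: adm_cst.
    by apply: admM; [exact: adm_cst|exact: admX].
  - move=> x _; rewrite /e.
    (* A single oscillation is bounded by the whole sum of squares, so [osc ^+ 3] costs only a
       factor [114 * N] over [osc]. *)
    have d2 j : osc a j x ^+ 2 <= 114 * N.
      apply: le_trans (sum_osc_sqr a x).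
      by rewrite (bigD1 j)//= lerDl; apply: sumr_ge0 => k _; exact: sqr_ge0.
    apply: (@le_trans _ _ (\sum_j (10 * lin a x ^+ 2 + 1140 * N) *
        (`|a j| * osc a j x))).
      apply: ler_sum => j _.
      have ad0 : 0 <= `|a j| * osc a j x by rewrite mulr_ge0 ?osc_ge0.
      have := ler_wpM2l ad0 (d2 j).
      by move: ad0; rewrite exprS; move: (osc a j x) `|a j| (lin a x) => d b l; lra.
    rewrite -mulr_sumr.
    by apply: bound_aux N0 _; exact: sum_norm_osc.
have aL2 : adm E (fun x => lin a x ^+ 2) by exact: admX.
rewrite (Ex_affine (580 * N) (580 * 114 * N ^+ 2) aL2).
by apply: bound_aux2 N0 _; exact: Ex_lin_sqr.
Qed.

End moments.

(** * Expansion around the mean field *)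

Section mean_field_expansion.
Context {R : realType} {n : nat} (E : cube_expectation (R := R) n).
Variables (A : 'I_n -> 'I_n -> R) (c : 'I_n -> R) (B V : 'I_n -> R -> R).
Variables (rho al : R).
Hypothesis HT : high_temperature A c B V E rho al.
Variables (u : 'I_n -> R) (an K : R).
Hypothesis K_ge0 : 0 <= K.
Hypothesis Ex_lin4 : forall a : 'I_n -> R,
  Ex E (fun x => lin A c B a x ^+ 4) <= K ^+ 2 * (\sum_j a j ^+ 2) ^+ 2.

Let s i := \sum_j A i j * u j.
Let vs i := V i (s i + c i).

Hypothesis uE : forall i, u i = B i (s i + c i).
Hypothesis an01 : 0 <= an <= 1.
Hypothesis al_an : n%:R * al ^+ 2 <= an ^+ 2.

Local Notation lfield := (lfield A c).
Local Notation resid := (resid A c B).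
Local Notation cvar := (cvar A c V).
Local Notation lin := (lin A c B).

Let D := (1 - rho)^-1.

Let D_ge1 : 1 <= D.
Proof.
have /andP[rho0 rho1] := ht_rho HT.
by rewrite invf_ge1 ?subr_gt0// gerBl ltW.
Qed.

Definition dev i (x : 'I_n -> R) := \sum_j A i j * (x j - u j).

(** For [h = q] this is the statistic. General weights are needed because the error of its
    linearisation is again made of such sums, and [dev i] is the case of the [i]-th row of [A]. *)
Definition clin (h : 'I_n -> R) (x : 'I_n -> R) := \sum_j h j * (x j - u j).

Lemma adm_clin h : adm E (clin h).
Proof.
apply: adm_bigsum => j; apply: admM; first exact: adm_cst.
by apply: admB; [exact: adm_coord|exact: adm_cst].
Qed.

Lemma adm_dev i : adm E (dev i).
Proof. exact: adm_clin. Qed.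

Lemma fieldE i x : lfield i x = s i + c i + dev i x.
Proof.
rewrite /lfield /s /dev addrAC; congr (_ + _); rewrite -big_split/=.
by apply: eq_bigr => j _; rewrite -mulrDr addrC subrK.
Qed.

(** Pointwise: [dev i] is [lin (A i)] plus [A] applied to the shifts of the conditional means away
    from [u]. As [u] is a fixed point and [B] is 1-Lipschitz, these shifts are at most the [dev j],
    and the l4 contraction absorbs them. *)
Lemma sum_dev4 x :
  \sum_i dev i x ^+ 4 <= (\sum_i lin (A i) x ^+ 4) * D ^+ 4.
Proof.
rewrite /D exprVn.
apply: (@l4_contraction _ _ A _ _ (fun j => B j (lfield j x) - u j)).
- exact: ht_rho HT.
- exact: ht_l4 HT.
- move=> i; rewrite /dev /lin -big_split/=; apply: eq_bigr => j _.
  by rewrite /resid; ring.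
- move=> i; rewrite {1}uE; apply: (le_trans (ht_B_lip HT _ _ _)).
  by rewrite fieldE addrAC subrr add0r.
Qed.

Lemma Ex_sum_dev4 :
  Ex E (fun x => \sum_i dev i x ^+ 4) <= D ^+ 4 * K ^+ 2 * an ^+ 2.
Proof.
have D4 : 0 <= D ^+ 4 by rewrite exprn_ge0// (le_trans _ D_ge1).
have aL i : adm E (fun x => lin (A i) x ^+ 4) by apply: admX; exact: (adm_lin HT).
apply: (@le_trans _ _ (Ex E (fun x => D ^+ 4 * \sum_i lin (A i) x ^+ 4))).
  apply: Ex_le.
  - by apply: adm_bigsum => i; apply: admX; exact: adm_dev.
  - by apply: admM; [exact: adm_cst|apply: adm_bigsum].
  - by move=> x _; rewrite mulrC; exact: sum_dev4.
rewrite ExZ; last exact: adm_bigsum.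
rewrite -mulrA; apply: ler_wpM2l => //.
rewrite Ex_sum//.
apply: (@le_trans _ _ (\sum_(i < n) K ^+ 2 * al ^+ 2)).
  apply: ler_sum => i _; apply: (le_trans (Ex_lin4 (A i))).
  apply: ler_wpM2l; first exact: sqr_ge0.
  rewrite ler_pXn2r ?nnegrE//; first exact: (ht_row HT).
    by apply: sumr_ge0 => j _; exact: sqr_ge0.
  by case/andP: (ht_al HT).
rewrite sumr_const card_ord -mulrnAr; apply: ler_wpM2l; first exact: sqr_ge0.
by rewrite -mulr_natl.
Qed.

(** The same absorption as in [sum_dev4], started at the bare field [c] instead of the mean-field
    value: [u j] differs from [B j (c j)] by at most the size of [s j]. *)
Lemma sum_s4 (r3 : R) :
  \sum_i (\sum_j A i j * B j (c j)) ^+ 4 <= r3 ^+ 2 ->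
  \sum_i s i ^+ 4 <= r3 ^+ 2 * D ^+ 4.
Proof.
move=> H; rewrite /D exprVn.
apply: (@le_trans _ _
  ((\sum_i (\sum_j A i j * B j (c j)) ^+ 4) / (1 - rho) ^+ 4)).
  apply: (@l4_contraction _ _ A _ _ (fun j => u j - B j (c j))).
  - exact: ht_rho HT.
  - exact: ht_l4 HT.
  - move=> i; rewrite /s -big_split/=; apply: eq_bigr => j _; ring.
  - by move=> i; rewrite uE; apply: (le_trans (ht_B_lip HT _ _ _)); rewrite addrK.
apply: ler_wpM2r => //; rewrite invr_ge0 exprn_ge0// subr_ge0 ltW//.
by case/andP: (ht_rho HT).
Qed.

Lemma Ex_sum_norm_dev_sqr (h : 'I_n -> R) H : 0 <= H ->
  \sum_i h i ^+ 2 <= H ^+ 2 ->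
  Ex E (fun x => \sum_i `|h i| * dev i x ^+ 2) <= H * (D ^+ 2 * K * an).
Proof.
move=> H0 hH; have /andP[an0 an1] := an01.
have D0 : 0 <= D by rewrite (le_trans _ D_ge1).
have af : adm E (fun x => \sum_i `|h i| * dev i x ^+ 2).
  apply: adm_bigsum => i; apply: admM; first exact: adm_cst.
  by apply: admX; exact: adm_dev.
(* The outer absolute value brings the sum into the form required by [Ex_norm_le]. *)
have -> : (fun x => \sum_i `|h i| * dev i x ^+ 2) =
          (fun x => `| \sum_i `|h i| * dev i x ^+ 2 |).
  apply: funext => x; rewrite ger0_norm// sumr_ge0// => i _.
  by rewrite mulr_ge0// sqr_ge0.
have a4 : adm E (fun x => \sum_i dev i x ^+ 4).
  by apply: adm_bigsum => i; apply: admX; exact: adm_dev.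
apply: Ex_norm_le => //.
  by rewrite mulr_ge0// mulr_ge0// mulr_ge0// exprn_ge0.
apply: (@le_trans _ _ (Ex E (fun x => H ^+ 2 * \sum_i dev i x ^+ 4))).
  apply: Ex_le; first exact: admX.
    by apply: admM => //; exact: adm_cst.
  move=> x _; apply: (le_trans (sum_CauchySchwarz _ _)).
  under eq_bigr do rewrite real_normK ?num_real//.
  have -> : \sum_i (dev i x ^+ 2) ^+ 2 = \sum_i dev i x ^+ 4.
    by apply: eq_bigr => i _; rewrite -exprM.
  apply: ler_wpM2r => //; apply: sumr_ge0 => i _.
  by rewrite -[4%N]/(2 * 2)%N exprM sqr_ge0.
rewrite ExZ// exprMn; apply: ler_wpM2l; first exact: sqr_ge0.
by apply: (le_trans Ex_sum_dev4); rewrite le_eqVlt; apply/orP; left; apply/eqP; ring.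
Qed.

Lemma Ex_norm_lin (h : 'I_n -> R) H : 0 <= H ->
  \sum_i h i ^+ 2 <= H ^+ 2 -> Ex E (fun x => `|lin h x|) <= 11 * H.
Proof.
move=> H0 hH; apply: Ex_norm_le; first exact: (adm_lin HT).
  exact: mulr_ge0.
apply: (le_trans (Ex_lin_sqr HT h)); rewrite exprMn.
by have := sqr_ge0 H; lra.
Qed.

Let rem i x := B i (lfield i x) - u i - vs i * dev i x.

Let adm_rem i : adm E (rem i).
Proof.
apply: admB; first apply: admB.
- by apply: adm_comp; [exact: (ht_B_lbm HT)|exact: adm_field].
- exact: adm_cst.
- by apply: admM; [exact: adm_cst|exact: adm_dev].
Qed.

Let rem_le i x : `|rem i x| <= 6 * dev i x ^+ 2.
Proof. by rewrite /rem uE fieldE; exact: ht_taylor HT _ _ _. Qed.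

Let Ex_sum_rem (h : 'I_n -> R) H : 0 <= H ->
  \sum_i h i ^+ 2 <= H ^+ 2 ->
  Ex E (fun x => `|\sum_i h i * rem i x|) <= 6 * (H * (D ^+ 2 * K * an)).
Proof.
move=> H0 hH.
have af : adm E (fun x => \sum_i `|h i| * dev i x ^+ 2).
  apply: adm_bigsum => i; apply: admM; first exact: adm_cst.
  by apply: admX; exact: adm_dev.
apply: (@le_trans _ _ (Ex E (fun x => 6 * \sum_i `|h i| * dev i x ^+ 2))).
  apply: Ex_le.
  - apply: adm_norm; apply: adm_bigsum => i; apply: admM => //; exact: adm_cst.
  - by apply: admM => //; exact: adm_cst.
  - move=> x _; apply: (le_trans (ler_norm_sum _ _ _)); rewrite mulr_sumr.
    by apply: ler_sum => i _; rewrite normrM mulrCA ler_wpM2l.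
by rewrite ExZ// ler_wpM2l//; exact: Ex_sum_norm_dev_sqr.
Qed.

Definition clin_cst : R := D * (11 + 6 * (D ^+ 2 * K)).

Lemma clin_cst_ge1 : 1 <= clin_cst.
Proof.
have D1 := D_ge1; have D2 : 0 <= D ^+ 2 * K by rewrite mulr_ge0// sqr_ge0.
rewrite /clin_cst; apply: (le_trans D1); rewrite ler_peMr//; last lra.
exact: le_trans D1.
Qed.

(** The linearised deviations are summed by duality: the weights [h] are replaced by the resolvent
    weights [h'], for which the linear response of the conditional means cancels. What remains is a
    combination of residuals and a quadratic remainder, and the l2 norm grows by at most [D]. *)
Lemma Ex_norm_clin (h : 'I_n -> R) H : 0 <= H ->
  \sum_i h i ^+ 2 <= H ^+ 2 -> Ex E (fun x => `|clin h x|) <= clin_cst * H.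
Proof.
move=> H0 hH; have /andP[an0 an1] := an01; have /andP[rho0 rho1] := ht_rho HT.
have D0 : 0 <= D by rewrite (le_trans _ D_ge1).
have vs1 j : `|vs j| <= 1.
  by have /andP[V0 V1] := ht_V01 HT j (s j + c j); rewrite ger0_norm.
have M2 x : \sum_i (\sum_j A i j * vs j * x j) ^+ 2 <= rho ^+ 2 * \sum_i x i ^+ 2.
  under eq_bigr do under eq_bigr do rewrite -mulrA.
  apply: (le_trans (A2 HT _)); apply: ler_wpM2l; first exact: sqr_ge0.
  apply: ler_sum => i _; rewrite exprMn ler_piMl ?sqr_ge0//.
  by rewrite -real_normK ?num_real// expr_le1.
have [h' h'E] := resolvent_exists (ht_rho HT) M2 h.
have h'H : \sum_i h' i ^+ 2 <= (D * H) ^+ 2.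
  apply: (@le_trans _ _ ((\sum_i h i ^+ 2) / (1 - rho) ^+ 2)).
    by apply: (l2_contraction (ht_rho HT) M2 h'E).
  by rewrite exprMn mulrC -exprVn ler_wpM2l// sqr_ge0.
have DH0 : 0 <= D * H by exact: mulr_ge0.
have clinE x : clin h x = lin h' x + \sum_i h' i * rem i x.
  transitivity (\sum_j (h' j * (x j - u j)) -
                \sum_i \sum_j A j i * vs i * h' i * (x j - u j)).
    rewrite exchange_big/= -sumrB; apply: eq_bigr => j _.
    by rewrite -mulr_suml {1}h'E -mulrBl addrK.
  rewrite -sumrB /lin -big_split/=; apply: eq_bigr => i _.
  rewrite (_ : \sum_j A j i * vs i * h' i * (x j - u j) = vs i * h' i * dev i x).
    by rewrite /rem /resid; ring.
  rewrite /dev mulr_sumr; apply: eq_bigr => j _.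
  by rewrite (ht_sym HT j); ring.
have alh : adm E (lin h') by exact: (adm_lin HT).
have ar : adm E (fun x => \sum_i h' i * rem i x).
  by apply: adm_bigsum => i; apply: admM => //; exact: adm_cst.
apply: (@le_trans _ _ (Ex E (fun x => `|lin h' x| + `|\sum_i h' i * rem i x|))).
  apply: Ex_le.
  - by apply: adm_norm; exact: adm_clin.
  - by apply: admD; exact: adm_norm.
  - by move=> x _; rewrite clinE; exact: ler_normD.
rewrite ExD; [|exact: adm_norm|exact: adm_norm].
apply: (le_trans (lerD (Ex_norm_lin DH0 h'H) (Ex_sum_rem DH0 h'H))).
rewrite /clin_cst.
(* Only a bound proportional to [H] is wanted, so [an <= 1] discards the smallness of the
   remainder. *)
have : D * H * (D ^+ 2 * K * an) <= D * H * (D ^+ 2 * K).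
  by rewrite ler_wpM2l// ler_piMr// mulr_ge0// sqr_ge0.
lra.
Qed.

Let qvar_arith (x1 x2 q a k y1 y3 e d : R) : 0 <= d -> 0 <= k ->
  0 <= y1 -> 0 <= y3 -> 0 <= e -> 0 <= q -> 0 <= a ->
  x2 <= 8 * (q + a) -> x1 <= (1 + k) * (q + a) ->
  x2 + (6 * x1 + 6 * (d * (q + y3))) <=
  (8 + 6 * d + 6 * (1 + k)) * (y1 + y3 + a + q + e).
Proof.
move=> d0 k0 y10 y30 e0 q0 a0 H1 H2.
have := mulr_ge0 d0 q0; have := mulr_ge0 d0 y30; have := mulr_ge0 d0 y10.
have := mulr_ge0 d0 e0; have := mulr_ge0 d0 a0.
have := mulr_ge0 k0 y30; have := mulr_ge0 k0 y10; have := mulr_ge0 k0 e0.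
lra.
Qed.

Let stein_arith (x1 x2 x3 x4 C q k1 k2 k3 e : R) : 0 <= C -> 0 <= q -> q <= e ->
  0 <= k3 -> x1 <= k1 * e -> x2 <= k2 * e -> x3 <= k3 -> x4 <= 44 * q ->
  2 * x1 + (C * x2 + ((8 * C * q * x3 + 8 * C * q) + C * x4)) <=
  (2 * k1 + C * k2 + 8 * C * (1 + k3) + 44 * C) * e.
Proof.
move=> C0 q0 qe k0 H1 H2 H3 H4.
have Cq := mulr_ge0 C0 q0.
have h2 := ler_wpM2l C0 H2; have h3 := ler_wpM2l Cq H3; have h4 := ler_wpM2l C0 H4.
have h5 := ler_wpM2l C0 qe.
have h6 : C * q * k3 <= C * e * k3 by exact: ler_wpM2r.
lra.
Qed.

(** * Stein identity for the normalised statistic *)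

Section statistic.
Variables (q : 'I_n -> R) (lam ups Q r1 r3 eps : R).
Hypothesis q1 : \sum_i q i ^+ 2 = 1.
Hypothesis qQ : forall i, `|q i| <= Q.
Hypothesis upsE : ups = \sum_i q i ^+ 2 * V i (c i).
Hypothesis lam_le : `|lam| <= rho.
Hypothesis r1_ge0 : 0 <= r1.
Hypothesis r3_ge0 : 0 <= r3.
Hypothesis eps_ge0 : 0 <= eps.
Hypothesis r1E :
  \sum_i (\sum_j A i j * q j * (V j (c j) - ups)) ^+ 2 <= r1 ^+ 2.
Hypothesis r3E : \sum_i (\sum_j A i j * B j (c j)) ^+ 4 <= r3 ^+ 2.
Hypothesis epsE : \sum_i (\sum_j A i j * q j - lam * q i) ^+ 2 <= eps ^+ 2.

Let err0 := r1 + r3 + an + Q + eps.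

Lemma ups_ge0 : 0 <= ups.
Proof.
rewrite upsE; apply: sumr_ge0 => i _; rewrite mulr_ge0 ?sqr_ge0//.
by case/andP: (ht_V01 HT i (c i)).
Qed.

Lemma ups_le1 : ups <= 1.
Proof.
rewrite upsE -q1; apply: ler_sum => i _; rewrite ler_piMr ?sqr_ge0//.
by case/andP: (ht_V01 HT i (c i)).
Qed.

Let Q_ge0 : 0 <= Q.
Proof.
have [i0 _|noi] := pickP (fun _ : 'I_n => true).
  exact: le_trans (normr_ge0 _) (qQ i0).
exfalso; move: q1; rewrite big1; last by move=> i; have := noi i.
by move/eqP; rewrite eq_sym oner_eq0.
Qed.

Let an_ge0 : 0 <= an. Proof. by case/andP: an01. Qed.

Let D_ge0 : 0 <= D. Proof. exact: le_trans D_ge1. Qed.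

Let q2Q i : q i ^+ 2 <= Q * `|q i|.
Proof. by rewrite -real_normK ?num_real// expr2 ler_wpM2r. Qed.

(** One factor of [q i] is bounded by [Q], the other paired with [s i ^+ 2] by Cauchy-Schwarz. The
    product [Q * r3] thus obtained is below [(Q + r3) ^+ 2], the form whose square root enters the
    error. *)
Lemma sum_q2_s2 : \sum_i q i ^+ 2 * s i ^+ 2 <= (D * (Q + r3)) ^+ 2.
Proof.
have H1 : \sum_i `|q i| * s i ^+ 2 <= r3 * D ^+ 2.
  rewrite -(@ler_pXn2r _ 2)// ?nnegrE; last 2 first.
  - by apply: sumr_ge0 => i _; rewrite mulr_ge0// sqr_ge0.
  - by rewrite mulr_ge0// exprn_ge0.
  apply: (le_trans (sum_CauchySchwarz _ _)).
  under eq_bigr do rewrite real_normK ?num_real//.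
  rewrite q1 mul1r; under eq_bigr do rewrite -exprM.
  by apply: (le_trans (sum_s4 r3E)); rewrite exprMn -exprM.
apply: (@le_trans _ _ (Q * (r3 * D ^+ 2))).
  apply: (@le_trans _ _ (Q * \sum_i `|q i| * s i ^+ 2)); last exact: ler_wpM2l.
  rewrite mulr_sumr; apply: ler_sum => i _; rewrite [leRHS]mulrA.
  by apply: ler_wpM2r; [exact: sqr_ge0|exact: q2Q].
rewrite exprMn mulrA mulrC ler_wpM2l ?sqr_ge0//.
have := mulr_ge0 Q_ge0 r3_ge0; have := sqr_ge0 Q; have := sqr_ge0 r3.
lra.
Qed.

Let errc x := (1 - lam * ups) * clin q x - lin q x.

Definition err_cst : R := 6 * D * clin_cst + 2 * clin_cst + 6 * (D ^+ 2 * K).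

Lemma Ex_norm_err : Ex E (fun x => `|errc x|) <= err_cst * err0.
Proof.
have C1 := clin_cst_ge1; have D1 := D_ge1.
(* Three successive replacements in A (vs q): [vs i] by its value at the bare field [c i], that
   value by its weighted average [ups], and A q by lam q. Each error is a weight vector small in l2;
   the Taylor remainder completes the list. *)
pose h1 j := \sum_i A j i * (q i * (vs i - V i (c i))).
pose h2 i := \sum_j A i j * q j * (V j (c j) - ups).
pose h3 i := \sum_j A i j * q j - lam * q i.
have errE x : errc x = clin h1 x + clin h2 x + ups * clin h3 x +
    \sum_i q i * rem i x.
  rewrite /errc; have -> : lin q x =
      clin q x - \sum_i q i * (vs i * dev i x) - \sum_i q i * rem i x.
    rewrite /clin -!sumrB; apply: eq_bigr => i _; rewrite /rem /resid; ring.
  have -> : \sum_i q i * (vs i * dev i x) =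
      clin h1 x + clin h2 x + ups * clin h3 x + ups * lam * clin q x.
    transitivity (\sum_j (\sum_i A j i * (q i * vs i)) * (x j - u j)).
      under eq_bigr do rewrite /dev mulrA mulr_sumr.
      rewrite exchange_big/=; apply: eq_bigr => j _; rewrite mulr_suml.
      by apply: eq_bigr => i _; rewrite (ht_sym HT j); ring.
    rewrite /clin !mulr_sumr -!big_split/=; apply: eq_bigr => j _.
    rewrite mulrA mulrA -!mulrDl; congr (_ * _).
    rewrite /h3 mulrBr [ups * _ - _]addrC mulrA !addrA addrAC subrK.
    rewrite /h1 /h2 mulr_sumr -!big_split/=.
    by apply: eq_bigr => i _; ring.
  by ring.
have h1H : \sum_i h1 i ^+ 2 <= (6 * (D * (Q + r3))) ^+ 2.
  apply: (le_trans (A2 HT _)).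
  apply: (@le_trans _ _ (1 * \sum_i (36 * (q i ^+ 2 * s i ^+ 2)))).
    have /andP[rho0 rho1] := ht_rho HT.
    apply: ler_pM; rewrite ?sqr_ge0//.
    - by apply: sumr_ge0 => i _; exact: sqr_ge0.
    - by rewrite expr_le1// ltW.
    apply: ler_sum => i _; rewrite exprMn [leRHS]mulrCA ler_wpM2l ?sqr_ge0//.
    have := ht_V_lip HT i (s i + c i) (c i); rewrite addrK -/(vs i) => H.
    rewrite -[leLHS]real_normK ?num_real//.
    apply: (@le_trans _ _ ((6 * `|s i|) ^+ 2)).
      by rewrite ler_pXn2r// nnegrE// mulr_ge0.
    by rewrite exprMn real_normK ?num_real//; have := sqr_ge0 (s i); lra.
  rewrite mul1r -mulr_sumr exprMn.
  by have := sum_q2_s2; lra.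
have H10 : 0 <= 6 * (D * (Q + r3)).
  by rewrite mulr_ge0// mulr_ge0// addr_ge0.
have E1 := Ex_norm_clin H10 h1H.
have E2 := Ex_norm_clin r1_ge0 r1E.
have E3 := Ex_norm_clin eps_ge0 epsE.
have q1' : \sum_i q i ^+ 2 <= 1 ^+ 2 by rewrite q1 expr1n.
have E4 := Ex_sum_rem ler01 q1'.
have ac h : adm E (fun x => `|clin h x|) by apply: adm_norm; exact: adm_clin.
have ar : adm E (fun x => `|\sum_i q i * rem i x|).
  by apply: adm_norm; apply: adm_bigsum => i; apply: admM => //; exact: adm_cst.
have a12 := admD (ac h1) (ac h2).
have a123 := admD a12 (ac h3).
have ae : adm E errc.
  apply: admB; last exact: (adm_lin HT).
  by apply: admM; [exact: adm_cst|exact: adm_clin].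
apply: (@le_trans _ _ (Ex E (fun x => `|clin h1 x| + `|clin h2 x| + `|clin h3 x|
    + `|\sum_i q i * rem i x|))).
  apply: Ex_le; [exact: adm_norm|exact: admD|move=> x _].
  rewrite errE; apply: (le_trans (ler_normD _ _)); rewrite lerD2r.
  apply: (le_trans (ler_normD _ _)); apply: lerD; first exact: ler_normD.
  rewrite normrM ler_piMl// ger0_norm ?ups_le1//; exact: ups_ge0.
rewrite (ExD a123 ar) (ExD a12 (ac h3)) (ExD (ac h1) (ac h2)).
rewrite -/h2 -/h3 in E2 E3.
move: E1 E2 E3 E4; rewrite /err_cst /err0.
move: (Ex E _) (Ex E _) (Ex E _) (Ex E _) => x1 x2 x3 x4 E1 E2 E3 E4.
have C0 : 0 <= clin_cst by exact: le_trans C1.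
have DC0 : 0 <= D * clin_cst by exact: mulr_ge0.
have D20 : 0 <= D ^+ 2 * K by rewrite mulr_ge0// sqr_ge0.
move: E1 E4; rewrite mul1r mulrCA [clin_cst * _]mulrCA.
rewrite (_ : clin_cst * (Q + r3) = clin_cst * Q + clin_cst * r3) ?mulrDr//.
move=> E1 E4.
have := mulr_ge0 C0 Q_ge0; have := mulr_ge0 C0 r3_ge0.
have := mulr_ge0 C0 r1_ge0; have := mulr_ge0 C0 eps_ge0; have := mulr_ge0 C0 an_ge0.
have := mulr_ge0 DC0 Q_ge0; have := mulr_ge0 DC0 r3_ge0.
have := mulr_ge0 DC0 r1_ge0; have := mulr_ge0 DC0 eps_ge0; have := mulr_ge0 DC0 an_ge0.
have := mulr_ge0 D20 Q_ge0; have := mulr_ge0 D20 r3_ge0.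
have := mulr_ge0 D20 r1_ge0; have := mulr_ge0 D20 eps_ge0; have := mulr_ge0 D20 an_ge0.
lra.
Qed.

(** The sum of squared summands of [lin q], which multiplies the derivative of the test function in
    the Stein expansion. *)
Definition qvar x := \sum_i q i ^+ 2 * resid i x ^+ 2.

Let adm_qvar : adm E qvar.
Proof.
apply: adm_bigsum => i; apply: admM; first exact: adm_cst.
by apply: admX; exact: (adm_resid HT).
Qed.

Lemma resid_sqr_le4 i x : in_cube x -> resid i x ^+ 2 <= 4.
Proof.
move=> cx; have := resid_le2 HT i cx; rewrite -[resid i x ^+ 2]real_normK ?num_real//.
by move: (normr_ge0 (resid i x)); move: `|resid i x| => y; nra.
Qed.

Lemma qvar_le4 x : in_cube x -> qvar x <= 4.
Proof.
move=> cx; rewrite (_ : 4 = 4 * \sum_i q i ^+ 2); last by rewrite q1 mulr1.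
rewrite mulr_sumr; apply: ler_sum => i _.
rewrite [leLHS]mulrC; apply: ler_wpM2r; first exact: sqr_ge0.
exact: resid_sqr_le4.
Qed.

Let in_cube_upd (i : 'I_n) (x : 'I_n -> R) : in_cube x -> in_cube (upd x i 0).
Proof. by move=> cx j; rewrite /upd; case: eqP => // _; rewrite normr0. Qed.

(** Fluctuations of [qvar] involve [al] without the factor sqrt(n). Unit length of [q] forces n Q^2
    >= 1, hence al^2 <= n al^2 Q^2 <= (an Q)^2. *)
Lemma al_le : al <= (Q + an) ^+ 2.
Proof.
have /andP[al0 al1] := ht_al HT.
have nQ : 1 <= n%:R * Q ^+ 2.
  apply: (@le_trans _ _ (\sum_i q i ^+ 2)); first by rewrite q1.
  rewrite mulr_natl -[n in leRHS]card_ord -sumr_const; apply: ler_sum => i _.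
  by rewrite -real_normK ?num_real// ler_pXn2r// nnegrE.
apply: (@le_trans _ _ (an * Q)); last first.
  have := mulr_ge0 an_ge0 Q_ge0; have := sqr_ge0 an; have := sqr_ge0 Q; lra.
rewrite -(@ler_pXn2r _ 2)// ?nnegrE ?mulr_ge0// exprMn.
apply: (@le_trans _ _ ((n%:R * al ^+ 2) * Q ^+ 2)); last first.
  by apply: ler_wpM2r => //; exact: sqr_ge0.
by rewrite mulrAC ler_peMl// sqr_ge0.
Qed.

Let fluct i x := resid i x ^+ 2 - cvar i x.

Let adm_fluct i : adm E (fluct i).
Proof. by apply: admB; [apply: admX; exact: (adm_resid HT)|exact: (adm_cvar HT)]. Qed.

Let fluct_le i x : in_cube x -> `|fluct i x| <= 4.
Proof.
move=> cx; have := resid_sqr_le4 i cx; have := sqr_ge0 (resid i x).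
have /andP[] := ht_V01 HT i (lfield i x); rewrite -/(cvar i x) /fluct => *.
by rewrite ler_norml; apply/andP; split; lra.
Qed.

(** Absolute values of [A] are affordable here: the bound will be summed against the weights
    [q k ^+ 2], whose total is 1. *)
Let fluct_upd k i x : in_cube x ->
  `|fluct k x - fluct k (upd x i 0)| <= (k == i)%:R * 4 + 10 * `|A k i|.
Proof.
move=> cx; have cx' := in_cube_upd i cx.
have xi : `|x i| <= 1 by exact: cx.
have Fd : lfield k x - lfield k (upd x i 0) = A k i * x i.
  by rewrite field_upd; ring.
have AF : `|lfield k x - lfield k (upd x i 0)| <= `|A k i|.
  by rewrite Fd normrM ler_piMr.
have H1 : `|cvar k x - cvar k (upd x i 0)| <= 6 * `|A k i|.
  by apply: (le_trans (ht_V_lip HT _ _ _)); rewrite ler_wpM2l.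
have H2 : `|resid k x - resid k (upd x i 0)| <= (k == i)%:R + `|A k i|.
  have -> : resid k x - resid k (upd x i 0) =
      (x k - upd x i 0 k) + (B k (lfield k (upd x i 0)) - B k (lfield k x)).
    by rewrite /resid; ring.
  apply: (le_trans (ler_normD _ _)); apply: lerD.
    rewrite /upd; case: eqP => [->|_] /=; last by rewrite subrr normr0.
    by rewrite subr0 (le_trans xi).
  by rewrite distrC; apply: (le_trans (ht_B_lip HT _ _ _)).
have H3 : `|resid k x ^+ 2 - resid k (upd x i 0) ^+ 2| <=
    4 * ((k == i)%:R + `|A k i|).
  rewrite subr_sqr normrM mulrC; apply: ler_pM => //.
  apply: (le_trans (ler_normD _ _)).
  by have := resid_le2 HT k cx; have := resid_le2 HT k cx'; lra.
rewrite /fluct (_ : _ - _ - _ = (resid k x ^+ 2 - resid k (upd x i 0) ^+ 2) -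
   (cvar k x - cvar k (upd x i 0))); last by ring.
by apply: (le_trans (ler_normB _ _)); lra.
Qed.

(** Second moment by the orthogonality of the centred squared residuals: each one, bounded by 4,
    sees only the oscillation [e i] of the whole sum in its own coordinate. *)
Let Ex_norm_fluct : Ex E (fun x => `|\sum_i q i ^+ 2 * fluct i x|) <= 8 * (Q + an).
Proof.
pose Y x := \sum_i q i ^+ 2 * fluct i x.
have aY : adm E Y by apply: adm_bigsum => i; apply: admM => //; exact: adm_cst.
have Qan : 0 <= Q + an by exact: addr_ge0.
apply: Ex_norm_le => //; first exact: mulr_ge0.
pose e i := 4 * q i ^+ 2 + 10 * \sum_k q k ^+ 2 * `|A k i|.
have -> : Ex E (fun x => (\sum_i q i ^+ 2 * fluct i x) ^+ 2) =
    \sum_i q i ^+ 2 * Ex E (fun x => fluct i x * Y x).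
  transitivity (Ex E (fun x => \sum_i q i ^+ 2 * (fluct i x * Y x))).
    congr (Ex E _); apply: funext => x; rewrite expr2 {1}/Y mulr_suml.
    by apply: eq_bigr => j _; rewrite mulrA.
  rewrite Ex_sum; last by move=> j; apply: admM; [exact: adm_cst|exact: admM].
  by apply: eq_bigr => j _; rewrite ExZ//; exact: admM.
have H1 i : Ex E (fun x => fluct i x * Y x) <= 4 * e i.
  apply: (le_trans (ler_norm _)); rewrite -[X in _ * X](Ex_cst E (e i)).
  apply: Ex_centered => //.
  - exact: adm_cst.
  - by move=> h; exact: (ht_cvar HT).
  - by move=> x; exact: fluct_le.
  - move=> x cx; rewrite /Y -sumrB.
    apply: (le_trans (ler_norm_sum _ _ _)).
    apply: (@le_trans _ _ (\sum_k q k ^+ 2 * ((k == i)%:R * 4 + 10 * `|A k i|))).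
      apply: ler_sum => k _; rewrite -mulrBr normrM ger0_norm ?sqr_ge0//.
      by apply: ler_wpM2l; [exact: sqr_ge0|exact: fluct_upd].
    rewrite (eq_bigr (fun k => q k ^+ 2 * ((k == i)%:R * 4) +
       10 * (q k ^+ 2 * `|A k i|))); last by move=> k _; ring.
    rewrite big_split/= -mulr_sumr (bigD1 i)//= eqxx big1; last first.
      by move=> k /negPf ->; rewrite mul0r mulr0.
    by rewrite mul1r addr0 /e [q i ^+ 2 * 4]mulrC.
have H2 i : Q * \sum_k `|q k| * `|A k i| <= (Q ^+ 2 + al) / 2.
  have H3 : (\sum_k `|q k| * `|A k i|) ^+ 2 <= al.
    apply: (le_trans (sum_CauchySchwarz _ _)).
    under eq_bigr do rewrite real_normK ?num_real//.
    under [X in _ * X <= _]eq_bigr do rewrite real_normK ?num_real// (ht_sym HT).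
    by rewrite q1 mul1r; exact: (ht_row HT).
  by move: H3; move: (\sum_k _) => y H3; have := sqr_ge0 (Q - y); lra.
have H4 i : e i <= 4 * Q ^+ 2 + 5 * (Q ^+ 2 + al).
  have H5 : q i ^+ 2 <= Q ^+ 2.
    by rewrite -real_normK ?num_real// ler_pXn2r// nnegrE.
  have : \sum_k q k ^+ 2 * `|A k i| <= Q * \sum_k `|q k| * `|A k i|.
    by rewrite mulr_sumr; apply: ler_sum => k _; rewrite mulrA ler_wpM2r.
  by move=> /le_trans/(_ (H2 i)); rewrite /e; lra.
apply: (@le_trans _ _ (\sum_i q i ^+ 2 * (4 * (4 * Q ^+ 2 + 5 * (Q ^+ 2 + al))))).
  apply: ler_sum => i _; apply: ler_wpM2l; first exact: sqr_ge0.
  by apply: (le_trans (H1 i)); rewrite ler_wpM2l.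
(* The total 36 Q^2 + 20 al is at most 56 (Q + an)^2 by [al_le], below the square of 8 (Q + an). *)
rewrite -mulr_suml q1 mul1r exprMn.
have Qan2 : Q ^+ 2 <= (Q + an) ^+ 2.
  by have := mulr_ge0 Q_ge0 an_ge0; have := sqr_ge0 an; lra.
by have := al_le; have := sqr_ge0 (Q + an); lra.
Qed.

Definition qvar_cst : R := 8 + 6 * D + 6 * (1 + D ^+ 2 * K).

(** Squared residuals are first replaced by conditional variances, at the cost of [fluct], then by
    variances at the bare field, at a Lipschitz cost in |dev i| + |s i|. *)
Lemma Ex_norm_qvar : Ex E (fun x => `|qvar x - ups|) <= qvar_cst * err0.
Proof.
have Qan : 0 <= Q + an by exact: addr_ge0.
have DK : 0 <= D ^+ 2 * K by rewrite mulr_ge0// sqr_ge0.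
have s_le : \sum_i q i ^+ 2 * `|s i| <= D * (Q + r3).
  rewrite -(@ler_pXn2r _ 2)// ?nnegrE; last 2 first.
  - by apply: sumr_ge0 => i _; rewrite mulr_ge0// sqr_ge0.
  - by rewrite mulr_ge0// addr_ge0.
  rewrite (eq_bigr (fun i => q i * (q i * `|s i|))); last by move=> i _; ring.
  apply: (le_trans (sum_CauchySchwarz _ _)); rewrite q1 mul1r.
  under eq_bigr do rewrite exprMn real_normK ?num_real//.
  exact: sum_q2_s2.
have dev_le : Ex E (fun x => \sum_i q i ^+ 2 * `|dev i x|) <=
    (1 + D ^+ 2 * K) * (Q + an).
  have af : adm E (fun x => \sum_i q i ^+ 2 * `|dev i x|).
    apply: adm_bigsum => i; apply: admM; first exact: adm_cst.
    by apply: adm_norm; exact: adm_dev.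
  have -> : (fun x => \sum_i q i ^+ 2 * `|dev i x|) =
            (fun x => `| \sum_i q i ^+ 2 * `|dev i x| |).
    apply: funext => x; rewrite ger0_norm// sumr_ge0// => i _.
    by rewrite mulr_ge0// sqr_ge0.
  apply: Ex_norm_le => //; first by rewrite mulr_ge0// addr_ge0.
  have aq : adm E (fun x => \sum_i `|q i| * dev i x ^+ 2).
    apply: adm_bigsum => i; apply: admM; first exact: adm_cst.
    by apply: admX; exact: adm_dev.
  apply: (@le_trans _ _ (Ex E (fun x => Q * \sum_i `|q i| * dev i x ^+ 2))).
    apply: Ex_le; [exact: admX|by apply: admM => //; exact: adm_cst|move=> x _].
    rewrite (eq_bigr (fun i => q i * (q i * `|dev i x|))); last by move=> i _; ring.
    apply: (le_trans (sum_CauchySchwarz _ _)); rewrite q1 mul1r mulr_sumr.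
    apply: ler_sum => i _; rewrite exprMn real_normK ?num_real// [leRHS]mulrA.
    by apply: ler_wpM2r; [exact: sqr_ge0|exact: q2Q].
  rewrite ExZ//.
  have q1' : \sum_i q i ^+ 2 <= 1 ^+ 2 by rewrite q1 expr1n.
  apply: (le_trans (ler_wpM2l Q_ge0 (Ex_sum_norm_dev_sqr ler01 q1'))).
  rewrite mul1r exprMn; move: DK; move: (D ^+ 2 * K) => k k0.
  apply: (@le_trans _ _ ((1 + k) * (Q + an) ^+ 2)).
    have := mulr_ge0 Q_ge0 an_ge0 => Qa0.
    have := mulr_ge0 k0 Qa0; have := mulr_ge0 k0 (sqr_ge0 Q).
    have := mulr_ge0 k0 (sqr_ge0 an); have := sqr_ge0 Q; have := sqr_ge0 an.
    lra.
  apply: ler_wpM2r; first exact: sqr_ge0.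
  by rewrite expr2 ler_peMl ?addr_ge0// lerDl.
have aY : adm E (fun x => `|\sum_i q i ^+ 2 * fluct i x|).
  by apply: adm_norm; apply: adm_bigsum => i; apply: admM => //; exact: adm_cst.
have ad : adm E (fun x => \sum_i q i ^+ 2 * `|dev i x|).
  apply: adm_bigsum => i; apply: admM; first exact: adm_cst.
  by apply: adm_norm; exact: adm_dev.
have a6 : adm E (fun x => 6 * (\sum_i q i ^+ 2 * `|dev i x|)).
  by apply: admM => //; exact: adm_cst.
pose b := 6 * (D * (Q + r3)).
apply: (@le_trans _ _ (Ex E (fun x => `|\sum_i q i ^+ 2 * fluct i x| +
    (6 * (\sum_i q i ^+ 2 * `|dev i x|) + b)))).
  apply: Ex_le.
  - by apply: adm_norm; apply: admB => //; exact: adm_cst.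
  - by apply: admD => //; apply: admD => //; exact: adm_cst.
  - move=> x _.
    have -> : qvar x - ups = \sum_i q i ^+ 2 * fluct i x +
        \sum_i q i ^+ 2 * (cvar i x - V i (c i)).
      rewrite upsE /qvar -sumrB -big_split/=; apply: eq_bigr => i _.
      by rewrite /fluct; ring.
    apply: (le_trans (ler_normD _ _)); rewrite lerD2l.
    apply: (le_trans (ler_norm_sum _ _ _)).
    apply: (@le_trans _ _ (6 * (\sum_i q i ^+ 2 * `|dev i x|) +
                           6 * \sum_i q i ^+ 2 * `|s i|)); last first.
      by rewrite lerD2l ler_wpM2l.
    rewrite -mulrDr -big_split/= mulr_sumr; apply: ler_sum => i _.
    rewrite normrM ger0_norm ?sqr_ge0// -mulrDr mulrCA.
    apply: ler_wpM2l; first exact: sqr_ge0.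
    apply: (le_trans (ht_V_lip HT _ _ _)); rewrite fieldE; apply: ler_wpM2l => //.
    rewrite (_ : s i + c i + dev i x - c i = dev i x + s i); last by ring.
    exact: ler_normD.
rewrite (ExD aY (admD a6 (adm_cst E b))) (Ex_affine 6 b ad).
move: Ex_norm_fluct dev_le; rewrite /b /qvar_cst /err0.
move: (Ex E _) (Ex E _) DK; move: (D ^+ 2 * K) => k X1 X2 k0 E1 E2.
exact: qvar_arith.
Qed.

Let resid_q_le i x : in_cube x -> `|q i * resid i x| <= 2 * Q.
Proof.
by move=> cx; rewrite normrM mulrC; apply: ler_pM => //; exact: (resid_le2 HT).
Qed.

Let adm_term i : adm E (fun x => q i * resid i x).
Proof. by apply: admM; [exact: adm_cst|exact: (adm_resid HT)]. Qed.

Let adm_shift i : adm E (fun x => clin q x - q i * resid i x).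
Proof. by apply: admB; [exact: adm_clin|exact: adm_term]. Qed.

(* Replacing the i-th coordinate by its conditional mean removes the dependence
   on that coordinate, since the local field at i does not see it. *)
Let shift_upd i x z : clin q (upd x i z) - q i * resid i (upd x i z) =
  clin q x - q i * resid i x.
Proof.
rewrite /clin (bigD1 i)//= [X in _ = X - _](bigD1 i)//=.
rewrite (eq_bigr (fun j => q j * (x j - u j))); last first.
  by move=> j ji; rewrite /upd (negPf ji).
by rewrite /resid field_upd (ht_diag HT) mul0r addr0 /upd eqxx; ring.
Qed.

(** This plays the part of an exchangeable pair: each residual is tested against [f] at an argument
    from which its own coordinate has been removed. *)
Let Ex_shift0 (f : R -> R) : locally_bounded_measurable f ->
  Ex E (fun x => \sum_i q i * resid i x * f (clin q x - q i * resid i x)) = 0.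
Proof.
move=> lf; rewrite Ex_sum; last first.
  by move=> i; apply: admM => //; exact: adm_comp.
rewrite big1// => i _.
have ah : adm E (fun x => f (clin q x - q i * resid i x)) by exact: adm_comp.
transitivity (Ex E (fun x => q i * (resid i x * f (clin q x - q i * resid i x)))).
  by congr (Ex E _); apply: funext => x; rewrite mulrA.
rewrite ExZ; last by apply: admM => //; exact: (adm_resid HT).
rewrite (ht_resid HT ah) ?mulr0// => x z.
by rewrite shift_upd.
Qed.

Let Ex_norm_lin_q : Ex E (fun x => `|lin q x|) <= 11.
Proof. by rewrite -[11]mulr1 Ex_norm_lin// q1 expr1n. Qed.

(** Concentration near the threshold: comparing the clipped test function at the statistic and at
    its shifts isolates [qvar] on the ball, while the total is at most the clipping level 4 Q times
    the mean of |lin q|. The weight [qvar] is the one with which the jump of the Stein derivative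
    enters. *)
Lemma Ex_qvar_ball (t : R) :
  Ex E (fun x => qvar x * (`|clin q x - t| <= 2 * Q)%R%:R) <= 44 * Q.
Proof.
have Q2 : 0 <= 2 * (2 * Q) by rewrite mulr_ge0// mulr_ge0.
pose f y := clip (2 * (2 * Q)) (y - t).
have lf : locally_bounded_measurable f by exact: lbm_clip.
have aT := adm_clin q.
have af : adm E (fun x => f (clin q x)) by exact: adm_comp.
have ali : adm E (lin q) by exact: (adm_lin HT).
have ash : adm E (fun x =>
    \sum_i q i * resid i x * f (clin q x - q i * resid i x)).
  by apply: adm_bigsum => i; apply: admM => //; exact: adm_comp.
apply: (@le_trans _ _ (Ex E (fun x => lin q x * f (clin q x) -
    \sum_i q i * resid i x * f (clin q x - q i * resid i x)))).
  apply: Ex_le.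
  - by apply: admM => //; apply: (adm_comp (lbm_ball t (2 * Q))).
  - by apply: admB => //; exact: admM.
  - move=> x cx; rewrite /lin /qvar !mulr_suml -sumrB; apply: ler_sum => i _.
    rewrite -mulrBr -exprMn /f.
    have -> : clin q x - q i * resid i x - t = (clin q x - t) - q i * resid i x.
      by ring.
    by apply: clip_step; exact: resid_q_le.
rewrite (ExB (admM ali af) ash) (Ex_shift0 lf) subr0.
apply: (@le_trans _ _ (Ex E (fun x => 2 * (2 * Q) * `|lin q x|))).
  apply: Ex_le => //; first exact: admM.
    by apply: admM; [exact: adm_cst|exact: adm_norm].
  move=> x _; apply: (le_trans (ler_norm _)); rewrite normrM mulrC.
  by apply: ler_wpM2r => //; exact: clip_le.
rewrite ExZ; last exact: adm_norm.
by apply: (le_trans (ler_wpM2l Q2 Ex_norm_lin_q)); lra.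
Qed.

Definition stein_cst (C : R) : R :=
  2 * qvar_cst + C * err_cst + 8 * C * (1 + clin_cst) + 44 * C.

(* [f] is the solution of the Stein equation for the half-line ]-oo, t], and
   [phi] its derivative, which jumps at [t]. *)
Lemma stein_comparison (C t N : R) (f phi : R -> R) : 0 <= C ->
  locally_bounded_measurable f -> locally_bounded_measurable phi ->
  (forall w, `|f w| <= C) -> (forall w, `|phi w| <= 2) ->
  (forall w y, `|y| <= 2 * Q -> `|f w - f (w - y) - y * phi w| <=
     C * (1 + `|w|) * y ^+ 2 + C * `|y| * (`|w - t| <= 2 * Q)%R%:R) ->
  (forall w, ups * phi w - (1 - lam * ups) * w * f w =
     ups * ((w <= t)%R%:R - N)) ->
  ups * `|Ex E (fun x => (clin q x <= t)%R%:R) - N| <= stein_cst C * err0.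
Proof.
move=> C0 lf lphi fC phi2 step eqn.
have aT := adm_clin q.
have af : adm E (fun x => f (clin q x)) by exact: adm_comp.
have aphi : adm E (fun x => phi (clin q x)) by exact: adm_comp.
have ali : adm E (lin q) by exact: (adm_lin HT).
have aind : adm E (fun x => (clin q x <= t)%R%:R).
  exact: (adm_comp (lbm_le t)).
have ash : adm E (fun x =>
    \sum_i q i * resid i x * f (clin q x - q i * resid i x)).
  by apply: adm_bigsum => i; apply: admM => //; exact: adm_comp.
have aerr : adm E errc.
  by apply: admB => //; apply: admM => //; exact: adm_cst.
pose g x := ups * ((clin q x <= t)%R%:R - N).
have ag : adm E g.
  by apply: admM; [exact: adm_cst|apply: admB => //; exact: adm_cst].
(* Adding the shifted sum, of zero expectation, makes a pointwise estimate possible. *)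
have -> : ups * `|Ex E (fun x => (clin q x <= t)%R%:R) - N| =
    `|Ex E (fun x => g x +
       \sum_i q i * resid i x * f (clin q x - q i * resid i x))|.
  rewrite (ExD ag ash) (Ex_shift0 lf) addr0 /g.
  rewrite ExZ; last by apply: admB => //; exact: adm_cst.
  rewrite ExB//; last exact: adm_cst.
  by rewrite Ex_cst normrM ger0_norm// ups_ge0.
pose b1 x := `|qvar x - ups|.
pose b2 x := `|errc x|.
pose b3 x := `|clin q x|.
pose b4 x := qvar x * (`|clin q x - t| <= 2 * Q)%R%:R.
have ab1 : adm E b1 by apply: adm_norm; apply: admB => //; exact: adm_cst.
have ab2 : adm E b2 by exact: adm_norm.
have ab3 : adm E b3 by exact: adm_norm.
have ab4 : adm E b4 by apply: admM => //; exact: (adm_comp (lbm_ball t (2 * Q))).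
have ac k y : adm E y -> adm E (fun x => k * y x).
  by move=> ay; apply: admM => //; exact: adm_cst.
apply: (@le_trans _ _ (Ex E (fun x => 2 * b1 x + (C * b2 x +
    ((8 * C * Q * b3 x + 8 * C * Q) + C * b4 x))))).
  apply: norm_Ex_le.
  - exact: admD.
  - apply: admD; first exact: ac.
    apply: admD; first exact: ac.
    apply: admD; last exact: ac.
    by apply: admD; [exact: ac|exact: adm_cst].
  - move=> x cx.
    (* Expanding every shifted value of [f] to first order produces [lin q * f] and [qvar * phi];
       trading them for the two terms of the Stein equation costs [errc] and [qvar - ups]. *)
    pose r i := f (clin q x) - f (clin q x - q i * resid i x) -
                q i * resid i x * phi (clin q x).
    have -> : g x + \sum_i q i * resid i x * f (clin q x - q i * resid i x) =
        (ups - qvar x) * phi (clin q x) - errc x * f (clin q x) -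
        \sum_i q i * resid i x * r i.
      rewrite /g -eqn /errc.
      have -> : \sum_i q i * resid i x * r i = lin q x * f (clin q x) -
          \sum_i q i * resid i x * f (clin q x - q i * resid i x) -
          qvar x * phi (clin q x).
        rewrite /lin /qvar !mulr_suml -!sumrB; apply: eq_bigr => i _.
        by rewrite /r; ring.
      by ring.
    apply: (le_trans (ler_normB _ _)).
    apply: (le_trans (lerD (ler_normB _ _) (lexx _))).
    rewrite [leRHS]addrA; apply: lerD; first apply: lerD.
    - rewrite normrM distrC -/(b1 x) [leLHS]mulrC.
      by apply: ler_wpM2r; [exact: normr_ge0|exact: phi2].
    - rewrite normrM -/(b2 x) [leLHS]mulrC.
      by apply: ler_wpM2r; [exact: normr_ge0|exact: fC].
    - apply: (le_trans (ler_norm_sum _ _ _)).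
      (* One of the three factors of y is bounded by 2 Q, which leaves squares adding up to [qvar];
         the jump term already carries y squared and becomes [b4]. *)
      apply: (@le_trans _ _ (\sum_i (C * (1 + b3 x) * (2 * Q) +
         C * (`|clin q x - t| <= 2 * Q)%R%:R) * (q i ^+ 2 * resid i x ^+ 2))).
        apply: ler_sum => i _; rewrite normrM.
        have yQ := resid_q_le i cx.
        apply: (le_trans (ler_wpM2l (normr_ge0 _) (step _ _ yQ))).
        rewrite -exprMn -/(b3 x) -[(q i * resid i x) ^+ 2]real_normK ?num_real//.
        move: yQ (normr_ge0 (q i * resid i x)).
        move: `|q i * resid i x| (_%:R : R) => y ind yQ y0.
        have H : 0 <= C * (1 + b3 x) * y ^+ 2.
          by rewrite mulr_ge0 ?sqr_ge0// mulr_ge0// addr_ge0// normr_ge0.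
        by have := ler_wpM2l H yQ; lra.
      rewrite -mulr_sumr -/(qvar x) mulrDl; apply: lerD.
        have H : 0 <= C * (1 + b3 x) * (2 * Q).
          by rewrite !mulr_ge0// addr_ge0// normr_ge0.
        by apply: (le_trans (ler_wpM2l H (qvar_le4 cx))); lra.
      by rewrite /b4 mulrAC mulrA.
have a3 : adm E (fun x => 8 * C * Q * b3 x + 8 * C * Q).
  by apply: admD; [exact: ac|exact: adm_cst].
have a34 := admD a3 (ac C _ ab4).
rewrite (ExD (ac 2 _ ab1) (admD (ac C _ ab2) a34)) (ExD (ac C _ ab2) a34).
rewrite (ExD a3 (ac C _ ab4)) (Ex_affine _ _ ab3) !ExZ//.
have H3 : Ex E b3 <= clin_cst.
  have q1' : \sum_i q i ^+ 2 <= 1 ^+ 2 by rewrite q1 expr1n.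
  by have := Ex_norm_clin ler01 q1'; rewrite mulr1.
have H1 : Ex E b1 <= qvar_cst * err0 := Ex_norm_qvar.
have H2 : Ex E b2 <= err_cst * err0 := Ex_norm_err.
have H4 : Ex E b4 <= 44 * Q := Ex_qvar_ball t.
have Qe : Q <= err0.
  rewrite /err0; move: r1_ge0 r3_ge0 an_ge0 eps_ge0; lra.
apply: stein_arith => //.
exact: le_trans ler01 clin_cst_ge1.
Qed.

End statistic.
End mean_field_expansion.

(** * The Stein equation for the normal law *)

Section mean_value.
Context {R : realType}.
Implicit Types g dg ddg : R -> R.

Lemma mean_value g dg (a b : R) : (forall x : R, is_derive x 1 g (dg x)) ->
  exists2 c, Num.min a b <= c <= Num.max a b & g b - g a = dg c * (b - a).
Proof.
move=> gd.
have cg : continuous g.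
  by move=> x; apply: differentiable_continuous; apply/derivable1_diffP; case: (gd x).
case: (ltgtP a b) => [ab|ba|ab].
- have [c] := @MVT _ g dg a b ab (fun z _ => gd z) (continuous_subspaceT cg).
  rewrite in_itv/= => /andP[ac cb] E; exists c => //.
  by rewrite !ltW.
- have [c] := @MVT _ g dg b a ba (fun z _ => gd z) (continuous_subspaceT cg).
  rewrite in_itv/= => /andP[ac cb] E; exists c => //.
    by rewrite !ltW.
  by rewrite -opprB E -mulrN opprB.
- by exists a; rewrite ab ?lexx// !subrr mulr0.
Qed.

Lemma mean_value_le g dg (a b M : R) : (forall x : R, is_derive x 1 g (dg x)) ->
  (forall x, Num.min a b <= x <= Num.max a b -> `|dg x| <= M) ->
  `|g b - g a| <= M * `|b - a|.
Proof.
move=> gd dgM; have [c cab ->] := mean_value a b gd.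
by rewrite normrM ler_wpM2r// dgM.
Qed.

Lemma between_dist (a b x : R) :
  Num.min a b <= x <= Num.max a b -> `|x - a| <= `|b - a|.
Proof.
case: (leP a b) => ab /andP[h1 h2].
  by rewrite !ger0_norm ?subr_ge0// lerD2r.
by rewrite !ler0_norm ?subr_le0// ?lerN2 ?lerD2r// ltW.
Qed.

(** The mean value theorem is applied twice, which gives the constant [M] rather than M / 2. *)
Lemma taylor1_le g dg ddg (a b M : R) : (forall x : R, is_derive x 1 g (dg x)) ->
  (forall x : R, is_derive x 1 dg (ddg x)) ->
  (forall x, Num.min a b <= x <= Num.max a b -> `|ddg x| <= M) ->
  `|g b - g a - dg a * (b - a)| <= M * (b - a) ^+ 2.
Proof.
move=> gd dgd M_le; have [c cab ->] := mean_value a b gd.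
rewrite -mulrBl normrM -[(b - a) ^+ 2]real_normK ?num_real// expr2 mulrA.
apply: ler_wpM2r => //.
have M0 : 0 <= M.
  by apply: le_trans (M_le a _) => //; rewrite ge_min lexx/= le_max lexx.
apply: (@le_trans _ _ (M * `|c - a|)); last first.
  by apply: ler_wpM2l => //; exact: between_dist.
apply: (mean_value_le dgd) => x /andP[h1 h2]; apply: M_le.
move: cab h1 h2; case: (leP a b) => ab /andP[ac cb].
  by rewrite min_l// max_r// => h1 h2; rewrite h1 (le_trans h2).
by rewrite min_r// max_l// => h1 h2; rewrite h2 (le_trans _ h1).
Qed.

End mean_value.

(** * Gaussian tail bounds *)

Section mills.
Context {R : realType}.

(** On the half-line to the right of [w], the function N + (v / w) p has derivative p (1 - x / w) <=
    0; its value at [w] therefore dominates its limit 1. *)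
Lemma mills_ratio (N p : R -> R) (v w : R) : 0 < v -> 0 < w ->
  (forall x : R, is_derive x 1 N (p x)) ->
  (forall x : R, is_derive x 1 p (- (x / v) * p x)) ->
  (forall x, 0 <= p x) -> N x @[x --> +oo] --> (1 : R) ->
  w * (1 - N w) <= v * p w.
Proof.
move=> v0 w0 dN dp p0 N1.
have H y : w <= y -> N y <= N w + v / w * p w.
  move=> wy.
  have dm (x : R) : is_derive x 1 (N + (v / w) *: p) (p x * (1 - x / w)).
    have := is_deriveD (dN x) (is_deriveZ (v / w) (dp x)).
    move/is_derive_eq; apply.
    by rewrite /GRing.scale/=; field; rewrite !gt_eqF.
  have [c] := mean_value w y dm; rewrite min_l// max_r// => /andP[wc cy] E.
  have {}E : (N y + v / w * p y) - (N w + v / w * p w) =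
    p c * (1 - c / w) * (y - w) := E.
  have : p c * (1 - c / w) * (y - w) <= 0.
    apply: mulr_le0_ge0; last by rewrite subr_ge0.
    by apply: mulr_ge0_le0 => //; rewrite subr_le0 ler_pdivlMr// mul1r.
  rewrite -E.
  have : 0 <= v / w * p y by rewrite mulr_ge0// divr_ge0// ltW.
  lra.
have : 1 <= N w + v / w * p w.
  rewrite -(cvg_lim _ N1)//; apply: limr_le; first by apply: cvgP N1.
  by near=> y; apply: H; near: y; apply: nbhs_pinfty_ge; exact: num_real.
move=> /(ler_wpM2l (ltW w0)); rewrite mulr1 mulrDr.
have -> : w * (v / w * p w) = v * p w by field; rewrite gt_eqF.
lra.
Unshelve. all: by end_near.
Qed.

(** Beyond 1 this is the Mills ratio. On [0, 1] the density decreases, so [C * p w] is at least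
    [C * p 1], hence at least 1. *)
Lemma mills_bound (N p : R -> R) (v C w : R) : 0 < v -> 0 <= w ->
  (forall x : R, is_derive x 1 N (p x)) ->
  (forall x : R, is_derive x 1 p (- (x / v) * p x)) ->
  (forall x, 0 <= p x) -> N x @[x --> +oo] --> (1 : R) ->
  (forall x, 0 <= N x <= 1) -> 1 <= C * p 1 -> 0 <= C -> v <= C ->
  1 - N w <= C * p w.
Proof.
move=> v0 w0 dN dp p0 N1 N01 Cp C0 vC; have /andP[Nw0 Nw1] := N01 w.
have [w1|w1] := leP w 1.
  apply: (@le_trans _ _ 1); first by rewrite lerBlDr lerDl.
  apply: (le_trans Cp); apply: ler_wpM2l => //; rewrite -subr_le0.
  have [c] := mean_value w 1 dp; rewrite min_l// max_r// => /andP[wc c1] ->.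
  rewrite mulr_le0_ge0 ?subr_ge0// mulNr oppr_le0 mulr_ge0// divr_ge0 ?(ltW v0)//.
  exact: le_trans wc.
have wp : 0 < w by rewrite (lt_trans _ w1).
have := mills_ratio v0 wp dN dp p0 N1.
have : 1 - N w <= w * (1 - N w) by rewrite ler_peMl ?(ltW w1)// subr_ge0.
have : v * p w <= C * p w by rewrite ler_wpM2r.
lra.
Qed.

End mills.

(** * The Stein solution of a half-line *)

Section stein_solution.
Context {R : realType}.
Variables (N p : R -> R) (v C t : R).
Hypothesis v_gt0 : 0 < v.
Hypothesis dN : forall x : R, is_derive x 1 N (p x).
Hypothesis dp : forall x : R, is_derive x 1 p (- (x / v) * p x).
Hypothesis p_gt0 : forall x, 0 < p x.
Hypothesis N01 : forall x, 0 <= N x <= 1.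
Hypothesis N_pinfty : N x @[x --> +oo] --> (1 : R).
Hypothesis N_ninfty : N x @[x --> -oo] --> (0 : R).
Hypothesis Cp : 1 <= C * p 1.
Hypothesis CpN : 1 <= C * p (- 1).
Hypothesis C_ge0 : 0 <= C.
Hypothesis vC : v <= C.

Let p_ge0 x : 0 <= p x. Proof. exact: ltW. Qed.

(** Reflected distribution function and density: they reduce the lower tail to the upper one. *)
Let N' x := 1 - N (- x).
Let p' x := p (- x).

Let dN' (x : R) : is_derive x 1 N' (p' x).
Proof.
have := is_deriveB (@is_derive_cst R R R 1 x 1)
  (is_derive1_comp (dN (- x)) (@is_deriveNid R R x 1)).
by move/is_derive_eq; apply; rewrite sub0r mulrN mulr1 opprK.
Qed.

Let dp' (x : R) : is_derive x 1 p' (- (x / v) * p' x).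
Proof.
have := is_derive1_comp (dp (- x)) (@is_deriveNid R R x 1).
by move/is_derive_eq; apply; rewrite /p'; ring.
Qed.

Let N'_pinfty : N' x @[x --> +oo] --> (1 : R).
Proof.
rewrite -[X in _ --> X]subr0; apply: cvgB; first exact: cvg_cst.
exact/cvgNy_compNP.
Qed.

Let N'01 x : 0 <= N' x <= 1.
Proof. by have := N01 (- x); rewrite /N'; lra. Qed.

Let upper w : 0 <= w -> 1 - N w <= C * p w.
Proof. by move=> w0; apply: mills_bound N_pinfty _ Cp C_ge0 vC. Qed.

Let lower w : w <= 0 -> N w <= C * p w.
Proof.
move=> w0; have w0' : 0 <= - w by rewrite oppr_ge0.
have := mills_bound v_gt0 w0' dN' dp' (fun x => p_ge0 _) N'_pinfty N'01 CpN C_ge0 vC.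
by rewrite /N' /p' opprK subKr.
Qed.

Let upper_mul w : 0 <= w -> w * (1 - N w) <= v * p w.
Proof.
rewrite le_eqVlt => /orP[/eqP <-|w0]; first by rewrite mul0r mulr_ge0// ltW.
exact: (mills_ratio v_gt0 w0 dN dp).
Qed.

Let lower_mul w : w <= 0 -> - w * N w <= v * p w.
Proof.
rewrite le_eqVlt => /orP[/eqP ->|w0].
  by rewrite oppr0 mul0r mulr_ge0// ltW.
have w0' : 0 < - w by rewrite oppr_gt0.
have := mills_ratio v_gt0 w0' dN' dp' (fun x => p_ge0 _) N'_pinfty.
by rewrite /N' /p' opprK subKr.
Qed.

Let N_mono w z : w <= z -> N w <= N z.
Proof.
move=> wz; rewrite -subr_ge0; have [c _ ->] := mean_value w z dN.
by rewrite mulr_ge0// subr_ge0.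
Qed.

(** The two branches of the classical solution; [gL] and [gR] are their derivatives, written through
    the Stein equation so that differentiating again stays algebraic. *)
Let fL w := (1 - N t) * (N w / p w).
Let fR w := N t * ((1 - N w) / p w).
Let gL w := w / v * fL w + (1 - N t).
Let gR w := w / v * fR w - N t.

Definition stein_sol w := if w <= t then fL w else fR w.
(** The derivative away from [t], defined by solving the Stein equation for it. The equation then
    holds at [t] too, where this is the left derivative. *)
Definition stein_der w := w / v * stein_sol w + ((w <= t)%R%:R - N t).

Let dpV (x : R) : is_derive x 1 (fun y => (p y)^-1) (x / v / p x).
Proof.
have px : p x != 0 by rewrite gt_eqF.
have := is_deriveV px (dp x); move/is_derive_eq; apply.
by rewrite /GRing.scale/=; field; rewrite px gt_eqF.
Qed.

Let dfL (w : R) : is_derive w 1 fL (gL w).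
Proof.
have pw : p w != 0 by rewrite gt_eqF.
have := is_deriveZ (1 - N t) (is_deriveM (dN w) (dpV w)).
move/is_derive_eq; apply.
by rewrite /gL /fL /GRing.scale/=; field; rewrite pw gt_eqF.
Qed.

Let dfR (w : R) : is_derive w 1 fR (gR w).
Proof.
have pw : p w != 0 by rewrite gt_eqF.
have := is_deriveZ (N t) (is_deriveM (is_deriveB (@is_derive_cst R R R 1 w 1) (dN w)) (dpV w)).
move/is_derive_eq; apply.
by rewrite !fctE /gR /fR /GRing.scale/=; field; rewrite pw gt_eqF.
Qed.

Let dgL (w : R) : is_derive w 1 gL (v^-1 * (fL w + w * gL w)).
Proof.
have := is_deriveD (is_deriveM (is_deriveM (@is_derive_id R R w 1) (@is_derive_cst R R R v^-1 w 1))
  (dfL w)) (@is_derive_cst R R R (1 - N t) w 1).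
move/is_derive_eq; apply.
by rewrite !fctE /GRing.scale/=; field; rewrite gt_eqF.
Qed.

Let dgR (w : R) : is_derive w 1 gR (v^-1 * (fR w + w * gR w)).
Proof.
have := is_deriveB (is_deriveM (is_deriveM (@is_derive_id R R w 1) (@is_derive_cst R R R v^-1 w 1))
  (dfR w)) (@is_derive_cst R R R (N t) w 1).
move/is_derive_eq; apply.
by rewrite !fctE /GRing.scale/=; field; rewrite gt_eqF.
Qed.

(** By monotonicity of [N] both bounds hold on either side of [t], so the tail estimate can be
    chosen by the sign of [w] alone. *)
Let sol_bounds w : [/\ 0 <= stein_sol w, stein_sol w * p w <= N w &
  stein_sol w * p w <= 1 - N w].
Proof.
have pw : p w != 0 by rewrite gt_eqF.
have /andP[Nw0 Nw1] := N01 w; have /andP[Nt0 Nt1] := N01 t.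
rewrite /stein_sol; case: (leP w t) => wt.
- have Nwt := N_mono wt; rewrite /fL -mulrA divfK//; split.
  + by rewrite mulr_ge0 ?subr_ge0// divr_ge0.
  + by rewrite ler_piMl// gerBl.
  + apply: (@le_trans _ _ (1 - N t)); first by rewrite ler_piMr// subr_ge0.
    by rewrite lerD2l lerN2.
- have Nwt := N_mono (ltW wt); rewrite /fR -mulrA divfK//; split.
  + by rewrite mulr_ge0// divr_ge0// subr_ge0.
  + by apply: le_trans Nwt; rewrite ler_piMr// gerBl.
  + by rewrite ler_piMl// subr_ge0.
Qed.

Lemma stein_sol_le w : `|stein_sol w| <= C.
Proof.
have [s0 s1 s2] := sol_bounds w; rewrite ger0_norm// -(ler_pM2r (p_gt0 w)).
case: (leP 0 w) => w0; first by apply: (le_trans s2); exact: upper.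
by apply: (le_trans s1); apply: lower; exact: ltW.
Qed.

Lemma mul_stein_sol_le w : `|w / v * stein_sol w| <= 1.
Proof.
have [s0 s1 s2] := sol_bounds w.
rewrite mulrAC normrM [`|v^-1|]gtr0_norm ?invr_gt0// ler_pdivrMr// mul1r.
rewrite normrM [`|stein_sol w|]ger0_norm// -(ler_pM2r (p_gt0 w)) -mulrA.
case: (leP 0 w) => w0.
  rewrite ger0_norm//; apply: le_trans (upper_mul w0); exact: ler_wpM2l.
rewrite ltr0_norm//; apply: le_trans (lower_mul (ltW w0)).
by apply: ler_wpM2l => //; rewrite oppr_ge0 ltW.
Qed.

Lemma stein_der_le w : `|stein_der w| <= 2.
Proof.
apply: (le_trans (ler_normD _ _)).
have := mul_stein_sol_le w; have /andP[Nt0 Nt1] := N01 t.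
have : `|(w <= t)%R%:R - N t| <= 1.
  by case: (w <= t); rewrite /= ?mulr1n ?mulr0n ler_norml; apply/andP; split; lra.
lra.
Qed.

Let solL w : w <= t -> stein_sol w = fL w.
Proof. by move=> wt; rewrite /stein_sol wt. Qed.

(** The branches agree at [t], so each formula is valid on a closed half-line. *)
Let solR w : t <= w -> stein_sol w = fR w.
Proof.
rewrite le_eqVlt => /orP[/eqP <-|tw]; last by rewrite /stein_sol leNgt tw.
by rewrite /stein_sol lexx /fL /fR; ring.
Qed.

Let gL_le w : w <= t -> `|gL w| <= 2.
Proof.
move=> wt; rewrite /gL -(solL wt); apply: (le_trans (ler_normD _ _)).
have := mul_stein_sol_le w; have /andP[Nt0 Nt1] := N01 t.
by rewrite [`|1 - _|]ger0_norm ?subr_ge0//; lra.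
Qed.

Let gR_le w : t <= w -> `|gR w| <= 2.
Proof.
move=> wt; rewrite /gR -(solR wt); apply: (le_trans (ler_normB _ _)).
have := mul_stein_sol_le w; have /andP[Nt0 Nt1] := N01 t.
by rewrite [`|N t|]ger0_norm//; lra.
Qed.

Lemma stein_sol_lipschitz a b : `|stein_sol b - stein_sol a| <= 2 * `|b - a|.
Proof.
wlog ab : a b / a <= b.
  move=> H; have [|/ltW] := leP a b; first exact: H.
  by move=> /H; rewrite distrC [`|a - b|]distrC.
have left a' b' : a' <= b' -> b' <= t ->
    `|stein_sol b' - stein_sol a'| <= 2 * `|b' - a'|.
  move=> ab' bt; rewrite !solL ?(le_trans ab')//.
  apply: (mean_value_le dfL) => x; rewrite min_l// max_r// => /andP[_ xb].
  by apply: gL_le; exact: le_trans bt.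
have right a' b' : a' <= b' -> t <= a' ->
    `|stein_sol b' - stein_sol a'| <= 2 * `|b' - a'|.
  move=> ab' ta; rewrite !solR ?(le_trans _ ab')//.
  apply: (mean_value_le dfR) => x; rewrite min_l// max_r// => /andP[ax _].
  by apply: gR_le; exact: le_trans ax.
have [bt|tb] := leP b t; first exact: left.
have [at_|ta] := leP a t; last by apply: right => //; exact: ltW.
have := left _ _ at_ (lexx t); have := right _ _ (ltW tb) (lexx t).
rewrite (@ger0_norm _ (b - t)) ?(@ger0_norm _ (t - a)) ?(@ger0_norm _ (b - a))
  ?subr_ge0// ?(ltW tb)// => h1 h2.
rewrite -(subrK (stein_sol t) (stein_sol b)) -addrA.
by apply: (le_trans (ler_normD _ _)); lra.
Qed.

Definition stein_step_cst : R := C + 4 + (C + 4) / v.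

(** If [w] and [w - y] are on the same side of [t], Taylor's formula applies, with second derivative
    at most (C + 4)(1 + |w|) / v. Otherwise [w] is within |y| of [t], and the bounds 2 on the
    Lipschitz constant and on the derivative give 4 |y|, charged to the indicator. *)
Lemma stein_sol_step d w y : d <= 2 -> `|y| <= d ->
  `|stein_sol w - stein_sol (w - y) - y * stein_der w| <=
  stein_step_cst * (1 + `|w|) * y ^+ 2 +
  stein_step_cst * `|y| * (`|w - t| <= d)%R%:R.
Proof.
move=> d2 yd; set K := stein_step_cst.
have Cv0 : 0 <= (C + 4) / v by rewrite divr_ge0 ?(ltW v_gt0)// addr_ge0.
have C4 : C + 4 <= K by rewrite lerDl.
have C4v : (C + 4) / v <= K by rewrite lerDr addr_ge0.
have K0 : 0 <= K by exact: le_trans C4v.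
have cross : `|w - t| <= `|y| ->
    `|stein_sol w - stein_sol (w - y) - y * stein_der w| <=
    K * (1 + `|w|) * y ^+ 2 + K * `|y| * (`|w - t| <= d)%R%:R.
  move=> wty; rewrite (le_trans wty yd) mulr1.
  apply: (@le_trans _ _ (4 * `|y|)).
    apply: (le_trans (ler_normB _ _)).
    have := stein_sol_lipschitz (w - y) w; rewrite subKr.
    have : `|y * stein_der w| <= `|y| * 2.
      by rewrite normrM ler_wpM2l// stein_der_le.
    lra.
  rewrite -[leLHS]add0r; apply: lerD.
    by rewrite mulr_ge0 ?sqr_ge0// mulr_ge0// addr_ge0.
  by apply: ler_wpM2r => //; apply: le_trans C4; rewrite lerDr.
have smooth (f g : R -> R) : (forall x : R, is_derive x 1 f (g x)) ->
    (forall x : R, is_derive x 1 g (v^-1 * (f x + x * g x))) ->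
    (forall x, Num.min w (w - y) <= x <= Num.max w (w - y) ->
      `|f x| <= C /\ `|g x| <= 2) ->
    `|f w - f (w - y) - y * g w| <=
    K * (1 + `|w|) * y ^+ 2 + K * `|y| * (`|w - t| <= d)%R%:R.
  move=> df dg fg.
  have := @taylor1_le _ f g _ w (w - y) (K * (1 + `|w|)) df dg.
  rewrite (_ : w - y - w = - y); last by ring.
  rewrite sqrrN.
  have -> : f w - f (w - y) - y * g w = - (f (w - y) - f w - g w * - y) by ring.
  rewrite normrN => H; apply: (le_trans (H _)); last by rewrite lerDl !mulr_ge0.
  move=> x xw; have [fx gx] := fg x xw.
  have := between_dist xw; rewrite (_ : w - y - w = - y); last by ring.
  rewrite normrN => xwy.
  have xle : `|x| <= `|w| + 2.
    rewrite -(subrK w x); apply: (le_trans (ler_normD _ _)); lra.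
  rewrite normrM gtr0_norm ?invr_gt0//.
  apply: (@le_trans _ _ (v^-1 * ((C + 4) * (1 + `|w|)))).
    apply: ler_wpM2l; first by rewrite invr_ge0 ltW.
    apply: (le_trans (ler_normD _ _)); rewrite normrM.
    have : `|x| * `|g x| <= (`|w| + 2) * 2 by exact: ler_pM.
    have : 0 <= C * `|w| by rewrite mulr_ge0.
    have := normr_ge0 w; lra.
  rewrite mulrA; apply: ler_wpM2r; first by rewrite addr_ge0.
  by rewrite mulrC.
have [wt|tw] := leP w t; have [wyt|twy] := leP (w - y) t.
- have dE : stein_der w = gL w by rewrite /stein_der wt (solL wt).
  rewrite dE (solL wt) (solL wyt); apply: (smooth _ _ dfL dgL) => x /andP[_].
  rewrite le_max => xw; have xt : x <= t.
    by case/orP: xw => /le_trans; apply.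
  by rewrite -(solL xt); split; [exact: stein_sol_le|exact: gL_le].
- apply: cross; rewrite distrC ger0_norm ?subr_ge0//.
  by rewrite ltr0_norm; lra.
- by apply: cross; rewrite !gtr0_norm; lra.
- have dE : stein_der w = gR w.
    by rewrite /stein_der leNgt tw (solR (ltW tw)) /gR /= sub0r.
  rewrite dE (solR (ltW tw)) (solR (ltW twy)).
  apply: (smooth _ _ dfR dgR) => x /andP[+ _].
  rewrite ge_min => xw; have xt : t <= x.
    by case/orP: xw; apply: le_trans; exact: ltW.
  by rewrite -(solR xt); split; [exact: stein_sol_le|exact: gR_le].
Qed.

Let derivable_continuous (f g : R -> R) :
  (forall x : R, is_derive x 1 f (g x)) -> continuous f.
Proof.
move=> df x; apply: differentiable_continuous; apply/derivable1_diffP.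
by case: (df x).
Qed.

Lemma stein_sol_lbm : locally_bounded_measurable stein_sol.
Proof.
split; last by move=> M; exists C => y _; exact: stein_sol_le.
apply: measurable_fun_ifT; first exact: measurable_fun_ler.
  by apply: continuous_measurable_fun; exact: derivable_continuous dfL.
by apply: continuous_measurable_fun; exact: derivable_continuous dfR.
Qed.

Lemma stein_der_lbm : locally_bounded_measurable stein_der.
Proof.
split; last by move=> M; exists 2 => y _; exact: stein_der_le.
apply: measurable_funD.
  apply: measurable_funM; first exact: measurable_funM.
  by case: stein_sol_lbm.
by apply: measurable_funB => //; case: (lbm_le t).
Qed.

Lemma stein_equation (ups a w : R) : 0 < ups -> v = ups / a -> 
  ups * stein_der w - a * w * stein_sol w = ups * ((w <= t)%R%:R - N t).
Proof.
move=> ups0 vE.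
have a0 : a != 0.
  by apply/eqP => a0; move: v_gt0; rewrite vE a0 invr0 mulr0 ltxx.
rewrite /stein_der vE. field.
by rewrite a0 lt0r_neq0.
Qed.

End stein_solution.

(** * Exponential tilting *)

Section exponential_moments.
Context {R : realType} (m : probability R R).
Hypothesis mI : m `[-1, 1]%classic = 1%E.

Local Notation I := (`[-1, 1]%classic : set R).

Let mI_fin : (m I < +oo)%E. Proof. by rewrite mI ltry. Qed.

Let I_norm z : I z -> `|z| <= 1.
Proof. by rewrite /= in_itv/= ler_norml. Qed.

Lemma m_outside : m (~` I) = 0%E.
Proof. by rewrite probability_setC// mI subee. Qed.

Lemma continuous_integrable (g : R -> R) : continuous g -> m.-integrable I (EFin \o g).
Proof.
move=> cg; apply: measurable_bounded_integrable => //.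
  by apply: measurable_funTS; exact: continuous_measurable_fun.
have [_ /(_ 1) [K HK]] := continuous_lbm cg.
exists K; split; first exact: num_real.
by move=> x Kx z Iz /=; rewrite (le_trans _ (ltW Kx))// HK// I_norm.
Qed.

Definition emom k (theta : R) : R := \int[m]_(z in I) (z ^+ k * expR (theta * z)).

Let integrand_cont k theta : continuous (fun z : R => z ^+ k * expR (theta * z)).
Proof.
move=> z; apply: cvgM; first exact: exprn_continuous.
apply: continuous_comp; last exact: continuous_expR.
exact: mulrl_continuous.
Qed.

Let dintegrand k (z t : R) :
  is_derive t 1 (fun theta : R => z ^+ k * expR (theta * z)) (z ^+ k.+1 * expR (t * z)).
Proof.
have h1 : is_derive t 1 (fun theta : R => theta * z) z.
  have := is_deriveM (@is_derive_id R R t 1) (@is_derive_cst R R R z t 1).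
  by move/is_derive_eq; apply; rewrite /GRing.scale/= mulr0 add0r mulr1.
have h2 := @is_derive1_comp R expR (fun theta => theta * z) t _ _
  (is_derive_expR (t * z)) h1.
have := is_deriveZ (z ^+ k) h2.
move/is_derive_eq; apply.
by rewrite /GRing.scale/= exprS; ring.
Qed.

Let integrand_le k t z : I z -> `|z ^+ k * expR (t * z)| <= expR `|t|.
Proof.
move=> /I_norm z1; rewrite normrM (gtr0_norm (expR_gt0 _)).
apply: (@le_trans _ _ (1 * expR (t * z))).
  by apply: ler_wpM2r; rewrite ?expR_ge0// normrX exprn_ile1.
rewrite mul1r ler_expR (le_trans (ler_norm _))// normrM ler_piMr//.
Qed.

Lemma emom_derive k (theta : R) : is_derive theta 1 (emom k) (emom k.+1 theta).
Proof.
pose f (t z : R) := z ^+ k * expR (t * z).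
have mI' : measurable I by [].
have ia : `]theta - 1, theta + 1[%classic theta.
  by rewrite /= in_itv/= ltrBlDr ltrDl ltr01.
have intf (x : R) : `]theta - 1, theta + 1[%classic x -> m.-integrable I (EFin \o f x).
  by move=> _; apply: continuous_integrable; exact: integrand_cont.
have derf (x z : R) : `]theta - 1, theta + 1[%classic x -> I z ->
    derivable (f ^~ z) x 1.
  by move=> _ _; have [] := dintegrand k z x.
(* Domination is local: on the interval of radius 1 around [theta] the derivative of the integrand
   is at most e^(|theta| + 1). *)
have G0 (z : R) : 0 <= (cst (expR (`|theta| + 1)) : R -> R) z by exact: expR_ge0.
have intG : m.-integrable I (EFin \o (cst (expR (`|theta| + 1)) : R -> R)).
  by apply: continuous_integrable; exact: cst_continuous.
have d1E (x z : R) : partial1of2 f x z = z ^+ k.+1 * expR (x * z).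
  by rewrite partial1of2E; have [_ ->] := dintegrand k z x.
have Gub (x z : R) : `]theta - 1, theta + 1[%classic x -> I z ->
    `|partial1of2 f x z| <= (cst (expR (`|theta| + 1)) : R -> R) z.
  rewrite /= in_itv/= => /andP[x1 x2] Iz; rewrite d1E.
  apply: (le_trans (integrand_le _ _ Iz)); rewrite ler_expR.
  rewrite -(subrK theta x) addrC; apply: (le_trans (ler_normD _ _)).
  by rewrite lerD2l ler_norml; apply/andP; split; lra.
have := differentiation_under_integral mI' ia intf derf G0 intG Gub.
have der := derivable_under_integral mI' ia intf derf G0 intG Gub.
rewrite derive1E => E; apply: DeriveDef; first exact: der.
rewrite -[LHS]/(_ _ _ _) E; apply: eq_Rintegral => z _.
by rewrite d1E.
Qed.

Lemma emom_quadratic (a b c theta : R) :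
  \int[m]_(z in I) ((a + b * z + c * z ^+ 2) * expR (theta * z)) =
  a * emom 0 theta + b * emom 1 theta + c * emom 2 theta.
Proof.
have im k : m.-integrable I (EFin \o (fun z : R => z ^+ k * expR (theta * z))).
  by apply: continuous_integrable; exact: integrand_cont.
have ia k (e : R) : m.-integrable I
    (EFin \o (fun z : R => e * (z ^+ k * expR (theta * z)))).
  apply: continuous_integrable => z; apply: cvgM; first exact: cvg_cst.
  exact: integrand_cont.
have E k (e : R) : e * emom k theta =
    \int[m]_(z in I) (e * (z ^+ k * expR (theta * z))).
  by rewrite RintegralZl.
rewrite (E 0%N) (E 1%N) (E 2%N) -RintegralD// -RintegralD//.
  by apply: eq_Rintegral => z _; rewrite expr0 expr1; ring.
apply: continuous_integrable => z; apply: cvgD; apply: cvgM;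
  by [exact: cvg_cst|exact: integrand_cont].
Qed.

Lemma emom_quadratic_ge0 (a b c theta : R) :
  (forall z, `|z| <= 1 -> 0 <= a + b * z + c * z ^+ 2) ->
  0 <= a * emom 0 theta + b * emom 1 theta + c * emom 2 theta.
Proof.
move=> abc; rewrite -emom_quadratic; apply: Rintegral_ge0 => z /I_norm z1.
by rewrite mulr_ge0 ?expR_ge0// abc.
Qed.

Lemma emom0_gt0 theta : 0 < emom 0 theta.
Proof.
apply: (@lt_le_trans _ _ (\int[m]_(z in I) expR (- `|theta|))).
  rewrite Rintegral_cst// (_ : fine _ = 1) ?mulr1 ?expR_gt0//.
  exact: (congr1 fine mI).
apply: le_Rintegral => //.
- by apply: continuous_integrable; exact: cst_continuous.
- by apply: continuous_integrable; exact: integrand_cont.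
- move=> z /I_norm z1; rewrite expr0 mul1r ler_expR lerNl -mulNr.
  by rewrite (le_trans (ler_norm _))// normrM normrN ler_piMr.
Qed.

Lemma emom_le k theta : `|emom k theta| <= emom 0 theta.
Proof.
rewrite /emom; apply: (le_trans (le_normr_Rintegral _ _)) => //.
  by apply: continuous_integrable; exact: integrand_cont.
apply: le_Rintegral => //.
- apply: continuous_integrable => z.
  by apply: cvg_norm; exact: integrand_cont.
- by apply: continuous_integrable; exact: integrand_cont.
- move=> z /I_norm z1; rewrite normrM (gtr0_norm (expR_gt0 _)).
  by apply: ler_wpM2r; rewrite ?expR_ge0// normrX expr0 exprn_ile1.
Qed.

(** Moments of [m] tilted by e^(theta z): the first is psi' and [tvar] is psi''. *)
Definition tmom k theta := emom k theta / emom 0 theta.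

Lemma tmom_derive k (theta : R) :
  is_derive theta 1 (tmom k) (tmom k.+1 theta - tmom k theta * tmom 1 theta).
Proof.
have m0 : emom 0 theta != 0 by rewrite gt_eqF// emom0_gt0.
have := is_deriveM (emom_derive k theta) (is_deriveV m0 (emom_derive 0 theta)).
move/is_derive_eq; apply.
by rewrite /tmom /GRing.scale/=; field.
Qed.

Lemma tmom_le1 k theta : `|tmom k theta| <= 1.
Proof.
have m0 := emom0_gt0 theta.
by rewrite normrM [`|_^-1|]gtr0_norm ?invr_gt0// ler_pdivrMr// mul1r emom_le.
Qed.

Definition tvar theta := tmom 2 theta - tmom 1 theta ^+ 2.

Definition tvar_der theta := tmom 3 theta - tmom 2 theta * tmom 1 theta
  - 2 * tmom 1 theta * tvar theta.

Lemma tvar_derive (theta : R) : is_derive theta 1 tvar (tvar_der theta).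
Proof.
have := is_deriveB (tmom_derive 2 theta) (is_deriveM (tmom_derive 1 theta) (tmom_derive 1 theta)).
move/is_derive_eq; apply.
by rewrite /tvar_der /tvar /GRing.scale/=; ring.
Qed.

Lemma tvar01 theta : 0 <= tvar theta <= 1.
Proof.
have m0 := emom0_gt0 theta; apply/andP; split; last first.
  rewrite /tvar lerBlDr; have := tmom_le1 2 theta; have := sqr_ge0 (tmom 1 theta).
  by rewrite ler_norml => ? /andP[_]; lra.
(* The lower bound integrates (z - b)^2 against the tilted law, [b] being its mean. *)
set b := tmom 1 theta.
have H z : `|z| <= 1 -> 0 <= b ^+ 2 + (- 2 * b) * z + 1 * z ^+ 2.
  by move=> _; have := sqr_ge0 (z - b); lra.
have P := emom_quadratic_ge0 theta H.
rewrite -(pmulr_rge0 _ m0) (_ : emom 0 theta * tvar theta = 1 * emom 2 theta -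
   b ^+ 2 * emom 0 theta); last first.
  by rewrite /tvar -/b /tmom; field; rewrite gt_eqF.
have : b * emom 0 theta = emom 1 theta by rewrite /b /tmom divfK// gt_eqF.
by move=> E; move: P; rewrite -E; lra.
Qed.

(** The third cumulant of the tilted law; moments bounded by 1 give 2 + 2. The looser 6 is the
    constant carried by [high_temperature]. *)
Lemma tvar_der_le theta : `|tvar_der theta| <= 6.
Proof.
have /andP[v0 v1] := tvar01 theta; rewrite /tvar_der.
apply: (le_trans (ler_normB _ _)).
have h1 : `|tmom 3 theta - tmom 2 theta * tmom 1 theta| <= 2.
  apply: (le_trans (ler_normB _ _)); rewrite [`|_ * tmom 1 _|]normrM.
  have := tmom_le1 3 theta.
  have : `|tmom 2 theta| * `|tmom 1 theta| <= 1 * 1 by apply: ler_pM; rewrite ?tmom_le1.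
  lra.
have : `|2 * tmom 1 theta * tvar theta| <= 2 * 1 * 1.
  rewrite normrM; apply: ler_pM => //; last by rewrite ger0_norm.
  by rewrite normrM normr_nat ler_wpM2l// tmom_le1.
lra.
Qed.

Lemma psiE theta : psi m theta = ln (emom 0 theta).
Proof.
rewrite /psi /emom; congr ln.
rewrite /Rintegral (@ge0_negligible_integral _ _ _ m setT (~` I)).
- by rewrite setTD setCK; congr fine; apply: eq_integral => z _; rewrite expr0 mul1r.
- exact: measurableC.
- by [].
- apply/measurable_EFinP; apply: continuous_measurable_fun => z.
  by have := @integrand_cont 0 theta z; under eq_fun do rewrite expr0 mul1r.
- by move=> z _; rewrite lee_fin expR_ge0.
- exact: m_outside.
Qed.

Lemma psi_derive (theta : R) : is_derive theta 1 (psi m) (tmom 1 theta).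
Proof.
rewrite (_ : psi m = @ln R \o emom 0); last by apply: funext => t; exact: psiE.
have := is_derive1_comp (is_derive1_ln (emom0_gt0 theta)) (emom_derive 0 theta).
by move/is_derive_eq; apply; rewrite /tmom mulrC.
Qed.

Lemma psi1E : (psi m)^`()%classic = tmom 1.
Proof. by apply: funext => t; rewrite derive1E; have [_ ->] := psi_derive t. Qed.

Lemma psi2E : (psi m)^`(2)%classic = tvar.
Proof.
apply: funext => t; rewrite derive1nS derive1n1 psi1E derive1E.
by have [_ ->] := tmom_derive 1 t; rewrite /tvar expr2.
Qed.

Lemma psi0 : psi m 0 = 0.
Proof.
rewrite psiE /emom (_ : \int[m]_(z in I) _ = 1) ?ln1//.
transitivity (\int[m]_(z in I) 1).
  by apply: eq_Rintegral => z _; rewrite expr0 mul0r expR0 mul1r.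
rewrite Rintegral_cst// (_ : fine _ = 1) ?mulr1//.
exact: (congr1 fine mI).
Qed.

Lemma tmom1_nondecreasing a b : a <= b -> tmom 1 a <= tmom 1 b.
Proof.
move=> ab; have [c _ E] := mean_value a b (tmom_derive 1).
rewrite -subr_ge0 E -expr2 mulr_ge0// ?subr_ge0//.
by have /andP[] := tvar01 c; rewrite /tvar subr_ge0.
Qed.

Lemma psi_convex eta theta : psi m eta + tmom 1 eta * (theta - eta) <= psi m theta.
Proof.
have [c cb E] := mean_value eta theta psi_derive; rewrite -lerBrDl E; move: cb.
case: (leP eta theta) => et /andP[c1 c2].
  by rewrite ler_wpM2r ?subr_ge0// tmom1_nondecreasing.
by rewrite ler_wnM2r ?subr_le0 ?(ltW et)// tmom1_nondecreasing.
Qed.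

Lemma psi_argmin (u theta : R) :
  (forall eta, u * eta - psi m eta <= u * theta - psi m theta) -> u = tmom 1 theta.
Proof.
move=> H; pose g := psi m - (u \*o id).
have dg (t : R) : is_derive t 1 g (tmom 1 t - u).
  have := is_deriveB (psi_derive t) (is_deriveZ u (@is_derive_id R R t 1)).
  by move/is_derive_eq; apply; rewrite /GRing.scale/= mulr1.
have := @derive1_at_min R g (theta - 1) (theta + 1) theta.
move=> /(_ _ _ _ _)[].
- lra.
- by move=> t _; have [] := dg t.
- by rewrite in_itv/=; apply/andP; split; lra.
- by move=> t _; rewrite /g !fctE/=; have := H t; lra.
move=> _; have [_ ->] := dg theta; lra.
Qed.

End exponential_moments.

(** * Rate functions and the mean-field optimizer *)

Section base_measure_theory.
Context {R : realType} (m : probability R R).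
Hypothesis bm : base_measure m.

Local Notation I := (`[-1, 1]%classic : set R).
Local Notation mean := (tmom m 1).

Let mI : m `[-1, 1]%classic = 1%E. Proof. by case: bm. Qed.

Let support_sign (s : R) : s = 1 \/ s = -1 -> in_support m s.
Proof. by case: bm => _ _ mN m1 [->|->]. Qed.

(** The mass [p] is fixed before [g] and [c], so it can serve for all tilts at once. *)
Lemma integral_ge_support (U : set R) (x : R) : open U -> U x -> in_support m x ->
  exists2 p : R, 0 < p & forall (g : R -> R) c, continuous g ->
    (forall z, I z -> 0 <= g z) -> 0 <= c -> (forall z, I z -> U z -> c <= g z) ->
    c * p <= \int[m]_(z in I) g z.
Proof.
move=> oU Ux xm; have mU : measurable U by exact: open_measurable.
have mIm : measurable I by [].
have UIE : m (U `&` I) = m U.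
  rewrite [RHS](measureDI m mU mIm) [X in (X + _)%E](_ : _ = 0%E) ?add0e//.
  apply: (@subset_measure0 _ _ _ m _ (~` I)) => //.
  - exact: measurableD.
  - exact: measurableC.
  - exact: m_outside.
have fU : m U \is a fin_num by exact: fin_num_measure.
exists (fine (m U)); first by rewrite fine_gt0// (xm U oU Ux)/= ltey_eq fU.
move=> g c cg g0 c0 gc.
have iU : m.-integrable I (EFin \o \1_U).
  by apply: (integrableS measurableT) => //; exact: integrable_indic.
have -> : c * fine (m U) = \int[m]_(z in I) (c * \1_U z).
  rewrite RintegralZl//; congr (_ * _).
  by rewrite /Rintegral integral_indic//; exact: esym (congr1 fine UIE).
apply: le_Rintegral => //.
- have := integrableZl mIm c iU; apply: eq_integrable => //.
- exact: continuous_integrable.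
- move=> z Iz; rewrite indicE; case: (boolP (z \in U)) => [/set_mem Uz|_].
    by rewrite mulr1 gc.
  by rewrite mulr0 g0.
Qed.

(** The tilted mean of 1 - s z is positive: the opposite endpoint [- s] is in the support, and near
    it the integrand exceeds a positive constant. *)
Lemma mean_lt1_sign (s theta : R) : s = 1 \/ s = -1 -> s * mean theta < 1.
Proof.
move=> s1; have ss : s * s = 1 by case: s1 => ->; ring.
pose U := [set z : R | s * z < 0].
have oU : open U.
  have -> : U = (fun z => s * z) @^-1` [set y | y < 0] by [].
  apply: open_comp; last exact: open_lt.
  by move=> z _; exact: mulrl_continuous.
have Us : U (- s) by rewrite /U/= mulrN ss oppr_lt0.
have sN : - s = 1 \/ - s = -1 by case: s1 => ->; [right|left; rewrite opprK].
have [p p0 Hp] := integral_ge_support oU Us (support_sign sN).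
have := Hp (fun z => (1 + (- s) * z + 0 * z ^+ 2) * expR (theta * z)) (expR (- `|theta|)).
have sz z : I z -> `|s * z| <= 1.
  rewrite /= in_itv/= -ler_norml => z1; rewrite normrM.
  by case: s1 => ->; rewrite ?normrN normr1 mul1r.
rewrite emom_quadratic// => H.
have : expR (- `|theta|) * p <= 1 * emom m 0 theta + - s * emom m 1 theta +
    0 * emom m 2 theta.
  apply: H.
  - move=> z; apply: cvgM; last first.
      apply: continuous_comp; last exact: continuous_expR.
      exact: mulrl_continuous.
    apply: cvgD; last by apply: cvgM; [exact: cvg_cst|exact: exprn_continuous].
    apply: cvgD; first exact: cvg_cst.
    exact: mulrl_continuous.
  - move=> z /sz; rewrite ler_norml => /andP[_ h]; rewrite mulr_ge0 ?expR_ge0//; lra.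
  - exact: expR_ge0.
  - move=> z Iz Uz; apply: (@le_trans _ _ (1 * expR (theta * z))).
      rewrite mul1r ler_expR lerNl -mulNr (le_trans (ler_norm _))//.
      rewrite normrM normrN ler_piMr//.
      by move: Iz; rewrite /= in_itv/= -ler_norml.
    by apply: ler_wpM2r; [exact: expR_ge0|move: Uz; rewrite /U/=; lra].
have ep : 0 < expR (- `|theta|) * p by rewrite mulr_gt0 ?expR_gt0.
have m0 := emom0_gt0 mI theta.
rewrite /tmom mulrA ltr_pdivrMr// mul1r; lra.
Qed.

Lemma mean_norm_lt1 theta : `|mean theta| < 1.
Proof.
rewrite ltr_norml; apply/andP; split.
  by have := @mean_lt1_sign (-1) theta (or_intror erefl); lra.
by have := @mean_lt1_sign 1 theta (or_introl erefl); lra.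
Qed.

(** Convexity of [psi] with psi(0) = 0 bounds t (s mean) below by psi(s t), and the mass [p] near
    the endpoint gives psi(s t) >= t (1 - e) + ln p. *)
Lemma mean_unbounded (s w : R) : s = 1 \/ s = -1 -> w < 1 ->
  exists theta, w <= s * mean theta.
Proof.
move=> s1 w1; have ss : s * s = 1 by case: s1 => ->; ring.
pose e := (1 - w) / 2; have e0 : 0 < e by rewrite /e; lra.
pose U := [set z : R | 1 - e < s * z].
have oU : open U.
  have -> : U = (fun z => s * z) @^-1` [set y | 1 - e < y] by [].
  apply: open_comp; last exact: open_gt.
  by move=> z _; exact: mulrl_continuous.
have Us : U s by rewrite /U/= ss; lra.
have [p p0 Hp] := integral_ge_support oU Us (support_sign s1).
(* Large enough that - ln p <= t e, so the two losses leave 1 - 2 e = w; the added 1 keeps [t]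
   positive. *)
pose t := `|ln p| / e + 1.
have t0 : 0 < t by rewrite ltr_wpDl// divr_ge0// ltW.
exists (s * t).
have Hm : expR (t * (1 - e)) * p <= emom m 0 (s * t).
  have := Hp (fun z => (1 + 0 * z + 0 * z ^+ 2) * expR (s * t * z)) (expR (t * (1 - e))).
  rewrite emom_quadratic// => H.
  have := H; rewrite mul1r !mul0r !addr0; apply.
  - move=> z; apply: cvgM; last first.
      apply: continuous_comp; last exact: continuous_expR.
      exact: mulrl_continuous.
    apply: cvgD; last by apply: cvgM; [exact: cvg_cst|exact: exprn_continuous].
    apply: cvgD; first exact: cvg_cst.
    exact: mulrl_continuous.
  - by move=> z _; rewrite !mul0r !addr0 mul1r expR_ge0.
  - exact: expR_ge0.
  - move=> z _ Uz; rewrite !mul0r !addr0 mul1r ler_expR.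
    by rewrite [s * t]mulrC -mulrA ler_wpM2l ?(ltW t0)//; exact: ltW.
have psi_ge : t * (1 - e) + ln p <= psi m (s * t).
  rewrite psiE// -[t * (1 - e)]expRK -lnM ?posrE ?expR_gt0//.
  by rewrite ler_ln ?posrE// ?mulr_gt0 ?expR_gt0// emom0_gt0.
have := psi_convex mI (s * t) 0; rewrite psi0// sub0r.
have te : - ln p <= t * e.
  rewrite /t mulrDl divfK ?gt_eqF// mul1r.
  by have := ler_norm (- ln p); rewrite normrN; lra.
move=> H; rewrite -(ler_pM2l t0).
have -> : t * w = t * (1 - e) - t * e by rewrite /e; field.
have -> : t * (s * mean (s * t)) = - (mean (s * t) * - (s * t)) by ring.
lra.
Qed.

Lemma mean_surjective z : `|z| < 1 -> exists theta, mean theta = z.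
Proof.
rewrite ltr_norml => /andP[z1 z2].
have [b zb] := mean_unbounded (or_introl erefl) z2.
have zN : - z < 1 by lra.
have [a az] := mean_unbounded (or_intror erefl) zN.
have {}zb : z <= mean b by move: zb; rewrite mul1r.
have {}az : mean a <= z by move: az; move: (mean a) => y; lra.
have cm : continuous mean.
  move=> x; apply: differentiable_continuous; apply/derivable1_diffP.
  by case: (tmom_derive mI 1 x).
case: (leP a b) => ab.
  have [] := @IVT R mean a b z ab (continuous_subspaceT cm).
    by apply/andP; split; [rewrite ge_min az|rewrite le_max zb orbT].
  by move=> c _ <-; exists c.
(* With [b < a], monotonicity pins the value at [a] between [z] and [z]. *)
exists a; apply/eqP; rewrite eq_le az/=; apply: (le_trans zb).
by apply: tmom1_nondecreasing => //; exact: ltW.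
Qed.

Lemma mean_phi z : `|z| < 1 -> mean (phi m z) = z.
Proof.
move=> z1; rewrite -(psi1E mI) /phi; apply: pinvK.
have [t tz] := mean_surjective z1; rewrite inE; exists t => //.
by rewrite (psi1E mI).
Qed.

Let J z := z * phi m z - psi m (phi m z).

Let J_ge (z eta : R) : `|z| < 1 -> z * eta - psi m eta <= J z.
Proof.
move=> z1; have := psi_convex mI (phi m z) eta; rewrite (mean_phi z1) /J.
move: (phi m z) => p; move: (psi m p) (psi m eta) => a b; lra.
Qed.

(** Both inequalities come from tangent lines of [psi], so [J] is evaluated without identifying
    [phi m (mean theta)] with [theta]. *)
Let J_mean theta : J (mean theta) = mean theta * theta - psi m theta.
Proof.
apply/le_anti/andP; split; last exact: J_ge (mean_norm_lt1 theta).
rewrite /J.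
move: (phi m (mean theta)) => y; have := psi_convex mI theta y.
by move: (mean theta) (psi m theta) (psi m y) => a b c; lra.
Qed.

(** To the right of the untilted mean the slope [phi m x] is nonnegative. Monotonicity near the
    endpoints makes the limits in [rate] exist. *)
Let J_mono_up x y : mean 0 < x -> x <= y -> y < 1 -> J x <= J y.
Proof.
move=> bx xy y1; have := mean_norm_lt1 0; rewrite ltr_norml => /andP[b1 _].
have x1 : `|x| < 1 by rewrite ltr_norml; apply/andP; split; lra.
have y1' : `|y| < 1 by rewrite ltr_norml; apply/andP; split; lra.
have phi0 : 0 <= phi m x.
  rewrite leNgt; apply/negP => /ltW /(tmom1_nondecreasing mI).
  by rewrite mean_phi//; lra.
have H : x * phi m x - psi m (phi m x) <= y * phi m x - psi m (phi m x).
  by apply: lerD; [exact: ler_wpM2r|exact: lexx].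
exact: (le_trans H (J_ge (phi m x) y1')).
Qed.

Let J_mono_down x y : -1 < x -> x <= y -> y < mean 0 -> J y <= J x.
Proof.
move=> x1 xy yb; have := mean_norm_lt1 0; rewrite ltr_norml => /andP[_ b1].
have x1' : `|x| < 1 by rewrite ltr_norml; apply/andP; split; lra.
have y1 : `|y| < 1 by rewrite ltr_norml; apply/andP; split; lra.
have phi0 : phi m y <= 0.
  rewrite leNgt; apply/negP => /ltW /(tmom1_nondecreasing mI).
  by rewrite mean_phi//; lra.
have H : y * phi m y - psi m (phi m y) <= x * phi m y - psi m (phi m y).
  by apply: lerD; [exact: ler_wnM2r|exact: lexx].
exact: (le_trans H (J_ge (phi m y) x1')).
Qed.

Let J_cvg_left : cvg ((J x)%:E @[x --> 1^'-]).
Proof.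
have := mean_norm_lt1 0; rewrite ltr_norml => /andP[b1 b2].
have : cvg (((fun x => (J x)%:E) \o -%R) @ (-1 : R)^'+).
  apply: nonincreasing_at_right_is_cvge; near=> x.
  move=> y z; rewrite !in_itv/= => /andP[y1 yx] /andP[z1 zx] yz.
  rewrite lee_fin; apply: J_mono_up; [|lra|lra].
  have : x < - mean 0 by near: x; apply: nbhs_right_lt; lra.
  lra.
by move=> /cvg_ex[l Hl]; apply/cvg_ex; exists l; apply/cvg_at_leftNP.
Unshelve. all: by end_near.
Qed.

Let J_cvg_right : cvg ((J x)%:E @[x --> (-1)^'+]).
Proof.
have := mean_norm_lt1 0; rewrite ltr_norml => /andP[b1 b2].
apply: nonincreasing_at_right_is_cvge; near=> x.
move=> y z; rewrite !in_itv/= => /andP[y1 yx] /andP[z1 zx] yz.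
rewrite lee_fin; apply: J_mono_down => //; apply: (lt_trans zx).
by near: x; apply: nbhs_right_lt.
Unshelve. all: by end_near.
Qed.

Lemma rate_mean theta :
  rate m (mean theta) = (mean theta * theta - psi m theta)%:E.
Proof.
have := mean_norm_lt1 theta; rewrite ltr_norml => /andP[b1 b2].
by rewrite /rate (lt_eqF b2) (gt_eqF b1); exact: (congr1 EFin (J_mean theta)).
Qed.

(** The Fenchel-Young inequality, extended to the endpoints by passing to the limit. *)
Lemma rate_ge (z eta : R) : `|z| <= 1 -> ((z * eta - psi m eta)%:E <= rate m z)%E.
Proof.
move=> z1; rewrite /rate.
have cv (F : set_system R) (x0 : R) : Filter F -> (fun x : R => x) @ F --> x0 ->
    (fun x : R => (x * eta - psi m eta)%:E) @ F --> (x0 * eta - psi m eta)%:E.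
  move=> FF Fx; apply: cvg_EFin; first by near=> x.
  apply: cvgB; last exact: cvg_cst.
  by apply: cvgM => //; exact: cvg_cst.
case: eqVneq => [->|z_neq1].
  have ids : (fun x : R => x) @ (1 : R)^'- --> (1 : R).
    by apply: cvg_at_left_filter; exact: cvg_id.
  have cvf : (x * eta - psi m eta)%:E @[x --> (1 : R)^'-] -->
      (1 * eta - psi m eta)%:E by exact: cv ids.
  apply: (lee_cvg_to cvf J_cvg_left).
  near=> x; suff x1 : `|x| < 1 by exact: (J_ge eta x1).
  rewrite ltr_norml; apply/andP; split; near: x.
      by apply: nbhs_left_gt; lra.
    exact: nbhs_left_lt.
case: eqVneq => [->|z_neqN1].
  have ids : (fun x : R => x) @ (-1 : R)^'+ --> (-1 : R).
    by apply: cvg_at_right_filter; exact: cvg_id.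
  have cvf : (x * eta - psi m eta)%:E @[x --> (-1 : R)^'+] -->
      (-1 * eta - psi m eta)%:E by exact: cv ids.
  apply: (lee_cvg_to cvf J_cvg_right).
  near=> x; suff x1 : `|x| < 1 by exact: (J_ge eta x1).
  rewrite ltr_norml; apply/andP; split; near: x.
      exact: nbhs_right_gt.
    by apply: nbhs_right_lt; lra.
have z1' : `|z| < 1.
  move: z1; rewrite ler_norml ltr_norml !lt_def => /andP[-> ->].
  by rewrite z_neqN1 eq_sym z_neq1.
exact: (J_ge eta z1').
Unshelve. all: by end_near.
Qed.

End base_measure_theory.

Section mean_field.
Context {R : realType} {n : nat} (mu : 'I_n -> probability R R).
Variables (A : 'M[R]_n) (c : 'cV[R]_n).
Hypothesis bmu : forall i, base_measure (mu i).
Hypothesis Asym : A^T = A.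
Hypothesis Adiag : forall i, A i i = 0.

Local Notation theta := (lfield (fun i j => A i j) (fun i => c i 0)).

(** The zero diagonal makes the energy affine in each coordinate, with the local field as slope. *)
Lemma energy_upd (x : 'I_n -> R) i z :
  energy A c (\col_j upd x i z j) = energy A c (\col_j upd x i 0 j) + z * theta i x.
Proof.
pose Y : 'cV[R]_n := \col_j upd x i 0 j; pose D : 'cV[R]_n := delta_mx i 0.
have -> : (\col_j upd x i z j : 'cV[R]_n) = Y + z *: D.
  apply/colP => j; rewrite !mxE /upd eqxx andbT.
  by case: (j == i); rewrite ?mulr1 ?mulr0 ?add0r ?addr0.
rewrite -/Y /energy.
have DM (M : 'cV[R]_n) : (D^T *m M) 0 0 = M i 0.
  by rewrite /D trmx_delta -rowE mxE.
have MD (M : 'rV[R]_n) : (M *m D) 0 0 = M 0 i.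
  by rewrite /D -colE mxE.
have AYi : (A *m Y) i 0 = \sum_j A i j * x j.
  rewrite !mxE; apply: eq_bigr => j _; rewrite !mxE /upd.
  by case: eqP => // ->; rewrite Adiag !mul0r.
have YAi : (Y^T *m A) 0 i = \sum_j A i j * x j.
  by rewrite -AYi -[in RHS]Asym -[in RHS](trmxK Y) -trmx_mul [RHS]mxE.
have addE (M M' : 'M[R]_1) : (M + M') 0 0 = M 0 0 + M' 0 0 by rewrite mxE.
have scaleE a (M : 'M[R]_1) : (a *: M) 0 0 = a * M 0 0 by rewrite mxE.
have -> : ((Y + z *: D)^T *m A *m (Y + z *: D)) 0 0 =
   (Y^T *m A *m Y) 0 0 + 2 * z * \sum_j A i j * x j.
  have h1 : (D^T *m A *m Y) 0 0 = \sum_j A i j * x j by rewrite -mulmxA DM.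
  have h2 : (Y^T *m A *m D) 0 0 = \sum_j A i j * x j by rewrite MD.
  have h3 : (D^T *m A *m D) 0 0 = 0 by rewrite -mulmxA DM /D -colE mxE Adiag.
  have -> : (Y + z *: D)^T *m A *m (Y + z *: D) = Y^T *m A *m Y +
      z *: (Y^T *m A *m D) + z *: (D^T *m A *m Y) + z ^+ 2 *: (D^T *m A *m D).
    rewrite [(_ + _)^T]linearD [X in (_ + X) *m _]linearZ /= !mulmxDl !mulmxDr.
    by rewrite -!scalemxAl -!scalemxAr scalerA -expr2 !addrA.
  by rewrite !addE !scaleE h1 h2 h3; ring.
have -> : (c^T *m (Y + z *: D)) 0 0 = (c^T *m Y) 0 0 + z * c i 0.
  by rewrite mulmxDr -scalemxAr addE scaleE MD [c^T 0 i]mxE.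
by rewrite /lfield /=; field.
Qed.

Let rate_nonneg i (z : R) : `|z| <= 1 -> (0%:E <= rate (mu i) z)%E.
Proof.
move=> z1; have := rate_ge (bmu i) 0 z1.
by rewrite mulr0 (psi0 _) ?subr0//; case: (bmu i).
Qed.

(** Optimality is tested by moving coordinate [i] alone to psi'(t), where t is its local field. This
    gives I(u_i) <= u_i t - psi(t); with Fenchel-Young, t maximises eta |-> u_i eta - psi(eta),
    hence u_i = psi'(t). The rate is never differentiated, and [u] may a priori touch the
    boundary. *)
Lemma mf_fixed_point (u : 'cV[R]_n) : mf_optimizer mu A c u ->
  forall i, u i 0 = tmom (mu i) 1 (theta i (fun j => u j 0)).
Proof.
move=> [cu umax].
have u1 j : `|u j 0| <= 1 by rewrite ler_norml; exact: cu.
pose m0 j := tmom (mu j) 1 0.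
pose z0 : 'cV[R]_n := \col_j m0 j.
have cube_of (z : 'cV[R]_n) : (forall j, `|z j 0| <= 1) -> cube z.
  by move=> z1 j; rewrite -ler_norml.
have cz0 : cube z0.
  by apply: cube_of => j; rewrite mxE ltW//; exact: mean_norm_lt1.
have Fz0 : mf_functional mu A c z0 \is a fin_num.
  rewrite /mf_functional fin_numB; apply/andP; split => //.
  apply/sum_fin_numP => j _ _; rewrite mxE rate_mean//.
(* An infinite rate would send the functional to minus infinity, below its finite value at the
   untilted means [z0]. *)
have ratefin j : rate (mu j) (u j 0) \is a fin_num.
  rewrite ge0_fin_numE; last exact: rate_nonneg.
  rewrite ltey; apply/eqP => rj.
  have := umax _ cz0; rewrite [leRHS]/mf_functional.
  rewrite (bigD1 j)//= rj addye; last first.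
    rewrite gt_eqF// (lt_le_trans (ltNyr 0))//; apply: sume_ge0 => k _.
    exact: rate_nonneg.
  by rewrite /= leeNy_eq => /eqP F; move: Fz0; rewrite F.
pose r j := fine (rate (mu j) (u j 0)).
have rE j : rate (mu j) (u j 0) = (r j)%:E by rewrite /r fineK.
move=> i; have bi := bmu i; have mi : mu i `[-1, 1]%classic = 1%E by case: bi.
set t := theta i _.
pose v := tmom (mu i) 1 t.
pose z : 'cV[R]_n := \col_j upd (fun j => u j 0) i v j.
have cz : cube z.
  apply: cube_of => j; rewrite mxE /upd; case: eqP => // _.
  by apply: ltW; exact: mean_norm_lt1.
pose r' j := upd r i (v * t - psi (mu i) t) j.
have rE' j : rate (mu j) (z j 0) = (r' j)%:E.
  rewrite mxE /r' /upd; case: eqP => [->|_]; last exact: rE.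
  exact: rate_mean.
have uE : u = \col_j upd (fun j => u j 0) i (u i 0) j.
  by apply/colP => j; rewrite mxE /upd; case: eqP => // ->.
have Fz : mf_functional mu A c z = (energy A c z - \sum_j r' j)%:E.
  rewrite EFinB -sumEFin; congr (_ - _)%E; apply: eq_bigr => j _; exact: rE'.
have Fu : mf_functional mu A c u = (energy A c u - \sum_j r j)%:E.
  rewrite EFinB -sumEFin; congr (_ - _)%E; apply: eq_bigr => j _; exact: rE.
have := umax _ cz; rewrite Fz Fu lee_fin.
have -> : energy A c z = energy A c u + (v - u i 0) * t.
  have e1 := energy_upd (fun j => u j 0) i v.
  have e2 := energy_upd (fun j => u j 0) i (u i 0).
  rewrite -uE in e2; rewrite /z e1 e2 -/t.
  by move: (energy A c _) => e; ring.
have -> : \sum_j r' j = \sum_j r j + (v * t - psi (mu i) t - r i).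
  rewrite (bigD1 i)//= [in RHS](bigD1 i)//= {1}/r' /upd eqxx.
  rewrite (eq_bigr r) /r'; first by ring.
  by move=> j /negPf ji; rewrite /upd ji.
move=> H; apply: (psi_argmin mi) => eta.
have := rate_ge bi eta (u1 i); rewrite rE lee_fin.
move: H; move: (energy A c u) (\sum_j r j) (psi (mu i) t) (psi (mu i) eta) => a b p p'.
by lra.
Qed.

End mean_field.

(** * Conditional laws under the Gibbs measure *)

Section resampling.
Context {R : realType}.

Definition tupd {n} (s : n.-tuple R) (i : 'I_n) (z : R) : n.-tuple R :=
  [tuple upd (tnth s) i z j | j < n].

Lemma measurable_tupd n (i : 'I_n) :
  measurable_fun setT (fun p : n.-tuple R * R => tupd p.1 i p.2).
Proof.
apply/measurable_fun_tnthP => j.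
rewrite (_ : _ \o _ = fun p : n.-tuple R * R => if j == i then p.2 else tnth p.1 j).
  case: (j == i); first exact: measurable_snd.
  by apply: (measurableT_comp (measurable_tnth j)); exact: measurable_fst.
by apply: funext => p /=; rewrite tnth_mktuple.
Qed.

Lemma tupd_cons0 n (x : R) (t : n.-tuple R) z :
  tupd [tuple of x :: t] ord0 z = [tuple of z :: t].
Proof.
apply: eq_from_tnth => j; rewrite tnth_mktuple /upd.
by case: (unliftP ord0 j) => [k|] -> //=; rewrite !tnthS.
Qed.

Lemma tupd_consS n (x : R) (t : n.-tuple R) j z :
  tupd [tuple of x :: t] (lift ord0 j) z = [tuple of x :: tupd t j z].
Proof.
apply: eq_from_tnth => l; rewrite tnth_mktuple /upd.
case: (unliftP ord0 l) => [k|] -> //=; rewrite !tnthS tnth_mktuple /upd.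
by rewrite (inj_eq lift_inj).
Qed.

(** Redrawing one coordinate from its own law leaves a product measure invariant. *)
Lemma integral_resample n (mu : 'I_n -> probability R R) (i : 'I_n)
    (k : n.-tuple R -> \bar R) :
  measurable_fun setT k -> (forall s, 0 <= k s)%E ->
  (\int[prod_prob mu]_s k s = \int[prod_prob mu]_s \int[mu i]_z k (tupd s i z))%E.
Proof.
elim: n mu i k => [mu []//|n IH] mu i k mk k0.
have minner : measurable_fun setT (fun s => \int[mu i]_z k (tupd s i z))%E.
  have := @measurable_fun_fubini_tonelli_F _ _ _ _ _ (mu i)
    (fun p : n.+1.-tuple R * R => k (tupd p.1 i p.2)).
  apply=> //; exact: (measurableT_comp mk (measurable_tupd i)).
have inner0 s : (0 <= \int[mu i]_z k (tupd s i z))%E by exact: integral_ge0.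
rewrite /= !ge0_integral_distribution//.
have mcons : measurable_fun setT (k \o @tuple_cons R n).
  exact: (measurableT_comp mk (@measurable_tuple_cons R n)).
have minner' : measurable_fun setT
    ((fun s => \int[mu i]_z k (tupd s i z))%E \o @tuple_cons R n).
  exact: (measurableT_comp minner (@measurable_tuple_cons R n)).
have kc0 p : (0 <= (k \o @tuple_cons R n) p)%E by exact: k0.
rewrite [LHS](fubini_tonelli1 _ mcons kc0) [RHS](fubini_tonelli1 _ minner' (fun=> inner0 _)).
case: (unliftP ord0 i) => [j|] ij.
- apply: eq_integral => x _; rewrite /fubini_F /=.
  rewrite (IH _ j (fun t => k (@tuple_cons R n (x, t))))//.
    apply: eq_integral => t _; rewrite ij; apply: eq_integral => z _.
    by rewrite /tuple_cons tupd_consS.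
  apply: (measurableT_comp mcons); exact: measurable_pair1.
(* For the head coordinate the resampled integrand no longer depends on [x], which integrates to
   total mass 1. *)
- rewrite -(fubini_tonelli1 _ mcons kc0) (fubini_tonelli2 _ mcons kc0).
  rewrite [RHS](_ : _ = \int[mu ord0]_x
    \int[prod_prob (fun i : 'I_n => mu (lift ord0 i))]_t \int[mu ord0]_z k (@tuple_cons R n (z, t)))%E.
    rewrite integral_cst//= probability_setT mule1.
    by [].
  apply: eq_integral => x _; rewrite /fubini_F /=; apply: eq_integral => t _.
  by rewrite ij; apply: eq_integral => z _; rewrite /tuple_cons tupd_cons0.
Qed.

End resampling.

(** * The Gibbs expectation on the cube *)

Section gibbs_expectation.
Context {R : realType} {n : nat} (mu : 'I_n -> probability R R).
Variables (A : 'M[R]_n) (c : 'cV[R]_n).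
Hypothesis muI : forall i, mu i `[-1, 1]%classic = 1%E.

Local Notation P := (prod_prob mu).
Local Notation T := (n.-tuple R).

Definition Qcube : set T := [set s | in_cube (tnth s)].

Lemma measurable_Qcube : measurable Qcube.
Proof.
rewrite [X in measurable X](_ : _ =
   \bigcap_(i in [set: 'I_n]) ((@tnth n R)^~ i @^-1` `[-1, 1]%classic)).
  apply: fin_bigcap_measurable => // i _.
  by rewrite -[X in measurable X]setTI; exact: measurable_tnth.
apply/seteqP; split=> [s H i _|s H i].
  by rewrite /= in_itv/= -ler_norml; exact: H.
by rewrite ler_norml; have := H i I; rewrite /= in_itv.
Qed.

Lemma prob_Qcube : P Qcube = 1%E.
Proof.
have := @prod_prob_box R n mu (fun=> `[-1, 1]%classic) (fun=> measurable_itv _).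
rewrite big1; last by move=> i _; exact: muI.
move=> <-; congr (P _); apply/seteqP; split=> s H i /=.
  by rewrite /= in_itv/= -ler_norml; exact: H.
by rewrite ler_norml; have := H i; rewrite /= in_itv.
Qed.

Let PQ_fin : (P Qcube < +oo)%E. Proof. by rewrite prob_Qcube ltry. Qed.

(** Boundedness is asked only on the cube, so that coordinates and energies belong to the class;
    integrals are accordingly restricted to [Qcube], which has full mass. *)
Definition cube_bounded (h : ('I_n -> R) -> R) : Prop :=
  measurable_fun setT (fun s : T => h (tnth s)) /\
  exists K, forall x, in_cube x -> `|h x| <= K.

Lemma cube_bounded_integrable h : cube_bounded h ->
  P.-integrable Qcube (EFin \o (fun s : T => h (tnth s))).
Proof.
move=> [mh [K hK]]; apply: measurable_bounded_integrable => //.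
- exact: measurable_Qcube.
- exact: measurable_funTS.
- exists K; split; first exact: num_real.
  by move=> x Kx s Qs /=; rewrite (le_trans _ (ltW Kx))// hK.
Qed.

Lemma cube_bounded_cst a : cube_bounded (fun=> a).
Proof. by split; [exact: measurable_cst|exists `|a|]. Qed.

Lemma cube_bounded_coord i : cube_bounded (fun x => x i).
Proof. by split; [exact: measurable_tnth|exists 1 => x /(_ i)]. Qed.

Lemma cube_boundedD f g : cube_bounded f -> cube_bounded g ->
  cube_bounded (fun x => f x + g x).
Proof.
move=> [mf [K fK]] [mg [L gL]]; split; first exact: measurable_funD.
exists (K + L) => x cx; apply: (le_trans (ler_normD _ _)).
by apply: lerD; [exact: fK|exact: gL].
Qed.

Lemma cube_boundedM f g : cube_bounded f -> cube_bounded g ->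
  cube_bounded (fun x => f x * g x).
Proof.
move=> [mf [K fK]] [mg [L gL]]; split; first exact: measurable_funM.
exists (K * L) => x cx; rewrite normrM.
by apply: ler_pM => //; [exact: fK|exact: gL].
Qed.

Lemma cube_bounded_comp g f : locally_bounded_measurable g -> cube_bounded f ->
  cube_bounded (fun x => g (f x)).
Proof.
move=> [mg lg] [mf [K fK]]; split; first exact: (measurableT_comp mg mf).
by have [L gL] := lg K; exists L => x cx; apply: gL; exact: fK.
Qed.

Lemma cube_bounded_upd i f : cube_bounded f -> cube_bounded (fun x => f (upd x i 0)).
Proof.
move=> [mf [K fK]]; split; last first.
  exists K => x cx; apply: fK => j; rewrite /upd.
  by case: eqP => // _; rewrite normr0.
have mt : measurable_fun setT (fun s : T => tupd s i 0).
  exact: (measurableT_comp (measurable_tupd i) (@pair2_measurable _ _ T R 0)).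
have := measurableT_comp mf mt; congr measurable_fun.
by apply: funext => s /=; congr f; apply: funext => j; rewrite tnth_mktuple.
Qed.

Lemma cube_bounded_sum (F : 'I_n -> ('I_n -> R) -> R) :
  (forall i, cube_bounded (F i)) -> cube_bounded (fun x => \sum_i F i x).
Proof.
move=> aF; elim: (index_enum _) => [|i r IH].
  by under eq_fun do rewrite big_nil; exact: cube_bounded_cst.
by under eq_fun do rewrite big_cons; exact: cube_boundedD.
Qed.

Let En (x : 'I_n -> R) := energy A c (\col_j x j).
Let W x := expR (En x).

Let cube_bounded_En : cube_bounded En.
Proof.
rewrite (_ : En = fun x => 2^-1 * (\sum_j (\sum_k x k * A k j) * x j) +
  \sum_j c j 0 * x j); last first.
  apply: funext => x; rewrite /En /energy !mxE; congr (_ * _ + _).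
    apply: eq_bigr => j _; rewrite !mxE; congr (_ * _).
    by apply: eq_bigr => k _; rewrite !mxE.
  by apply: eq_bigr => j _; rewrite !mxE.
apply: cube_boundedD; last first.
  apply: cube_bounded_sum => j; apply: cube_boundedM.
    exact: cube_bounded_cst.
  exact: cube_bounded_coord.
apply: cube_boundedM; first exact: cube_bounded_cst.
apply: cube_bounded_sum => j; apply: cube_boundedM; last exact: cube_bounded_coord.
apply: cube_bounded_sum => k; apply: cube_boundedM; first exact: cube_bounded_coord.
exact: cube_bounded_cst.
Qed.

Lemma cube_bounded_W : cube_bounded W.
Proof.
apply: (@cube_bounded_comp expR En) => //; apply: continuous_lbm.
exact: continuous_expR.
Qed.

Definition wint (h : ('I_n -> R) -> R) : R :=
  \int[P]_(s in Qcube) (h (tnth s) * W (tnth s)).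

Let integrable_hW h : cube_bounded h ->
  P.-integrable Qcube (EFin \o (fun s : T => h (tnth s) * W (tnth s))).
Proof.
move=> ah; exact: (cube_bounded_integrable (cube_boundedM ah cube_bounded_W)).
Qed.

Lemma wint1_gt0 : 0 < wint (fun=> 1).
Proof.
have [_ [K HK]] := cube_bounded_En.
apply: (@lt_le_trans _ _ (\int[P]_(s in Qcube) expR (- K))).
  rewrite Rintegral_cst//; last exact: measurable_Qcube.
  rewrite (_ : fine _ = 1) ?mulr1 ?expR_gt0//; exact: (congr1 fine prob_Qcube).
apply: le_Rintegral.
- exact: measurable_Qcube.
- exact: (cube_bounded_integrable (cube_bounded_cst _)).
- exact: (integrable_hW (cube_bounded_cst _)).
- move=> s /HK; rewrite mul1r ler_norml => /andP[+ _].
  by rewrite /W ler_expR.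
Qed.

Definition gEx h : R := wint h / wint (fun=> 1).

Lemma gExD f g : cube_bounded f -> cube_bounded g ->
  gEx (fun x => f x + g x) = gEx f + gEx g.
Proof.
move=> af ag; rewrite /gEx -mulrDl; congr (_ / _).
rewrite /wint -RintegralD//; last 3 first.
- exact: measurable_Qcube.
- exact: integrable_hW.
- exact: integrable_hW.
by apply: eq_Rintegral => s _; rewrite mulrDl.
Qed.

Lemma gExZ a f : cube_bounded f -> gEx (fun x => a * f x) = a * gEx f.
Proof.
move=> af; rewrite /gEx mulrA; congr (_ / _).
rewrite /wint -RintegralZl//; last 2 first.
- exact: measurable_Qcube.
- exact: integrable_hW.
by apply: eq_Rintegral => s _; rewrite mulrA.
Qed.

Lemma gEx_le f g : cube_bounded f -> cube_bounded g ->
  (forall x, in_cube x -> f x <= g x) -> gEx f <= gEx g.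
Proof.
move=> af ag fg; rewrite /gEx ler_wpM2r ?invr_ge0 ?(ltW wint1_gt0)//.
apply: le_Rintegral.
- exact: measurable_Qcube.
- exact: integrable_hW.
- exact: integrable_hW.
- by move=> s Qs; rewrite ler_wpM2r ?expR_ge0// fg.
Qed.

Definition gibbs_expectation : cube_expectation n :=
  CubeExpectation cube_bounded_cst cube_bounded_coord cube_boundedD cube_boundedM
    cube_bounded_comp cube_bounded_upd gExD gExZ gEx_le (divff (lt0r_neq0 wint1_gt0)).

Section resampled_coordinate.
Hypothesis Asym : A^T = A.
Hypothesis Adiag : forall i, A i i = 0.

Local Notation theta := (lfield (fun i j => A i j) (fun i => c i 0)).

(** After resampling coordinate [i], the weight is a factor free of [z] times the tilt by the local
    field, so the inner integral is a multiple of the one assumed to vanish. *)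
Lemma wint_resample0 (i : 'I_n) (k : ('I_n -> R) -> R) : cube_bounded k ->
  (forall x, in_cube (upd x i 0) -> \int[mu i]_(z in `[-1, 1]%classic)
     (k (upd x i z) * expR (theta i x * z)) = 0) ->
  wint k = 0.
Proof.
move=> ak k0.
have aF := integrable_hW ak.
pose F : T -> \bar R := (fun s => (k (tnth s) * W (tnth s))%:E) \_ Qcube.
have iF : P.-integrable setT F by apply/(integrable_mkcond _ measurable_Qcube).
have mF : measurable_fun setT F by case/integrableP : iF.
have wE : (\int[P]_s F s)%E = (wint k)%:E.
  rewrite -integral_mkcond /wint /Rintegral fineK//.
  exact: (integrable_fin_num measurable_Qcube aF).
(* [integral_resample] concerns nonnegative functions, so positive and negative parts are resampled
   separately and shown to have equal inner integrals. *)
have inner s : (\int[mu i]_z F^\+%E (tupd s i z) = \int[mu i]_z F^\-%E (tupd s i z))%E.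
  pose G z := F (tupd s i z).
  have -> : (\int[mu i]_z F^\+%E (tupd s i z) = \int[mu i]_z G^\+%E z)%E.
    by apply: eq_integral => z _; rewrite !funeposE.
  have -> : (\int[mu i]_z F^\-%E (tupd s i z) = \int[mu i]_z G^\-%E z)%E.
    by apply: eq_integral => z _; rewrite !funenegE.
  have tE z : tnth (tupd s i z) = upd (tnth s) i z.
    by apply: funext => j; rewrite tnth_mktuple.
  have mtup : measurable_fun setT (fun z => tupd s i z).
    exact: (measurableT_comp (measurable_tupd i) (@pair1_measurable _ _ T R s)).
  have mI : measurable (`[-1, 1]%classic : set R) by [].
  have muI_fin : (mu i `[(-1)%R, 1%R]%classic < +oo)%E by rewrite muI ltry.
  (* If another coordinate leaves [-1, 1], the integrand vanishes whatever value is drawn for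
     [i]. *)
  have [cs|ncs] := pselect (in_cube (upd (tnth s) i 0)); last first.
    have G0 z : G z = 0%E.
      rewrite /G /F patchE memNset//; rewrite /Qcube /= tE => H; apply: ncs => j.
      by have := H j; rewrite /upd; case: eqP => // _ _; rewrite normr0.
    by apply: eq_integral => z _; rewrite funeposE funenegE G0 oppe0.
  pose g z := k (upd (tnth s) i z) * W (upd (tnth s) i z).
  have GE : G = (fun z => (g z)%:E) \_ `[-1, 1]%classic.
    apply: funext => z; rewrite /G /F !patchE.
    have -> : (tupd s i z \in Qcube) = (z \in `[-1, 1]%classic).
      apply/idP/idP => /set_mem H; apply/mem_set.
        have := H i; rewrite tE /upd eqxx ler_norml.
        by rewrite /= in_itv.
      move=> j; rewrite tE /upd; case: eqP => [_|/eqP ji].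
        by move: H; rewrite /= in_itv/= ler_norml.
      by have := cs j; rewrite /upd (negPf ji).
    by rewrite tE.
  have EW z : W (upd (tnth s) i z) =
      W (upd (tnth s) i 0) * expR (theta i (tnth s) * z).
    by rewrite /W /En (energy_upd c Asym Adiag (tnth s) i z) expRD [z * _]mulrC.
  have [mk [K kK]] := cube_boundedM ak cube_bounded_W.
  have mg : measurable_fun setT g.
    have := measurableT_comp mk mtup; congr measurable_fun.
    by apply: funext => z /=; rewrite tE.
  have ig : (mu i).-integrable `[-1, 1]%classic (EFin \o g).
    apply: measurable_bounded_integrable => //.
    - exact: measurable_funTS.
    - exists K; split; first exact: num_real.
      move=> y Ky z /= Iz; rewrite (le_trans _ (ltW Ky))// kK//.
      move=> j; rewrite /upd; case: eqP => [_|/eqP ji].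
        by move: Iz; rewrite in_itv/= ler_norml.
      by have := cs j; rewrite /upd (negPf ji).
  have iG : (mu i).-integrable setT G by rewrite GE; apply/(integrable_mkcond _ mI).
  have G0 : (\int[mu i]_z G z = 0)%E.
    rewrite GE -integral_mkcond.
    have <- : ((\int[mu i]_(z in `[(-1)%R, 1%R]%classic) g z)%:E =
        \int[mu i]_(z in `[(-1)%R, 1%R]%classic) (g z)%:E)%E.
      by rewrite /Rintegral fineK//; exact: (integrable_fin_num mI ig).
    congr EFin.
    transitivity (\int[mu i]_(z in `[-1, 1]%classic) (W (upd (tnth s) i 0) *
        (k (upd (tnth s) i z) * expR (theta i (tnth s) * z)))).
      by apply: eq_Rintegral => z _; rewrite /g (EW z); ring.
    rewrite RintegralZl//; first by rewrite k0// mulr0.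
    have := integrableZl mI (W (upd (tnth s) i 0))^-1 ig.
    apply: eq_integrable => // z _ /=; rewrite /g (EW z) -EFinM; congr EFin.
    by rewrite mulrCA mulKf// gt_eqF// expR_gt0.
  move: G0; rewrite integralE => /eqP.
  rewrite sube_eq.
  - by rewrite add0e => /eqP.
  - exact: integrable_pos_fin_num.
  - by apply: fin_num_adde_defl; exact: integrable_neg_fin_num.
have := wE; rewrite integralE.
rewrite (@integral_resample _ _ mu i F^\+%E); last 2 first.
- exact: measurable_funepos.
- exact: funepos_ge0.
rewrite [X in (_ - X)%E](@integral_resample _ _ mu i F^\-%E); last 2 first.
- exact: measurable_funeneg.
- exact: funeneg_ge0.
rewrite (eq_integral _ _ (fun s _ => inner s)) subee.
  by move=> [].
rewrite -(@integral_resample _ _ mu i F^\-%E).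
- exact: integrable_neg_fin_num.
- exact: measurable_funeneg.
- exact: funeneg_ge0.
Qed.

End resampled_coordinate.
End gibbs_expectation.

Section gibbs_conditional.
Context {R : realType} {n : nat} (mu : 'I_n -> probability R R).
Variables (A : 'M[R]_n) (c : 'cV[R]_n).
Hypothesis muI : forall i, mu i `[-1, 1]%classic = 1%E.
Hypothesis Asym : A^T = A.
Hypothesis Adiag : forall i, A i i = 0.

Local Notation Af := (fun i j => A i j).
Local Notation cf := (fun i => c i 0).
Local Notation B := (fun i => tmom (mu i) 1).
Local Notation V := (fun i => tvar (mu i)).
Local Notation E := (gibbs_expectation A c muI).

Lemma tmom_lbm i : locally_bounded_measurable (tmom (mu i) 1).
Proof.
apply: continuous_lbm => x; apply: differentiable_continuous; apply/derivable1_diffP.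
by case: (tmom_derive (muI i) 1 x).
Qed.

Lemma tvar_lbm i : locally_bounded_measurable (tvar (mu i)).
Proof.
apply: continuous_lbm => x; apply: differentiable_continuous; apply/derivable1_diffP.
by case: (tvar_derive (muI i) x).
Qed.

Lemma adm_lfield i : adm E (lfield Af cf i).
Proof.
apply: admD; last exact: adm_cst.
by apply: adm_bigsum => j; apply: admM; [exact: adm_cst|exact: adm_coord].
Qed.

Lemma lfield_upd i (x : 'I_n -> R) z : lfield Af cf i (upd x i z) = lfield Af cf i x.
Proof.
rewrite /lfield; congr (_ + _); apply: eq_bigr => j _; rewrite /upd.
by case: eqP => // ->; rewrite Adiag !mul0r.
Qed.

(* Conditionally on the other coordinates, the i-th one follows [mu i] tilted by
   the local field, so quadratic functions of it can be integrated out. *)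
Lemma gibbs_quadratic0 i (p0 p1 p2 : ('I_n -> R) -> R) h :
  adm E (fun x => (p0 x + p1 x * x i + p2 x * x i ^+ 2) * h x) ->
  (forall x z, p0 (upd x i z) = p0 x) -> (forall x z, p1 (upd x i z) = p1 x) ->
  (forall x z, p2 (upd x i z) = p2 x) -> (forall x z, h (upd x i z) = h x) ->
  (forall x, p0 x + p1 x * tmom (mu i) 1 (lfield Af cf i x) +
     p2 x * tmom (mu i) 2 (lfield Af cf i x) = 0) ->
  Ex E (fun x => (p0 x + p1 x * x i + p2 x * x i ^+ 2) * h x) = 0.
Proof.
move=> ak p0E p1E p2E hE p_eq0.
rewrite /Ex /= /gEx (@wint_resample0 _ _ _ A c muI Asym Adiag i _ ak) ?mul0r//.
move=> x _; set t := lfield Af cf i x.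
transitivity (\int[mu i]_(z in `[-1, 1]%classic)
   ((h x * p0 x + h x * p1 x * z + h x * p2 x * z ^+ 2) * expR (t * z))).
  apply: eq_Rintegral => z _; rewrite p0E p1E p2E hE /upd eqxx; ring.
rewrite emom_quadratic//.
have m0 := emom0_gt0 (muI i) t.
have eE k : emom (mu i) k t = emom (mu i) 0 t * tmom (mu i) k t.
  by rewrite /tmom mulrC divfK// gt_eqF.
rewrite (eE 1%N) (eE 2%N).
transitivity (h x * emom (mu i) 0 t *
  (p0 x + p1 x * tmom (mu i) 1 t + p2 x * tmom (mu i) 2 t)); first by ring.
by rewrite p_eq0 mulr0.
Qed.

Lemma gibbs_resid i h : adm E h -> (forall x z, h (upd x i z) = h x) ->
  Ex E (fun x => resid Af cf B i x * h x) = 0.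
Proof.
move=> ah hE.
pose p0 x := - tmom (mu i) 1 (lfield Af cf i x).
have EE : (fun x => resid Af cf B i x * h x) =
    (fun x => (p0 x + 1 * x i + 0 * x i ^+ 2) * h x).
  by apply: funext => x; rewrite /resid /p0; ring.
have ak : adm E (fun x => (p0 x + 1 * x i + 0 * x i ^+ 2) * h x).
  rewrite -EE; apply: admM => //; apply: admB; first exact: adm_coord.
  exact: (adm_comp (tmom_lbm i) (adm_lfield i)).
have p0E x z : p0 (upd x i z) = p0 x by rewrite /p0 lfield_upd.
have cst1 (x : 'I_n -> R) (z : R) : (fun=> 1 : R) (upd x i z) = (fun=> 1 : R) x by [].
have cst0 (x : 'I_n -> R) (z : R) : (fun=> 0 : R) (upd x i z) = (fun=> 0 : R) x by [].
rewrite EE; apply: (gibbs_quadratic0 ak p0E cst1 cst0 hE) => x.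
by rewrite /p0 mul1r mul0r addr0 addNr.
Qed.

Lemma gibbs_cvar i h : adm E h -> (forall x z, h (upd x i z) = h x) ->
  Ex E (fun x => (resid Af cf B i x ^+ 2 - cvar Af cf V i x) * h x) = 0.
Proof.
move=> ah hE.
pose b x := tmom (mu i) 1 (lfield Af cf i x).
pose p0 x := b x ^+ 2 - tvar (mu i) (lfield Af cf i x).
pose p1 x := - 2 * b x.
have EE : (fun x => (resid Af cf B i x ^+ 2 - cvar Af cf V i x) * h x) =
    (fun x => (p0 x + p1 x * x i + 1 * x i ^+ 2) * h x).
  by apply: funext => x; rewrite /resid /cvar /p0 /p1 /b; ring.
have ak : adm E (fun x => (p0 x + p1 x * x i + 1 * x i ^+ 2) * h x).
  rewrite -EE; apply: admM => //; apply: admB.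
    apply: admX; apply: admB; first exact: adm_coord.
    exact: (adm_comp (tmom_lbm i) (adm_lfield i)).
  exact: (adm_comp (tvar_lbm i) (adm_lfield i)).
have p0E x z : p0 (upd x i z) = p0 x by rewrite /p0 /b lfield_upd.
have p1E x z : p1 (upd x i z) = p1 x by rewrite /p1 /b lfield_upd.
have cst1 (x : 'I_n -> R) (z : R) : (fun=> 1 : R) (upd x i z) = (fun=> 1 : R) x by [].
rewrite EE; apply: (gibbs_quadratic0 ak p0E p1E cst1 hE) => x.
rewrite /p0 /p1 -/(b x) /tvar -/(b x).
by move: (b x) (tmom _ 2 _) => y y2; ring.
Qed.

Lemma gibbs_high_temperature (rho al : R) : 0 < rho < 1 ->
  (forall x : 'I_n -> R,
    \sum_i (\sum_j A i j * x j) ^+ 4 <= rho ^+ 4 * \sum_i x i ^+ 4) ->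
  (forall i, \sum_j A i j ^+ 2 <= al) -> 0 <= al <= 1 ->
  high_temperature Af cf B V E rho al.
Proof.
move=> rho01 A4 alA al01; split => //.
- by move=> i j; rewrite -{1}Asym mxE.
- by move=> i t; exact: tmom_le1.
- by move=> i t; exact: tvar01.
- exact: tmom_lbm.
- exact: tvar_lbm.
- move=> i s t; rewrite -[leRHS]mul1r distrC [`|s - t|]distrC.
  apply: (mean_value_le (tmom_derive (muI i) 1)) => x _.
  have /andP[v0 v1] := tvar01 (muI i) x.
  by rewrite -expr2 -/(tvar _ _) ger0_norm.
- move=> i s t; rewrite distrC [`|s - t|]distrC.
  apply: (mean_value_le (tvar_derive (muI i))) => x _; exact: tvar_der_le.
- move=> i s t; have := @taylor1_le R _ _ _ s (s + t) 6 (tmom_derive (muI i) 1).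
  rewrite (_ : s + t - s = t); last by ring.
  move=> H; have := H (tvar_der (mu i)) => {}H.
  rewrite /tvar expr2; apply: H => [x|x _]; last exact: tvar_der_le.
  by have := tvar_derive (muI i) x; rewrite /tvar; under eq_fun do rewrite expr2.
- exact: gibbs_resid.
- exact: gibbs_cvar.
Qed.

End gibbs_conditional.

(** * Comparison of distribution functions *)

Section normal_cdf.
Context {R : realType} (s : R).
Hypothesis s_neq0 : s != 0.
Local Notation p := (normal_pdf 0 s).

Lemma normal_pdf0E x : p x = normal_peak s * expR (- x ^+ 2 / (s ^+ 2 *+ 2)).
Proof. by rewrite normal_pdfE// /normal_fun subr0. Qed.

Lemma normal_pdf_gt0 x : 0 < p x.
Proof. by rewrite normal_pdf0E mulr_gt0 ?expR_gt0 ?normal_peak_gt0. Qed.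

Lemma normal_pdf_derive (x : R) : is_derive x 1 p (- (x / s ^+ 2) * p x).
Proof.
have pE : p = (normal_peak s) *: (expR \o (fun y => (- (s ^+ 2 *+ 2)^-1) * (y * y))).
  apply: funext => y; rewrite normal_pdf0E /GRing.scale/=; congr (_ * expR _).
  by rewrite expr2; ring.
have h1 : is_derive x 1 (fun y : R => (- (s ^+ 2 *+ 2)^-1) * (y * y))
    (- (s ^+ 2 *+ 2)^-1 * (x + x)).
  have := is_deriveZ (- (s ^+ 2 *+ 2)^-1)
    (is_deriveM (@is_derive_id R R x 1) (@is_derive_id R R x 1)).
  by move/is_derive_eq; apply; rewrite /GRing.scale/= !mulr1.
have h2 := @is_derive1_comp R expR _ x _ _
  (is_derive_expR (- (s ^+ 2 *+ 2)^-1 * (x * x))) h1.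
have := is_deriveZ (normal_peak s) h2.
rewrite [X in _ -> is_derive _ _ X _]pE; move/is_derive_eq; apply.
rewrite normal_pdf0E /GRing.scale/=.
have -> : - (s ^+ 2 *+ 2)^-1 * (x * x) = - x ^+ 2 / (s ^+ 2 *+ 2) by ring.
by move: (expR _) => e; field.
Qed.

Definition normal_cdf x : R :=
  \int[lebesgue_measure]_(t in `]-oo, x]) normal_pdf 0 s t.

Lemma normal_cdf_derive (x : R) : is_derive x 1 normal_cdf (p x).
Proof.
have xu : x < x + 1 by rewrite ltrDl.
have ip : (@lebesgue_measure R).-integrable `]-oo, (x + 1)] (EFin \o p).
  by apply: (integrableS measurableT) => //; exact: integrable_normal_pdf.
have cp : {for x, continuous p} by exact: continuous_normal_pdf.
have [d1 d2] := @continuous_FTC1 R p -oo%O x (x + 1) xu ip (ltNyr x) cp.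
by apply: DeriveDef; [exact: d1|rewrite -derive1E].
Qed.

Lemma normal_probE x : fine (normal_prob 0 s `]-oo, x]) = normal_cdf x.
Proof. by []. Qed.

End normal_cdf.

Section normal_law.
Context {R : realType} d (T : measurableType d) (P : probability T R).
Variables (W : {RV P >-> R}) (s : R).
Hypothesis Wlaw : has_law W (normal_prob 0 s).

Lemma has_law_cdf x : P [set w | W w <= x] = normal_prob 0 s `]-oo, x].
Proof.
by rewrite -Wlaw.
Qed.

Lemma cdfE : cdf W = fun x => P [set w | W w <= x].
Proof.
by apply: funext.
Qed.

(** Identifying [normal_cdf] with the distribution function of [W] supplies its bounds and its
    limits at infinity. *)
Let fineE : normal_cdf s = fine \o cdf W.
Proof. by apply: funext => x; rewrite -normal_probE -has_law_cdf /= cdfE. Qed.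

Lemma normal_cdf01 x : 0 <= normal_cdf s x <= 1.
Proof.
rewrite fineE /=; apply/andP; split; first by rewrite fine_ge0// cdf_ge0.
by rewrite -[leRHS]/(fine 1%E) fine_le// ?cdf_le1// fin_num_measure.
Qed.

Lemma normal_cdf_pinfty : normal_cdf s x @[x --> +oo] --> (1 : R).
Proof. by rewrite fineE; apply: fine_cvg; exact: cvg_cdfy1. Qed.

Lemma normal_cdf_ninfty : normal_cdf s x @[x --> -oo] --> (0 : R).
Proof. by rewrite fineE; apply: fine_cvg; exact: cvg_cdfNy0. Qed.

End normal_law.

Section gibbs_law.
Context {R : realType} {n : nat} (mu : 'I_n -> probability R R).
Variables (A : 'M[R]_n) (c q u : 'cV[R]_n).
Hypothesis muI : forall i, mu i `[-1, 1]%classic = 1%E.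
Local Notation E := (gibbs_expectation A c muI).
Local Notation Pi := (prod_prob mu).

Let outside0 : Pi (~` Qcube) = 0%E.
Proof.
rewrite probability_setC; last exact: measurable_Qcube.
by rewrite prob_Qcube// subee.
Qed.

Let measurable_gw : measurable_fun setT (gibbs_weight A c : n.-tuple R -> R).
Proof. by have [] := cube_bounded_W A c. Qed.

Let gw_gt0 s : 0 < gibbs_weight A c s. Proof. exact: expR_gt0. Qed.

Let partition_funE : partition_fun mu A c = wint mu A c (fun=> 1).
Proof.
rewrite /partition_fun /wint /Rintegral.
rewrite (@ge0_negligible_integral _ _ _ Pi setT (~` Qcube)).
- rewrite setTD setCK; congr fine; apply: eq_integral => s _.
  by rewrite mul1r.
- by apply: measurableC; exact: measurable_Qcube.
- by [].
- exact/measurable_EFinP.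
- by move=> s _; rewrite lee_fin ltW.
- exact: outside0.
Qed.

Let measurable_Tstar : measurable_fun setT (Tstar q u : n.-tuple R -> R).
Proof.
have [] // := @adm_clin R n E (fun i => u i 0) (fun i => q i 0).
Qed.

Lemma gibbs_le d (T : measurableType d) (P : probability T R)
    (sigma : {RV P >-> n.-tuple R}) t : has_law sigma (gibbs mu A c) ->
  fine (P [set w | Tstar q u (sigma w) <= t]) =
  Ex E (fun x => (clin (fun i => u i 0) (fun i => q i 0) x <= t)%R%:R).
Proof.
move=> law; pose B := [set s : n.-tuple R | Tstar q u s <= t].
pose Z := partition_fun mu A c.
have Z0 : 0 < Z by rewrite /Z partition_funE; exact: wint1_gt0.
have mB : measurable B.
  rewrite -[X in measurable X]setTI /B.
  rewrite (_ : [set s | _] = Tstar q u @^-1` `]-oo, t]); last first.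
    by apply/seteqP; split=> s /=; rewrite in_itv.
  exact: measurable_Tstar.
have -> : P [set w | Tstar q u (sigma w) <= t] = gibbs mu A c B by rewrite -law.
have mf : measurable_fun B (fun s => (gibbs_weight A c s / Z)%:E).
  apply/measurable_EFinP; apply: measurable_funTS.
  by apply: measurable_funM.
have mQc : measurable (~` Qcube : set (n.-tuple R)).
  by apply: measurableC; exact: measurable_Qcube.
have f0 s : B s -> (0 <= (gibbs_weight A c s / Z)%:E)%E.
  by move=> _; rewrite lee_fin divr_ge0 ?ltW.
rewrite /gibbs -/Z (ge0_negligible_integral mQc mB mf f0 outside0).
rewrite setDE setCK setIC integral_mkcondr.
rewrite /Ex /= /gEx -partition_funE -/Z /wint mulrC -RintegralZl; last 2 first.
- exact: measurable_Qcube.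
- have ac := adm_comp (lbm_le t) (@adm_clin R n E (fun i => u i 0) (fun i => q i 0)).
  exact: (cube_bounded_integrable muI (cube_boundedM ac (cube_bounded_W A c))).
rewrite /Rintegral; congr fine; apply: eq_integral => s _; rewrite patchE.
rewrite (_ : (s \in B) = (clin (fun i => u i 0) (fun i => q i 0) (tnth s) <= t)).
  case: ifP => h; first by rewrite /= mul1r mulrC.
  by rewrite /= mul0r mulr0.
by apply/idP/idP => [/set_mem//|h]; exact: mem_set.
Qed.

End gibbs_law.

Section operator_norm.
Context {R : realType} {n : nat}.

Lemma lpnormX p (x : 'cV[R]_n) : (0 < p)%N ->
  lpnorm p x ^+ p = \sum_i `|x i 0| ^+ p.
Proof.
move=> p0; rewrite /lpnorm -powR_mulrn ?powR_ge0// -powRrM mulVf ?powRr1//.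
  by apply: sumr_ge0 => i _; exact: exprn_ge0.
by rewrite pnatr_eq0 -lt0n.
Qed.

Lemma opnorm4_bound (A : 'M[R]_n) rho : opnorm 4 A <= rho -> 0 <= rho ->
  forall x : 'I_n -> R,
  \sum_i (\sum_j A i j * x j) ^+ 4 <= rho ^+ 4 * \sum_i x i ^+ 4.
Proof.
move=> Arho rho0.
have e4 (y : R) : `|y| ^+ 4 = y ^+ 4.
  by rewrite -[4%N]/(2 * 2)%N !exprM real_normK ?num_real.
have l4 (y : 'cV[R]_n) : lpnorm 4 y ^+ 4 = \sum_i y i 0 ^+ 4.
  by rewrite lpnormX//; apply: eq_bigr => i _; rewrite e4.
have l0 (y : 'cV[R]_n) : 0 <= lpnorm 4 y by exact: powR_ge0.
have sup_le (y : 'cV[R]_n) : lpnorm 4 y <= 1 -> lpnorm 4 (A *m y) <= rho.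
  move=> y1; apply: le_trans Arho; apply: ub_le_sup; last by exists y.
  (* A real [sup] bounds its elements only if the set has an upper bound; this crude one provides
     it. *)
  pose K := \sum_i \sum_j `|A i j|.
  exists ((n%:R * K ^+ 4) `^ (4%:R^-1)) => _ [z z1 <-].
  have K0 : 0 <= K by apply: sumr_ge0 => i _; apply: sumr_ge0.
  apply: ge0_ler_powR; rewrite ?nnegrE ?invr_ge0//.
  - by apply: sumr_ge0 => i _; exact: exprn_ge0.
  - by rewrite mulr_ge0// exprn_ge0.
  rewrite mulr_natl -[n in leRHS]card_ord -sumr_const; apply: ler_sum => i _.
  rewrite ler_pXn2r ?nnegrE// mxE; apply: (le_trans (ler_norm_sum _ _ _)).
  apply: (@le_trans _ _ (\sum_j `|A i j|)); last first.
    by rewrite /K [leRHS](bigD1 i)//= lerDl; apply: sumr_ge0 => k _; apply: sumr_ge0.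
  apply: ler_sum => j _; rewrite normrM ler_piMr//.
  rewrite -(@ler_pXn2r _ 4)// ?nnegrE// expr1n.
  have : lpnorm 4 z ^+ 4 <= 1 by rewrite exprn_ile1.
  by apply: le_trans; rewrite lpnormX// (bigD1 j)//= lerDl sumr_ge0// => k _; exact: exprn_ge0.
move=> x; set N := \sum_i x i ^+ 4.
have N0 : 0 <= N by apply: sumr_ge0 => i _; rewrite -e4 exprn_ge0.
pose X : 'cV[R]_n := \col_i x i.
have XN : lpnorm 4 X ^+ 4 = N.
  by rewrite l4; apply: eq_bigr => i _; rewrite mxE.
have AXE i : (A *m X) i 0 = \sum_j A i j * x j.
  by rewrite mxE; apply: eq_bigr => j _; rewrite mxE.
(* The bound follows by homogeneity from the unit ball, which requires a nonzero norm to divide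
   by. *)
have [X0|Xn0] := eqVneq (lpnorm 4 X) 0.
  have N_eq0 : N = 0 by rewrite -XN X0 expr0n.
  have x0 i : x i = 0.
    have : x i ^+ 4 <= 0.
      rewrite -N_eq0 /N (bigD1 i)//= lerDl sumr_ge0// => k _.
      by rewrite -e4 exprn_ge0.
    rewrite -e4 => h; have : `|x i| ^+ 4 == 0 by rewrite eq_le h exprn_ge0.
    by rewrite expf_eq0/= normr_eq0 => /eqP.
  rewrite N_eq0 mulr0 big1// => i _; rewrite big1 ?expr0n// => j _.
  by rewrite x0 mulr0.
set a := lpnorm 4 X in XN Xn0 *.
have a0 : 0 < a by rewrite lt_def Xn0 l0.
have lZ (y : 'cV[R]_n) : lpnorm 4 (a^-1 *: y) ^+ 4 = a^-1 ^+ 4 * lpnorm 4 y ^+ 4.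
  by rewrite !l4 mulr_sumr; apply: eq_bigr => i _; rewrite mxE exprMn.
have : lpnorm 4 (a^-1 *: X) <= 1.
  rewrite -(@ler_pXn2r _ 4)// ?nnegrE// lZ expr1n -/a -exprMn mulVf ?expr1n//.
move=> /sup_le; rewrite -scalemxAr -(@ler_pXn2r _ 4)// ?nnegrE//.
rewrite lZ exprVn mulrC ler_pdivrMr ?exprn_gt0// XN l4.
by under eq_bigr do rewrite AXE.
Qed.

End operator_norm.

Section constants.
Context {R : realType} (rho kappa : R).
Hypothesis rho01 : 0 < rho < 1.
Hypothesis kappa01 : 0 < kappa < 1.

Let D := (1 - rho)^-1.

(** For variances [v] between kappa / 2 and [D], the density at 1 and -1 is at least e^(-1/kappa) /
    sqrt(2 pi D). The second summand is the inverse of this bound; the first makes the constant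
    dominate [v]. *)
Definition mills_cst : R := D + Num.sqrt (D * pi *+ 2) * expR kappa^-1.

(** [stein_step_cst] with 1 / v replaced by its upper bound 2 / kappa. *)
Definition test_cst : R := mills_cst + 4 + (mills_cst + 4) * (2 / kappa).

Let D_gt0 : 0 < D. Proof. by rewrite invr_gt0 subr_gt0; case/andP: rho01. Qed.

Lemma mills_cst_ge0 : 0 <= mills_cst.
Proof. by rewrite addr_ge0 ?(ltW D_gt0)// mulr_ge0 ?sqrtr_ge0 ?expR_ge0. Qed.

Lemma test_cst_ge0 : 0 <= test_cst.
Proof.
have k0 : 0 <= 2 / kappa by rewrite divr_ge0// ltW//; case/andP: kappa01.
have M0 := mills_cst_ge0.
have M4 : 0 <= mills_cst + 4 by rewrite addr_ge0.
by rewrite /test_cst addr_ge0// mulr_ge0.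
Qed.

Variable v : R.
Hypothesis v_bounds : kappa / 2 <= v <= D.

Let v_gt0 : 0 < v.
Proof.
have /andP[kv _] := v_bounds; apply: lt_le_trans kv.
by rewrite divr_gt0//; case/andP: kappa01.
Qed.

Lemma le_mills_cst : v <= mills_cst.
Proof.
have /andP[_ vD] := v_bounds; apply: (le_trans vD).
by rewrite lerDl mulr_ge0 ?sqrtr_ge0 ?expR_ge0.
Qed.

Lemma mills_cst_pdf x : x ^+ 2 = 1 -> 1 <= mills_cst * normal_pdf 0 (Num.sqrt v) x.
Proof.
move=> x2; have s0 : Num.sqrt v != 0 by rewrite gt_eqF// sqrtr_gt0.
have /andP[kv vD] := v_bounds.
have pk : 0 < v * pi *+ 2 by rewrite pmulrn_lgt0// mulr_gt0// pi_gt0.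
rewrite normal_pdf0E// x2 /normal_peak sqr_sqrtr ?(ltW v_gt0)//.
have Dv : Num.sqrt (v * pi *+ 2) <= Num.sqrt (D * pi *+ 2).
  by rewrite ler_wsqrtr// lerMn2r/= ler_wpM2r// pi_ge0.
have ev : expR (- kappa^-1) <= expR (- 1 / (v *+ 2)).
  have /andP[k0 _] := kappa01.
  rewrite ler_expR mulN1r lerN2 lef_pV2 ?posrE ?pmulrn_lgt0//.
  by move: kv; rewrite ler_pdivrMr// mulr_natr.
apply: (@le_trans _ _ (Num.sqrt (D * pi *+ 2) * expR kappa^-1 *
   ((Num.sqrt (v * pi *+ 2))^-1 * expR (- kappa^-1)))).
  rewrite expRN mulrACA divff ?gt_eqF ?expR_gt0// mulr1 ler_pdivlMr ?mul1r//.
  by rewrite sqrtr_gt0.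
apply: ler_pM.
- by rewrite mulr_ge0 ?sqrtr_ge0 ?expR_ge0.
- by rewrite mulr_ge0 ?invr_ge0 ?sqrtr_ge0 ?expR_ge0.
- by rewrite lerDr ltW.
- by rewrite ler_wpM2l ?invr_ge0 ?sqrtr_ge0.
Qed.

Lemma stein_step_cst_le : stein_step_cst v mills_cst <= test_cst.
Proof.
have /andP[kv _] := v_bounds; have /andP[k0 _] := kappa01.
rewrite /stein_step_cst /test_cst lerD2l; apply: ler_wpM2l.
  by rewrite addr_ge0// mills_cst_ge0.
by rewrite -[2 / kappa]invf_div lef_pV2 ?posrE ?divr_gt0.
Qed.

End constants.

Section row_norms.
Context {R : realType} {n : nat} (A : 'M[R]_n).

Lemma alpha_ge0 : 0 <= alpha A.
Proof. by rewrite /alpha; apply: bigmax_ge_id. Qed.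

Lemma alpha_row i : \sum_j A i j ^+ 2 <= alpha A.
Proof. exact: (le_bigmax _ (fun i => \sum_j A i j ^+ 2)). Qed.

(** The l2 bound is applied to the basis vectors, whose images are the columns of [A]. *)
Lemma alpha_le1 (rho : R) : 0 <= rho <= 1 -> (forall i j, A i j = A j i) ->
  (forall x : 'I_n -> R,
    \sum_i (\sum_j A i j * x j) ^+ 2 <= rho ^+ 2 * \sum_i x i ^+ 2) ->
  alpha A <= 1.
Proof.
move=> /andP[rho0 rho1] Asym A2; apply: bigmax_le => // i _.
have e k : \sum_j A k j * (j == i)%:R = A k i.
  rewrite (bigD1 i)//= eqxx mulr1 big1 ?addr0// => j /negPf ->.
  by rewrite mulr0.
have := A2 (fun j => (j == i)%:R).
rewrite (eq_bigr (fun k => A i k ^+ 2)); last by move=> k _; rewrite e Asym.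
move=> /le_trans; apply.
rewrite (bigD1 i)//= eqxx expr1n big1 ?addr0 ?mulr1; first by rewrite expr_le1.
by move=> j /negPf ->; rewrite expr0n.
Qed.

Lemma le_mx_norm (q : 'cV[R]_n) i : `|q i 0| <= mx_norm q.
Proof.
rewrite mx_normrE.
exact: (le_bigmax _ (fun ij : 'I_n * 'I_1 => `|q ij.1 ij.2|) (i, 0)).
Qed.

Lemma mx_norm_le1 (q : 'cV[R]_n) : \sum_i q i 0 ^+ 2 = 1 -> mx_norm q <= 1.
Proof.
move=> q1; rewrite mx_normrE; apply: bigmax_le => // -[i j] _ /=.
rewrite (ord1 j) -(@expr_le1 _ 2)// real_normK ?num_real// -q1.
by rewrite (bigD1 i)//= lerDl sumr_ge0// => k _; exact: sqr_ge0.
Qed.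

End row_norms.

(** * Assembly with constants uniform in the model *)

Theorem theorem2p4 (R : realType) (rho kappa : R)
    (hrho : 0 < rho < 1) (hkappa : 0 < kappa < 1) :
  exists2 C : R, 0 < C &
  forall (n : nat) (mu : 'I_n -> probability R R) (A : 'M[R]_n)
    (c q u : 'cV[R]_n) (lambda : R)
    (d : measure_display) (T : measurableType d) (P : probability T R)
    (sigma : {RV P >-> n.-tuple R})
    (d' : measure_display) (T' : measurableType d') (P' : probability T' R)
    (W : {RV P' >-> R}),
  (forall i, base_measure (mu i)) ->
  A^T = A ->
  (forall i, A i i = 0) ->
  has_law sigma (gibbs mu A c) ->
  opnorm 4 A <= rho ->
  lpnorm 2 q = 1 ->
  mf_optimizer mu A c u ->
  kappa <= upsilon mu c q ->
  `|lambda| <= rho ->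
  has_law W (normal_prob 0
    (Num.sqrt (upsilon mu c q / (1 - lambda * upsilon mu c q)))) ->
  dKS P P' (fun w => Tstar q u (sigma w)) W <=
    C * (Num.sqrt (R1 mu A c q)
         + Num.sqrt (alpha A * R2 mu A c)
         + Num.sqrt (R3 mu A c)
         + Num.sqrt n%:R * alpha A
         + mx_norm q
         + lpnorm 2 (A *m q - lambda *: q)).
Proof.
have /andP[rho_gt0 rho_lt1] := hrho; have /andP[kappa_gt0 kappa_lt1] := hkappa.
pose K : R := 366.
have K_ge0 : 0 <= K by exact: ler0n.
pose C1 := stein_cst rho K (test_cst rho kappa).
(* The summand 1 covers the range where [an] exceeds 1; dividing by [kappa] removes the factor [ups]
   of the Stein equation. *)
exists (1 + `|C1| / kappa).
  by rewrite ltr_pwDl// divr_ge0// ltW.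
move=> n mu A c q u lambda d T P sigma d' T' P' W.
move=> bmu Asym Adiag law Aop q1 uopt ups_ge lam_le Wlaw.
have muI i : mu i `[-1, 1]%classic = 1%E by case: (bmu i).
have Asym' i j : A i j = A j i by rewrite -{1}Asym mxE.
have A4 := opnorm4_bound Aop (ltW rho_gt0).
have A2 := l2_le_l4 rho_gt0 Asym' A4.
have al0 := alpha_ge0 A.
have al1 : alpha A <= 1.
  by apply: (@alpha_le1 _ _ A rho) => //; rewrite !ltW.
have al01 : 0 <= alpha A <= 1 by rewrite al0.
have HT := gibbs_high_temperature c muI Asym Adiag hrho A4 (alpha_row A) al01.
set ups := upsilon mu c q in ups_ge Wlaw *.
have qq : \sum_i q i 0 ^+ 2 = 1.
  have := lpnormX q (isT : (0 < 2)%N); rewrite q1 expr1n => ->.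
  by apply: eq_bigr => i _; rewrite real_normK ?num_real.
have upsE : ups = \sum_i q i 0 ^+ 2 * tvar (mu i) (c i 0).
  by apply: eq_bigr => i _; rewrite (psi2E (muI i)).
have r1_ge0 : 0 <= Num.sqrt (R1 mu A c q) by exact: sqrtr_ge0.
have r3_ge0 : 0 <= Num.sqrt (R3 mu A c) by exact: sqrtr_ge0.
have eps_ge0 : 0 <= lpnorm 2 (A *m q - lambda *: q) by exact: powR_ge0.
have r1E : \sum_i (\sum_j A i j * q j 0 * (tvar (mu j) (c j 0) - ups)) ^+ 2 <=
    Num.sqrt (R1 mu A c q) ^+ 2.
  rewrite sqr_sqrtr; last by apply: sumr_ge0 => i _; exact: sqr_ge0.
  rewrite le_eqVlt; apply/orP; left; apply/eqP; apply: eq_bigr => i _.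
  by congr (_ ^+ 2); apply: eq_bigr => j _; rewrite (psi2E (muI j)).
have r3E : \sum_i (\sum_j A i j * tmom (mu j) 1 (c j 0)) ^+ 4 <=
    Num.sqrt (R3 mu A c) ^+ 2.
  rewrite sqr_sqrtr; last first.
    by apply: sumr_ge0 => i _; rewrite -[4%N]/(2 * 2)%N exprM sqr_ge0.
  rewrite le_eqVlt; apply/orP; left; apply/eqP; apply: eq_bigr => i _.
  by congr (_ ^+ 4); apply: eq_bigr => j _; rewrite (psi1E (muI j)).
have epsE : \sum_i (\sum_j A i j * q j 0 - lambda * q i 0) ^+ 2 <=
    lpnorm 2 (A *m q - lambda *: q) ^+ 2.
  rewrite lpnormX// le_eqVlt; apply/orP; left; apply/eqP; apply: eq_bigr => i _.
  by rewrite real_normK ?num_real// !mxE.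
have qQ i : `|q i 0| <= mx_norm q by exact: le_mx_norm.
have Q_ge0 : 0 <= mx_norm q by rewrite mx_normrE; exact: bigmax_ge_id.
set an := Num.sqrt n%:R * alpha A.
have an_ge0 : 0 <= an by rewrite mulr_ge0 ?sqrtr_ge0.
have al_an : n%:R * alpha A ^+ 2 <= an ^+ 2.
  by rewrite exprMn sqr_sqrtr.
set err := (X in _ <= _ * X).
set r2 := Num.sqrt (alpha A * R2 mu A c) in err *.
have r2_ge0 : 0 <= r2 by exact: sqrtr_ge0.
have C1k : 0 <= `|C1| / kappa by rewrite divr_ge0// ltW.
have err_ge0 : 0 <= err.
  by rewrite /err; do ! apply: addr_ge0.
apply: ge_sup => [|_ [t _ <-]].
  by exists `|fine (P [set w | Tstar q u (sigma w) <= 0]) - fine (P' [set w | W w <= 0])|, 0.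
rewrite (gibbs_le q u muI t law) (has_law_cdf Wlaw) normal_probE.
have N01 := normal_cdf01 Wlaw.
(* A difference of probabilities is at most 1, so the claim is immediate when the error already
   exceeds 1. *)
have [an1|an_gt1] := leP an 1; last first.
  apply: (@le_trans _ _ 1).
    have at_ := adm_comp (lbm_le t) (@adm_clin _ _ (gibbs_expectation A c muI)
      (fun i => u i 0) (fun i => q i 0)).
    have P0 := Ex_ge0 at_ (fun x _ => ler0n R _).
    have P1 := Ex_le_cst (a := 1) at_ (fun x _ => ltac:(by rewrite lern1 leq_b1)).
    by have /andP[? ?] := N01 t; rewrite ler_norml; apply/andP; split; lra.
  have : 1 <= err by rewrite /err; lra.
  by move=> e1; rewrite -[leLHS]mulr1; apply: ler_pM => //; rewrite lerDl.
have an01 : 0 <= an <= 1 by rewrite an_ge0.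
have uE i : u i 0 = tmom (mu i) 1 (\sum_j A i j * u j 0 + c i 0).
  exact: (mf_fixed_point bmu Asym Adiag uopt).
have ups_gt0 : 0 < ups by exact: lt_le_trans ups_ge.
have ups1 : ups <= 1.
  exact: (ups_le1 HT qq upsE).
have lam_ups : `|lambda * ups| <= rho.
  rewrite normrM [`|ups|]gtr0_norm// -[leRHS]mulr1.
  by apply: ler_pM => //; exact: ltW.
have a_gt0 : 1 - rho <= 1 - lambda * ups <= 2.
  by move: lam_ups; rewrite ler_norml => /andP[? ?]; apply/andP; split; lra.
set v := ups / (1 - lambda * ups) in Wlaw.
(* The numerator lies between [kappa] and 1, the denominator between [1 - rho] and 2. *)
have v_bounds : kappa / 2 <= v <= (1 - rho)^-1.
  have /andP[h1 h2] := a_gt0.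
  have a0 : 0 < 1 - lambda * ups by apply: lt_le_trans h1; rewrite subr_gt0.
  apply/andP; split.
    by apply: ler_pM; rewrite ?invr_ge0 ?(ltW kappa_gt0)// lef_pV2 ?posrE.
  rewrite -[leRHS]mul1r; apply: ler_pM; rewrite ?invr_ge0 ?(ltW ups_gt0) ?(ltW a0)//.
  by rewrite lef_pV2 ?posrE// subr_gt0.
have v_gt0 : 0 < v.
  by have /andP[h _] := v_bounds; apply: lt_le_trans h; rewrite divr_gt0.
have s_neq0 : Num.sqrt v != 0 by rewrite gt_eqF// sqrtr_gt0.
have sv : Num.sqrt v ^+ 2 = v by rewrite sqr_sqrtr// ltW.
pose N := normal_cdf (Num.sqrt v); pose p := normal_pdf 0 (Num.sqrt v).
have dN (x : R) : is_derive x 1 N (p x) by exact: normal_cdf_derive.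
have dp (x : R) : is_derive x 1 p (- (x / v) * p x).
  by rewrite -[in X in is_derive _ _ _ X]sv; exact: normal_pdf_derive.
have p_gt0 x : 0 < p x by exact: normal_pdf_gt0.
have Npoo := normal_cdf_pinfty Wlaw.
have Nnoo := normal_cdf_ninfty Wlaw.
pose M := mills_cst rho kappa.
have M0 : 0 <= M by exact: mills_cst_ge0.
have Mp : 1 <= M * p 1.
  by apply: (mills_cst_pdf hrho hkappa v_bounds); rewrite expr1n.
have MpN : 1 <= M * p (-1).
  by apply: (mills_cst_pdf hrho hkappa v_bounds); rewrite sqrrN expr1n.
have vM : v <= M by exact: le_mills_cst v_bounds.
pose C := test_cst rho kappa.
have C0 : 0 <= C by exact: test_cst_ge0.
have KC : stein_step_cst v M <= C by exact: stein_step_cst_le.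
have MC : M <= C.
  apply: le_trans KC; rewrite /stein_step_cst -addrA lerDl addr_ge0//.
  by rewrite divr_ge0 ?(ltW v_gt0)// addr_ge0.
have lf := stein_sol_lbm t v_gt0 dN dp p_gt0 N01 Npoo Nnoo Mp MpN M0 vM.
have lphi : locally_bounded_measurable (stein_der N p v t).
  exact: (stein_der_lbm t v_gt0 dN dp p_gt0 N01 Npoo Nnoo Mp MpN M0 vM).
have fC w : `|stein_sol N p t w| <= C.
  exact: le_trans (stein_sol_le t v_gt0 dN dp p_gt0 N01 Npoo Nnoo Mp MpN M0 vM w) MC.
have phi2 w : `|stein_der N p v t w| <= 2.
  exact: (stein_der_le t v_gt0 dN dp p_gt0 N01 Npoo Nnoo).
have Q1 : mx_norm q <= 1 by exact: mx_norm_le1.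
have step w y : `|y| <= 2 * mx_norm q ->
    `|stein_sol N p t w - stein_sol N p t (w - y) - y * stein_der N p v t w| <=
    C * (1 + `|w|) * y ^+ 2 + C * `|y| * (`|w - t| <= 2 * mx_norm q)%R%:R.
  have Q2 : 2 * mx_norm q <= 2 by rewrite ler_piMr.
  move=> yQ.
  apply: (le_trans (stein_sol_step t v_gt0 dN dp p_gt0 N01 Npoo Nnoo Mp MpN M0 vM w Q2 yQ)).
  apply: lerD.
    by apply: ler_wpM2r; [exact: sqr_ge0|apply: ler_wpM2r; rewrite ?addr_ge0].
  by apply: ler_wpM2r => //; exact: ler_wpM2r.
have eqn w : ups * stein_der N p v t w - (1 - lambda * ups) * w * stein_sol N p t w =
     ups * ((w <= t)%R%:R - N t).
  exact: (stein_equation N p t v_gt0 w ups_gt0 erefl).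
have HK := Ex_lin_expr4 HT.
have main := stein_comparison HT K_ge0 HK uE an01 al_an qq qQ upsE r1_ge0 r3_ge0
  eps_ge0 r1E r3E epsE C0 lf lphi fC phi2 step eqn.
apply: (@le_trans _ _ (`|C1| / kappa * err)); last first.
  by apply: ler_wpM2r => //; rewrite lerDr.
rewrite mulrAC ler_pdivlMr// mulrC.
apply: (le_trans (ler_wpM2r (normr_ge0 _) ups_ge)).
apply: (le_trans main).
set err0 := (X in _ * X <= _).
have err0_le : 0 <= err0 <= err.
  by rewrite /err0 /err; apply/andP; split; lra.
have /andP[e0 e1] := err0_le.
apply: (le_trans (ler_wpM2r e0 (ler_norm _))).
by apply: ler_wpM2l.
Qed.
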